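(* Let $n\ge 2$, $1\le k\le n-1$, let $q\in(1,n+1]$ be an integer, and let $p=\frac{nq}{n-k+kq}$. Let $$A_0=\sup_{\{f:\ \|f\|_{L^p}=1,\ f=f^*\}}\frac{\|T_{n,k}f\|_{L^q(\mathcal{M}_{n,k})}}{\|f\|_{L^p(\mathbb{R}^n)}},$$ and let $\{f_j\}$ be an extremizing sequence for this supremum. Then there exist a subsequence (still denoted $f_j$), a sequence $\sigma_j\in(0,\infty)$, and a non-zero function $f\in L^p(\mathbb{R}^n)$ such that $|\sigma_j|^{-n/p}f_j(\sigma_j^{-1}x)$, which is again an extremizing sequence, converges to $f$ in $L^p(\mathbb{R}^n)$. In particular, the supremum defining $A_0$ is attained.
   Context: $f^*$ denotes the symmetric decreasing rearrangement of $f$ on $\mathbb{R}^n$, so $f=f^*$ means that $f$ is nonnegative, radial and nonincreasing in $|x|$. An extremizing sequence for the supremum is a sequence of functions $f_j$ with $\|f_j\|_{L^p}=1$, $f_j=f_j^*$ and $\|T_{n,k}f_j\|_{L^q(\mathcal{M}_{n,k})}\to A_0$. $\mathcal{G}_{n,k}$ is the Grassmann manifold of $k$-dimensional linear subspaces of $\mathbb{R}^n$ with its rotation-invariant probability measure $d\theta$. $\mathcal{M}_{n,k}$ is the manifold of affine $k$-planes in $\mathbb{R}^n$, parametrized by $(\theta,y)$ with $\theta\in\mathcal{G}_{n,k}$, $y\in\theta^\perp$, equipped with the measure $d\lambda_{\theta^\perp}(y)\,d\theta$ ($\lambda_{\theta^\perp}$ Lebesgue measure on $\theta^\perp$). The $k$-plane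 transform is $T_{n,k}f(\theta,y)=\int_{\theta}f(x+y)\,d\lambda_\theta(x)$ with $\lambda_\theta$ Lebesgue measure on $\theta$; it is known to be bounded from $L^p(\mathbb{R}^n)$ to $L^q(\mathcal{M}_{n,k})$ for these exponents. *)

(* Defs.v *)
From HB Require Import structures.
From mathcomp Require Import all_boot all_order all_algebra.
From mathcomp Require Import all_classical all_reals all_analysis.
From mathcomp Require Import measurable_realfun.

Set Implicit Arguments.
Unset Strict Implicit.
Unset Printing Implicit Defensive.

Import Order.TTheory GRing.Theory Num.Theory.
Import numFieldNormedType.Exports.

Local Open Scope classical_set_scope.
Local Open Scope ring_scope.

Definition measure_mx_display : measure_display -> measure_display.
Proof. exact. Qed.

Section measurable_matrix.
Context {d} {T : measurableType d} (m n : nat).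

Definition mx_cylinders : set (set 'M[T]_(m, n)) :=
  [set A | exists i j B,
     measurable B /\ A = (fun M : 'M[T]_(m, n) => M i j) @^-1` B].

Let mx0 : <<s mx_cylinders >> set0.
Proof. exact: sigma_algebra0. Qed.

Let mxC A : <<s mx_cylinders >> A -> <<s mx_cylinders >> (~` A).
Proof. exact: sigma_algebraC. Qed.

Let mx_bigcup (F : (set 'M[T]_(m, n))^nat) :
  (forall i, <<s mx_cylinders >> (F i)) ->
  <<s mx_cylinders >> (\bigcup_i F i).
Proof. exact: sigma_algebra_bigcup. Qed.

HB.instance Definition _ := @isMeasurable.Build (measure_mx_display d)
  'M[T]_(m, n) <<s mx_cylinders >> mx0 mxC mx_bigcup.

Lemma measurable_mxE (i : 'I_m) (j : 'I_n) :
  measurable_fun [set: 'M[T]_(m, n)] (fun M : 'M[T]_(m, n) => M i j).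
Proof.
move=> _ B mB; rewrite setTI; apply: sub_sigma_algebra.
by exists i, j, B.
Qed.

Lemma measurable_fun_mx d' (X : measurableType d') (f : X -> 'M[T]_(m, n)) :
  (forall i j, measurable_fun [set: X] (fun x => f x i j)) ->
  measurable_fun [set: X] f.
Proof.
move=> mf; apply: (@measurability _ _ _ _ _ _ mx_cylinders) => //.
move=> _ [_ [i [j [B [mB ->]]]] <-].
by rewrite setTI -comp_preimage -[X in measurable X]setTI; exact: mf.
Qed.

End measurable_matrix.

Section rV_cons.
Context {R : realType} (n : nat).

Definition rV_cons (x : measurableTypeR R * 'rV[R]_n) : 'rV[R]_n.+1 :=
  row_mx (x.1%:M : 'rV_1) x.2.

Definition rV_uncons (v : 'rV[R]_n.+1) : measurableTypeR R * 'rV[R]_n :=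
  (v 0 ord0, \row_i v 0 (lift ord0 i)).

Lemma rV_cons0 x : rV_cons x 0 ord0 = x.1.
Proof.
rewrite /rV_cons.
have -> : ord0 = lshift n (ord0 : 'I_1) :> 'I_(1 + n) by apply: val_inj.
by rewrite (@row_mxEl _ 1 1 n) mxE eqxx.
Qed.

Lemma rV_consS x i : rV_cons x 0 (lift ord0 i) = x.2 0 i.
Proof.
rewrite /rV_cons.
have -> : lift ord0 i = rshift 1 i :> 'I_(1 + n) by apply: val_inj.
by rewrite (@row_mxEr _ 1 1 n).
Qed.

Lemma rV_consK : cancel rV_cons rV_uncons.
Proof.
move=> [x v]; rewrite /rV_uncons rV_cons0; congr (_, _).
by apply/rowP => i; rewrite mxE rV_consS.
Qed.

Lemma measurable_rV_cons : measurable_fun setT rV_cons.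
Proof.
apply: measurable_fun_mx => i j; rewrite (ord1 i).
case: (unliftP ord0 j) => [k ->|->].
- under eq_fun do rewrite rV_consS.
  exact: measurableT_comp (measurable_mxE 0 k) measurable_snd.
- under eq_fun do rewrite rV_cons0.
  exact: measurable_fst.
Qed.

HB.instance Definition _ :=
  isMeasurableFun.Build _ _ _ _ rV_cons measurable_rV_cons.

Lemma measurable_rV_uncons : measurable_fun setT rV_uncons.
Proof.
apply/measurable_fun_pairP; split; first exact: measurable_mxE.
apply: measurable_fun_mx => i j; rewrite /rV_uncons /=.
under eq_fun do rewrite mxE.
exact: measurable_mxE.
Qed.

End rV_cons.

Section lebesgue_rVS.
Context {R : realType} (n : nat).
Variable mu : {sigma_finite_measure set 'rV[R]_n -> \bar R}.

Definition lebesgue_rVS : set 'rV[R]_n.+1 -> \bar R :=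
  pushforward (lebesgue_measure \x mu)%E (@rV_cons R n).

Let lebesgue_rVS0 : lebesgue_rVS set0 = 0%E. Proof. exact: measure0. Qed.

Let lebesgue_rVS_ge0 A : (0 <= lebesgue_rVS A)%E.
Proof. exact: measure_ge0. Qed.

Let lebesgue_rVS_sigma_additive : semi_sigma_additive lebesgue_rVS.
Proof. exact: measure_semi_sigma_additive. Qed.

HB.instance Definition _ := isMeasure.Build _ _ _ lebesgue_rVS
  lebesgue_rVS0 lebesgue_rVS_ge0 lebesgue_rVS_sigma_additive.

Let sigma_finite_lebesgue_rVS : sigma_finite setT lebesgue_rVS.
Proof.
have /sigma_finiteP[F [FT Fnd Ffin]] := sigma_finiteT (@lebesgue_measure R).
have /sigma_finiteP[G [GT Gnd Gfin]] := sigma_finiteT mu.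
exists (fun i => @rV_uncons R n @^-1` (F i `*` G i)).
  apply/esym; rewrite -subTset => v _.
  have [i _ Fi] : (\bigcup_i F i) (rV_uncons v).1 by rewrite -FT.
  have [j _ Gj] : (\bigcup_i G i) (rV_uncons v).2 by rewrite -GT.
  exists (maxn i j) => //; split.
    by move: Fi; apply/subsetPset/Fnd; exact: leq_maxl.
  by move: Gj; apply/subsetPset/Gnd; exact: leq_maxr.
move=> i; have [mF Foo] := Ffin i; have [mG Goo] := Gfin i; split.
  rewrite -[X in measurable X]setTI; apply: measurable_rV_uncons => //.
  exact: measurableX.
rewrite /lebesgue_rVS /pushforward -comp_preimage.
have -> : (@rV_uncons R n \o @rV_cons R n) = id.
  by apply/funext => x /=; rewrite rV_consK.
rewrite preimage_id product_measure1E//.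
by rewrite lte_mul_pinfty// ge0_fin_numE.
Qed.

HB.instance Definition _ := @Measure_isSigmaFinite.Build _ _ _
  lebesgue_rVS sigma_finite_lebesgue_rVS.

End lebesgue_rVS.

Fixpoint lebesgue_rV {R : realType} (n : nat) :
    {sigma_finite_measure set 'rV[R]_n -> \bar R} :=
  if n is n'.+1 then lebesgue_rVS (lebesgue_rV n') else \d_(0 : 'rV[R]_0).

Lemma lebesgue_rV_box {R : realType} (n : nat) (A : 'I_n -> set R) :
  (forall i, measurable (A i)) ->
  lebesgue_rV n [set v : 'rV[R]_n | forall i, A i (v 0 i)] =
  (\prod_(i < n) lebesgue_measure (A i))%E.
Proof.
elim: n A => [|n IHn] A mA.
  rewrite big_ord0 /= diracE (_ : _ \in _ = true)//.
  by apply/mem_set => -[].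
rewrite big_ord_recl -IHn//= /lebesgue_rVS /pushforward.
rewrite -product_measure1E//; last first.
  rewrite [X in measurable X](_ : _ = \bigcap_(i in [set: 'I_n])
    ((fun v : 'rV[R]_n => v 0 i) @^-1` A (lift ord0 i))).
    apply: fin_bigcap_measurable => // i _.
    by rewrite -[X in measurable X]setTI; exact: measurable_mxE.
  by apply/seteqP; split => [v vA i _|v vA i] /=; exact: vA.
  exact: mA.
congr (product_measure1 _ _ _); apply/seteqP; split => [x /= xA|x /= [xA0 xA] i].
  split; first by have := xA ord0; rewrite rV_cons0.
  by move=> i /=; have := xA (lift ord0 i); rewrite rV_consS.
by case: (unliftP ord0 i) => [j ->|->]; rewrite ?rV_consS ?rV_cons0.
Qed.

Section subspaces.
Context {R : realType} {n : nat}.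
Implicit Types (V : {vspace 'rV[R]_n}) (x y : 'rV[R]_n).

Definition dotrV x y : R := (x *m y^T) 0 0.

Definition enorm x : R := Num.sqrt (dotrV x x).

Definition is_onb V (B : 'M[R]_(\dim V, n)) : Prop :=
  B *m B^T = 1%:M /\ forall x, x \in V <-> exists u, x = u *m B.
Arguments is_onb : clear implicits.

Lemma dotrV_gt0 x : x != 0 -> 0 < dotrV x x.
Proof.
move=> x0; have sq i : x 0 i * x^T i 0 = x 0 i ^+ 2 by rewrite mxE expr2.
rewrite /dotrV mxE lt0r; under eq_bigr do rewrite sq.
apply/andP; split; last by apply: sumr_ge0 => i _; exact: sqr_ge0.
apply: contra x0 => /eqP /psumr_eq0P x0; apply/eqP/rowP => i.
apply/eqP; rewrite mxE -(sqrf_eq0 (x 0 i)); apply/eqP.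
by apply: x0 => // j _; exact: sqr_ge0.
Qed.

Let orthonormal_rows V (m : nat) : (m <= \dim V)%N ->
  exists B : 'M[R]_(m, n), B *m B^T = 1%:M /\ forall u, u *m B \in V.
Proof.
elim: m => [_|m IHm mV].
  exists 0; split; first by apply/matrixP => -[].
  by move=> u; rewrite mulmx0 mem0v.
have [B [BB BV]] := IHm (ltnW mV).
pose h : 'Hom('rV[R]_n, 'rV[R]_m) := linfun (mulmxr B^T).
have : (\dim (V :&: lker h) != 0)%N.
  have := limg_ker_dim h V.
  have : (\dim (h @: V) <= m)%N.
    by apply: leq_trans (dimvS (subvf _)) _; rewrite dimvf dim_matrix mul1r.
  move: mV; case: (\dim (V :&: lker h)) => //.
  by move=> mV + E; rewrite -E add0n in mV *; rewrite leqNgt mV.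
rewrite dimv_eq0 => /negPf /negbT; set W := (V :&: _)%VS => W0.
have := vpick0 W; rewrite (negbTE W0) => /negbT w0.
have := memv_pick W; rewrite memv_cap memv_ker => /andP[wV].
rewrite lfunE /= => /eqP wB.
move: wV w0 wB; set w := vpick W => wV w0 wB.
have w0' := dotrV_gt0 w0.
pose e := (enorm w)^-1 *: w.
have ee : e *m e^T = 1%:M.
  rewrite [LHS]mx11_scalar; congr (_%:M).
  rewrite /e linearZ /= -scalemxAl -scalemxAr !mxE -/(dotrV w w).
  rewrite [X in _ * (_ * X)](_ : _ = dotrV w w); last by rewrite /dotrV mxE.
  by rewrite mulrA -expr2 exprVn sqr_sqrtr ?ltW// mulVf// gt_eqF.
have eB : e *m B^T = 0 by rewrite /e -scalemxAl wB scaler0.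
have Be : B *m e^T = 0 by rewrite -[LHS]trmxK trmx_mul trmxK eB trmx0.
suff [C CP] : exists C : 'M[R]_(1 + m, n),
  C *m C^T = 1%:M /\ forall u, u *m C \in V by exists C.
exists (col_mx e B); split.
  by rewrite tr_col_mx mul_col_row ee eB Be BB -scalar_mx_block.
move=> u; rewrite -[u]hsubmxK mul_row_col rpredD// ?BV//.
by rewrite [lsubmx _]mx11_scalar mul_scalar_mx /e !rpredZ.
Qed.

Lemma onb_exists V : exists B, is_onb V B.
Proof.
have [B [BB BV]] := orthonormal_rows (leqnn (\dim V)).
exists B; split => // x; split => [xV|[u ->] //].
pose h : 'Hom('rV[R]_(\dim V), 'rV[R]_n) := linfun (mulmxr B).
suff : x \in limg h.
  by case/memv_imgP => u _ ->; exists u; rewrite lfunE.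
suff <- : V = limg h by [].
apply/eqP; rewrite eq_sym eqEdim; apply/andP; split.
  by apply/subvP => _ /memv_imgP[u _ ->]; rewrite lfunE /=.
rewrite limg_dim_eq ?dimvf ?dim_matrix ?mul1r//.
apply/eqP; rewrite -subv0; apply/subvP => u; rewrite memv_cap memv_ker.
case/andP=> _; rewrite lfunE /= => /eqP uB.
by rewrite memv0 -[u]mulmx1 -BB mulmxA uB mul0mx.
Qed.

Definition onb V : 'M[R]_(\dim V, n) := xget 0 [set B | is_onb V B].

Lemma onbP V : is_onb V (onb V).
Proof. by have [B BV] := onb_exists V; exact: (@xgetI _ _ _ B). Qed.

(* Orthogonal projection onto V, acting on row vectors by x |-> x *m _ *)
Definition orthoproj V : 'M[R]_n := (onb V)^T *m onb V.

Definition perp V : {vspace 'rV[R]_n} := lker (linfun (mulmxr (orthoproj V))).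

Lemma memv_perp V x : x \in perp V <-> forall y, y \in V -> dotrV x y = 0.
Proof.
have [BB BV] := onbP V; rewrite memv_ker lfunE /= /orthoproj; split.
  move=> /eqP xB y /BV[u ->]; rewrite /dotrV trmx_mul.
  suff xB0 : x *m (onb V)^T = 0 by rewrite mulmxA xB0 mul0mx mxE.
  by rewrite -[LHS]mulmx1 -BB !mulmxA -[x *m _ *m _]mulmxA xB mul0mx.
move=> xV; apply/eqP; rewrite mulmxA (_ : x *m _ = 0) ?mul0mx//.
apply/rowP => i; rewrite [RHS]mxE.
have /xV : delta_mx 0 i *m onb V \in V by apply/BV; exists (delta_mx 0 i).
by rewrite /dotrV -rowE mxE => <-; rewrite !mxE; apply: eq_bigr => j _; rewrite !mxE.
Qed.

Definition mulmx_onb V (u : 'rV[R]_(\dim V)) : 'rV[R]_n := u *m onb V.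

Arguments mulmx_onb : clear implicits.

Lemma measurable_mulmx_onb V : measurable_fun setT (mulmx_onb V).
Proof.
apply: measurable_fun_mx => i j; rewrite /mulmx_onb.
under eq_fun do rewrite mxE.
apply: measurable_sum => k; apply: measurable_funM => //.
exact: measurable_mxE.
Qed.

HB.instance Definition _ V := isMeasurableFun.Build _ _ _ _
  (mulmx_onb V) (@measurable_mulmx_onb V).

(* Lebesgue measure on V, as a measure on R^n concentrated on V: the image of
   Lebesgue measure on R^(\dim V) under the isometry defined by an orthonormal
   basis of V. *)
Definition lebesgue_vs V : set 'rV[R]_n -> \bar R :=
  pushforward (lebesgue_rV (\dim V)) (mulmx_onb V).

Section lebesgue_vs_measure.
Variable V : {vspace 'rV[R]_n}.

Let lebesgue_vs0 : lebesgue_vs V set0 = 0%E. Proof. exact: measure0. Qed.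

Let lebesgue_vs_ge0 A : (0 <= lebesgue_vs V A)%E.
Proof. exact: measure_ge0. Qed.

Let lebesgue_vs_sigma_additive : semi_sigma_additive (lebesgue_vs V).
Proof. exact: measure_semi_sigma_additive. Qed.

HB.instance Definition _ := isMeasure.Build _ _ _ (lebesgue_vs V)
  lebesgue_vs0 lebesgue_vs_ge0 lebesgue_vs_sigma_additive.

End lebesgue_vs_measure.

End subspaces.
Arguments is_onb {R n} V B.
Arguments mulmx_onb {R n} V u.

HB.instance Definition _ (R : realType) (n : nat) :=
  isPointed.Build {vspace 'rV[R]_n} 0%VS.

(* All linear subspaces of R^n, of any dimension.  The dimension-k ones are
   singled out by [Gr k]: as a type they could be empty, which the measurable
   structures do not allow.  V |-> orthoproj V embeds each Gr k
   homeomorphically in the n x n matrices, so the sigma-algebra induced by it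
   is the Borel one. *)
Definition subspaces (R : realType) (n : nat) :=
  g_sigma_algebra_preimageType (@orthoproj R n).

HB.instance Definition _ (R : realType) (n : nat) :=
  Measurable.on (subspaces R n).

Section grassmannian.
Context {R : realType} {n : nat}.

Definition Gr (k : nat) : set (subspaces R n) :=
  [set V | \dim (V : {vspace 'rV[R]_n}) = k].

Lemma measurable_Gr k : measurable (Gr k).
Proof.
pose f (M : 'M[R]_n) : R := \sum_(i < n) M i i.
have mf : measurable_fun setT f.
  by apply: measurable_sum => i; exact: measurable_mxE.
exists (f @^-1` [set k%:R]).
  by rewrite -[X in measurable X]setTI; apply: mf.
rewrite setTI; apply/seteqP; split => V; rewrite /Gr /f /=;
  rewrite -/(\tr (orthoproj V)) /orthoproj mxtrace_mulC (onbP V).1 mxtrace1.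
- by move=> /eqP; rewrite eqr_nat => /eqP.
- by move=> ->.
Qed.

Definition vrotate (O : 'M[R]_n) (V : subspaces R n) : subspaces R n :=
  (linfun (mulmxr O) @: (V : {vspace 'rV[R]_n}))%VS.

(* SO(n) acts transitively on Gr k for 0 < k < n, so this determines dtheta. *)
Definition rotation_invariant_prob (k : nat)
    (dtheta : probability (subspaces R n) R) : Prop :=
  dtheta (Gr k) = 1%E /\
  forall (O : 'M[R]_n) (A : set (subspaces R n)),
    O *m O^T = 1%:M -> \det O = 1 -> measurable A ->
    dtheta (vrotate O @^-1` A) = dtheta A.

End grassmannian.

Section rearrangement.
Context {R : realType} {n : nat}.

(* The open ball centred at 0 with the same measure as A: x lies in it iff the
   open ball of radius |x| is strictly smaller than A. *)
Definition set_rearr (A : set 'rV[R]_n) : set 'rV[R]_n :=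
  [set x | (lebesgue_rV n [set z | (enorm z < enorm x)%R] < lebesgue_rV n A)%E].

(* Layer-cake formula: f^*(x) is the integral over t > 0 of the indicator of
   {|f| > t}^* at x *)
Definition rearr (f : 'rV[R]_n -> R) (x : 'rV[R]_n) : \bar R :=
  (\int[lebesgue_measure]_(t in `]0%R, +oo[)
     (\1_(set_rearr [set z | (t < `|f z|)%R]) x)%:E)%E.

(* f = f^* as elements of L^p, i.e. almost everywhere: [rearr f] is lower
   semicontinuous and may be infinite at 0. *)
Definition eq_rearr (f : 'rV[R]_n -> R) : Prop :=
  \forall x \ae lebesgue_rV n, (f x)%:E = rearr f x.

End rearrangement.

Section kplane.
Context {R : realType} {n : nat}.
Implicit Types (f : 'rV[R]_n -> R) (theta : subspaces R n).

Definition kplane f theta (y : 'rV[R]_n) : \bar R :=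
  (\int[lebesgue_vs theta]_(x in [set x | x \in (theta : {vspace 'rV[R]_n})])
     (f (x + y)%R)%:E)%E.

(* the L^q norm over the affine k-planes theta + y, y in perp theta *)
Definition affLnorm (k : nat) (dtheta : probability (subspaces R n) R) (q : R)
    (F : subspaces R n -> 'rV[R]_n -> \bar R) : \bar R :=
  ((\int[dtheta]_(theta in Gr k)
      \int[lebesgue_vs (perp theta)]_(y in [set y | y \in perp theta]) `|F theta y| `^ q)
   `^ q^-1)%E.

Definition admissible (p : R) f : Prop :=
  [/\ f \in Lfun (lebesgue_rV n) p%:E,
      'N[lebesgue_rV n]_p%:E[EFin \o f]%E = 1%E & eq_rearr f].

Definition kplane_ratio k dtheta (p q : R) f : \bar R :=
  (affLnorm k dtheta q (kplane f) / 'N[lebesgue_rV n]_p%:E[EFin \o f])%E.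

Definition kplane_sup k dtheta (p q : R) : \bar R :=
  ereal_sup [set kplane_ratio k dtheta p q f | f in admissible p].

Definition extremizing k dtheta (p q : R) (fs : nat -> 'rV[R]_n -> R) : Prop :=
  (forall j, admissible p (fs j)) /\
  affLnorm k dtheta q (kplane (fs j)) @[j --> \oo] --> kplane_sup k dtheta p q.

Definition rescale (p sigma : R) f : 'rV[R]_n -> R :=
  fun x => `|sigma| `^ (- (n%:R / p)) * f (sigma^-1 *: x).

End kplane.

(* Main.v *)
Require Import Defs.
From HB Require Import structures.
From mathcomp Require Import all_boot all_order all_algebra.
From mathcomp Require Import all_classical all_reals all_analysis.
From mathcomp Require Import measurable_realfun zify ring lra.

Set Implicit Arguments.
Unset Strict Implicit.
Unset Printing Implicit Defensive.

Import Order.TTheory GRing.Theory Num.Theory.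
Import numFieldNormedType.Exports.

Local Open Scope classical_set_scope.
Local Open Scope ring_scope.

(** An admissible [f] is almost everywhere [phi |x|] for a nonincreasing profile [phi], and then
    the k-plane transform depends only on the distance [rho] of the plane to the origin: it is
    [S phi (rho) = \int phi (sqrt (r^2 + rho^2)) d nu_k r] with [nu_k] the image of Lebesgue measure
    on R^k by the norm.  The problem becomes one-dimensional.

    The weak norm [B = sup r^a phi r], [a = n/p], controls the transform with a gain,
    [|S phi|_q^q <= C B^(q-p) |phi|_p^p] (sum over dyadic shells, Minkowski and scaling).  Hence along
    an extremizing sequence some [r_j^a phi_j (r_j)] stays away from 0, and after rescaling by [r_j] a
    Helly subsequence has a nonzero limit [phi].  Cutting a profile between two levels writes it as a
    sum of two profiles whose p-th powers of norms add up to at most 1: the bounded and compactly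
    supported part converges by dominated convergence, the rest is estimated by the best
    constant [A].  In the limit [A <= |S phi|_q^q + A (1 - X)^(q/p)] with [X = |phi|_p^p], while
    [|S phi|_q^q <= A X^(q/p)]; as [q > p] and [0 < X <= 1] this forces [X = 1], so [phi] is an
    extremizer and the convergence is strong. *)

(** * Lebesgue measure on R^n and its radial image *)

(** Why the cut is made by level: cutting a nonincreasing profile by radius does not in general
    leave nonincreasing pieces, and the best constant applies to profiles only. Why the planes are
    divided as well: Minkowski applied to the two pieces over all planes would only give A <= A
    (X^(1/p) + (1 - X)^(1/p))^q, no contradiction since p > 1. So the distance rho is split. On an
    annulus ep <= rho <= 1/ep the whole transform converges, dominated by that of W r^(-a), which is
    finite because a > k. Outside it Minkowski is used, and the contribution of the bounded piece
    there vanishes as ep -> 0. What remains is the additive inequality of the overview, where strict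
    convexity acts. Pointwise limits say nothing at the jumps of the limit profile. Jumps are
    countable, hence null for the radial measures, and they stay countable when seen from a fixed
    k-plane. Dilations are the one loss of compactness; r^a phi (r) is the quantity that they merely
    transport, so moving a radius where it is large to 1 removes them. *)

Section lebesgue1.
Context {R : realType}.
Local Notation leb := (@lebesgue_measure R).

(** A measure giving each interval ]u, v] its length is Lebesgue measure; the same argument, with a
    factor [c], treats dilations. *)
Lemma lebesgue_measure_shift (a : R) (A : set R) : measurable A ->
  pushforward leb ((fun x => x + a) : measurableTypeR R -> measurableTypeR R) A = leb A.
Proof.
move=> mA.
have ms : measurable_fun setT ((fun x => x + a) : measurableTypeR R -> measurableTypeR R).
  exact: measurable_funD.
pose H := isMeasurableFun.Build _ _ _ _ _ ms.
pose sh : {mfun measurableTypeR R >-> measurableTypeR R} := HB.pack (fun x => x + a) H.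
apply/esym/(@lebesgue_measure_unique R (pushforward leb sh)) => //= _ [[u v]] _ <-.
rewrite /pushforward.
have -> : (fun x => x + a) @^-1` `]u, v]%classic = `]u - a, v - a]%classic.
  by apply/seteqP; split => x /=; rewrite !in_itv/= ltrBlDr lerBrDr.
rewrite !lebesgue_measure_itv/= !lte_fin ltrD2r.
by case: ifP => // _; rewrite -!EFinB opprB addrA subrK.
Qed.

Lemma lebesgue_measure_scale (c : R) (A : set R) : 0 < c -> measurable A ->
  (c%:E * pushforward leb ((fun x => c * x)%R : measurableTypeR R -> measurableTypeR R) A = leb A)%E.
Proof.
move=> c0 mA.
have ms : measurable_fun setT ((fun x => c * x) : measurableTypeR R -> measurableTypeR R).
  exact: measurable_funM.
pose H := isMeasurableFun.Build _ _ _ _ _ ms.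
pose sh : {mfun measurableTypeR R >-> measurableTypeR R} := HB.pack (fun x => c * x) H.
apply/esym/(@lebesgue_measure_unique R (mscale (NngNum (ltW c0)) (pushforward leb sh))) => //= _ [[u v]] _ <-.
rewrite /mscale/= /pushforward.
have -> : (fun x => c * x) @^-1` `]u, v]%classic = `]u / c, v / c]%classic.
  by apply/seteqP; split => x /=; rewrite !in_itv/= ltr_pdivrMr// ler_pdivlMr// mulrC.
rewrite !lebesgue_measure_itv/= !lte_fin ltr_pM2r ?invr_gt0//.
case: ifP => // _; last by rewrite mule0.
by rewrite -!EFinB -EFinM -mulrBl mulrC divfK ?gt_eqF.
Qed.

Lemma ge0_integral_shift (a : R) (f : measurableTypeR R -> \bar R) : measurable_fun setT f ->
  (forall x, 0 <= f x)%E -> (\int[leb]_x f (x + a)%R = \int[leb]_x f x)%E.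
Proof.
move=> mf f0.
have ms : measurable_fun setT ((fun x => x + a) : measurableTypeR R -> measurableTypeR R).
  exact: measurable_funD.
rewrite -[LHS](@ge0_integral_pushforward _ _ _ _ _ _ ms leb setT f)//.
by apply: eq_measure_integral => A mA _; exact: lebesgue_measure_shift.
Qed.

Lemma ge0_integral_scale (c : R) (f : measurableTypeR R -> \bar R) : 0 < c -> measurable_fun setT f ->
  (forall x, 0 <= f x)%E -> (c%:E * \int[leb]_x f (c * x)%R = \int[leb]_x f x)%E.
Proof.
move=> c0 mf f0.
have ms : measurable_fun setT ((fun x => c * x) : measurableTypeR R -> measurableTypeR R).
  exact: measurable_funM.
rewrite -[X in (_ * X)%E](@ge0_integral_pushforward _ _ _ _ _ _ ms leb setT f)//.
pose H := isMeasurableFun.Build _ _ _ _ _ ms.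
pose sh : {mfun measurableTypeR R >-> measurableTypeR R} := HB.pack (fun x => c * x) H.
rewrite -(@ge0_integral_mscale _ _ _ (pushforward leb sh) _ _ (NngNum (ltW c0)))//.
by apply: eq_measure_integral => A mA _; exact: lebesgue_measure_scale.
Qed.

End lebesgue1.

(** * Translations, dilations and Fubini on R^n *)

Section lebesgue_rV_theory.
Context {R : realType}.

Lemma measurable_addmx n (v : 'rV[R]_n) : measurable_fun setT (fun x : 'rV[R]_n => x + v).
Proof.
apply: measurable_fun_mx => i j; under eq_fun do rewrite mxE.
by apply: measurable_funD => //; exact: measurable_mxE.
Qed.

Lemma measurable_scalemx n (c : R) : measurable_fun setT (fun x : 'rV[R]_n => c *: x).
Proof.
apply: measurable_fun_mx => i j; under eq_fun do rewrite mxE.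
by apply: measurable_funM => //; exact: measurable_mxE.
Qed.

Lemma measurable_mulmx n m (B : 'M[R]_(n, m)) :
  measurable_fun setT (fun x : 'rV[R]_n => x *m B).
Proof.
apply: measurable_fun_mx => i j; under eq_fun do rewrite mxE.
apply: measurable_sum => k; apply: measurable_funM => //; exact: measurable_mxE.
Qed.

Lemma measurable_funD_mx d (T : measurableType d) n (f g : T -> 'rV[R]_n) :
  measurable_fun setT f -> measurable_fun setT g -> measurable_fun setT (fun x => f x + g x).
Proof.
move=> mf mg; apply: measurable_fun_mx => i j; under eq_fun do rewrite mxE.
by apply: measurable_funD; exact: (measurableT_comp (measurable_mxE i j)).
Qed.

Lemma measurable_dotrV n : measurable_fun setT (fun x : 'rV[R]_n => dotrV x x).
Proof.
rewrite /dotrV; under eq_fun do rewrite mxE.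
apply: measurable_sum => k; under eq_fun do rewrite mxE.
by apply: measurable_funM; exact: measurable_mxE.
Qed.

Lemma measurable_sqrtr : measurable_fun setT (@Num.sqrt R).
Proof. by apply: continuous_measurable_fun; exact: sqrt_continuous. Qed.

Lemma measurable_enorm n : measurable_fun setT (@enorm R n).
Proof. exact: measurableT_comp measurable_sqrtr (@measurable_dotrV n). Qed.

HB.instance Definition _ n := isMeasurableFun.Build _ _ _ _ (@enorm R n) (@measurable_enorm n).

Lemma dotrVE n (v : 'rV[R]_n) : dotrV v v = \sum_i v 0 i ^+ 2.
Proof. by rewrite /dotrV mxE; apply: eq_bigr => i _; rewrite mxE expr2. Qed.

Lemma dotrV_cons n x (v : 'rV[R]_n) : dotrV (rV_cons (x, v)) (rV_cons (x, v)) = x ^+ 2 + dotrV v v.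
Proof.
rewrite !dotrVE big_ord_recl rV_cons0; congr (_ + _).
by apply: eq_bigr => i _; rewrite rV_consS.
Qed.

Lemma dotrV_ge0 n (v : 'rV[R]_n) : 0 <= dotrV v v.
Proof. by rewrite /dotrV mxE; apply: sumr_ge0 => i _; rewrite mxE -expr2 sqr_ge0. Qed.

Lemma enorm_ge0 n (v : 'rV[R]_n) : 0 <= enorm v.
Proof. exact: sqrtr_ge0. Qed.

Lemma sqr_enorm n (v : 'rV[R]_n) : enorm v ^+ 2 = dotrV v v.
Proof. by rewrite sqr_sqrtr// dotrV_ge0. Qed.

Lemma enormZ n c (v : 'rV[R]_n) : 0 <= c -> enorm (c *: v) = c * enorm v.
Proof.
move=> c0; rewrite /enorm /dotrV linearZ/= -scalemxAl -scalemxAr !mxE mulrA -expr2.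
by rewrite sqrtrM ?sqr_ge0// sqrtr_sqr ger0_norm.
Qed.

Lemma integral_lebesgue_rVS n (f : 'rV[R]_n.+1 -> \bar R) : measurable_fun setT f ->
  (forall x, 0 <= f x)%E ->
  (\int[lebesgue_rV n.+1]_x f x = \int[lebesgue_measure]_x \int[lebesgue_rV n]_v f (rV_cons (x, v)))%E.
Proof.
move=> mf f0.
rewrite (@ge0_integral_pushforward _ _ _ _ _ _ (@measurable_rV_cons R n)) //.
rewrite preimage_setT fubini_tonelli1//; last by move=> x; exact: f0.
by apply: measurableT_comp => //; exact: measurable_rV_cons.
Qed.

Lemma ge0_integral_rV_shift n (w : 'rV[R]_n) (f : 'rV[R]_n -> \bar R) : measurable_fun setT f ->
  (forall x, 0 <= f x)%E -> (\int[lebesgue_rV n]_x f (x + w)%R = \int[lebesgue_rV n]_x f x)%E.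
Proof.
elim: n w f => [|n IH] w f mf f0.
  by apply: eq_integral => x _; congr f; apply/rowP => -[].
have mc : measurable_fun setT (f \o @rV_cons R n).
  by apply: measurableT_comp => //; exact: measurable_rV_cons.
have ma := measurableT_comp mf (measurable_addmx w).
rewrite (integral_lebesgue_rVS ma (fun x => f0 _)) (integral_lebesgue_rVS mf f0).
rewrite -(@ge0_integral_shift _ (w 0 ord0) (fun x => \int[lebesgue_rV n]_v f (rV_cons (x, v)))%E); first last.
  - by move=> x; exact: integral_ge0.
  - exact: (measurable_fun_fubini_tonelli_F (f \o @rV_cons R n) mc (fun x => f0 _)).
apply: eq_integral => x _.
rewrite -(IH (\row_i w 0 (lift ord0 i)) (fun v => f (rV_cons (x + w 0 ord0, v)))) //.
  apply: eq_integral => v _; congr f; apply/rowP => i; rewrite [LHS]mxE.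
  by case: (unliftP ord0 i) => [j ->|->]; rewrite ?rV_consS ?rV_cons0 /= ?mxE.
exact: (measurable_fun_pair2 _ mc).
Qed.

Lemma ge0_integral_rV_scale n (c : R) (f : 'rV[R]_n -> \bar R) : 0 < c -> measurable_fun setT f ->
  (forall x, 0 <= f x)%E ->
  ((c ^+ n)%:E * \int[lebesgue_rV n]_x f (c *: x)%R = \int[lebesgue_rV n]_x f x)%E.
Proof.
move=> c0; elim: n f => [|n IH] f mf f0.
  by rewrite expr0 mul1e; apply: eq_integral => x _; congr f; apply/rowP => -[].
have mc : measurable_fun setT (f \o @rV_cons R n).
  by apply: measurableT_comp => //; exact: measurable_rV_cons.
have mc2 : measurable_fun setT ((f \o ( *:%R c)) \o @rV_cons R n).
  have ms := measurableT_comp mf (measurable_scalemx c).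
  exact: (measurableT_comp ms (@measurable_rV_cons R n)).
have ms := measurableT_comp mf (measurable_scalemx c).
rewrite (integral_lebesgue_rVS ms (fun x => f0 _)) (integral_lebesgue_rVS mf f0).
rewrite -(@ge0_integral_scale _ c (fun x => \int[lebesgue_rV n]_v f (rV_cons (x, v)))%E)//; first last.
  - by move=> x; exact: integral_ge0.
  - exact: (measurable_fun_fubini_tonelli_F (f \o @rV_cons R n) mc (fun x => f0 _)).
rewrite exprS EFinM -muleA; congr (_ * _)%E.
rewrite -ge0_integralZl//; last 3 first.
- exact: (measurable_fun_fubini_tonelli_F ((f \o ( *:%R c)) \o @rV_cons R n) mc2 (fun x => f0 _)).
- by move=> x _; apply: integral_ge0 => v _; exact: f0.
- by rewrite lee_fin exprn_ge0// ltW.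
apply: eq_integral => x _.
rewrite -(IH (fun v => f (rV_cons (c * x, v)))) //.
  congr (_ * _)%E; apply: eq_integral => v _; congr f; apply/rowP => i; rewrite [LHS]mxE.
  by case: (unliftP ord0 i) => [j ->|->]; rewrite ?rV_consS ?rV_cons0 /= ?mxE.
exact: (measurable_fun_pair2 _ mc).
Qed.

(** Fubini for R^k x R^m, restricted to functions of the squared norm. Then no splitting of a vector
    of length [k + m] is needed: in the induction on [k] the square of the peeled coordinate is
    absorbed into [G]. *)
Lemma ge0_integral_rV_dotrVD k m (G : R -> \bar R) : measurable_fun setT G ->
  (forall x, 0 <= G x)%E ->
  (\int[lebesgue_rV (k + m)]_z G (dotrV z z) =
   \int[lebesgue_rV k]_x \int[lebesgue_rV m]_y G (dotrV x x + dotrV y y)%R)%E.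
Proof.
elim: k G => [|k IH] G mG G0.
  have dot0 (x : 'rV[R]_0) : dotrV x x = 0 by rewrite dotrVE big_ord0.
  under [RHS]eq_integral do rewrite dot0.
  rewrite [in RHS]/= integral_dirac// diracE in_setT mul1e.
  by apply: eq_integral => x _; rewrite add0r.
have mD a n : measurable_fun setT (fun x : 'rV[R]_n => G (a + dotrV x x)).
  apply: measurableT_comp => //; apply: measurable_funD => //; exact: measurable_dotrV.
rewrite addSn !integral_lebesgue_rVS//; last first.
- exact: measurableT_comp mG (@measurable_dotrV _).
- by move=> x; exact: integral_ge0.
- apply: (measurable_fun_fubini_tonelli_F (fun p : 'rV[R]_k.+1 * 'rV[R]_m => G (dotrV p.1 p.1 + dotrV p.2 p.2))) => //.
  apply: measurableT_comp => //; apply: measurable_funD.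
    exact: measurableT_comp (@measurable_dotrV _) measurable_fst.
  exact: measurableT_comp (@measurable_dotrV _) measurable_snd.
apply: eq_integral => x _; under eq_integral do rewrite dotrV_cons.
rewrite (IH (fun r => G (x ^+ 2 + r)))//; last by apply: measurableT_comp => //; exact: measurable_funD.
by apply: eq_integral => u _; apply: eq_integral => y _; rewrite dotrV_cons addrA.
Qed.

End lebesgue_rV_theory.

(** * Radial measures: images of Lebesgue measure under the norm *)

Section radial.
Context {R : realType}.

(** For n > 0 this is the measure with density n |B| r^(n-1) on the half-line, B the unit ball of
    R^n; taking an image measure replaces polar coordinates. *)
Definition radial_measure n : set R -> \bar R :=
  pushforward (lebesgue_rV n) (@enorm R n).

Local Notation nu := radial_measure.

Section radial_measure_measure.
Variable n : nat.

Let radial_measure0 : nu n set0 = 0%E. Proof. exact: measure0. Qed.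

Let radial_measure_ge0 A : (0 <= nu n A)%E. Proof. exact: measure_ge0. Qed.

Let radial_measure_sigma_additive : semi_sigma_additive (nu n).
Proof.
exact: measure_semi_sigma_additive.
Qed.

HB.instance Definition _ := isMeasure.Build _ _ _ (nu n)
  radial_measure0 radial_measure_ge0 radial_measure_sigma_additive.

End radial_measure_measure.

Lemma ge0_integral_radial n (g : R -> \bar R) : measurable_fun setT g ->
  (forall x, 0 <= g x)%E -> (\int[nu n]_r g r = \int[lebesgue_rV n]_x g (enorm x))%E.
Proof.
move=> mg g0.
by rewrite (@ge0_integral_pushforward _ _ _ _ _ _ (@measurable_enorm R n) (lebesgue_rV n) setT g).
Qed.

Definition ballvol n : R := fine (lebesgue_rV n [set x : 'rV[R]_n | enorm x < 1]).

Lemma ler_coord_enorm n (x : 'rV[R]_n) i : `|x 0 i| <= enorm x.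
Proof.
rewrite -(@ler_pXn2r _ 2)// ?nnegrE ?enorm_ge0// sqr_enorm dotrVE.
rewrite (bigD1 i)//= real_normK ?num_real// lerDl.
by apply: sumr_ge0 => j _; exact: sqr_ge0.
Qed.

Lemma measurable_enorm_preimage n (A : set (R)) : measurable A ->
  measurable ((@enorm R n) @^-1` A).
Proof. by move=> mA; rewrite -[X in measurable X]setTI; exact: measurable_enorm. Qed.

Lemma measurable_enorm_lt n r : measurable [set x : 'rV[R]_n | enorm x < r].
Proof.
rewrite (_ : [set _ | _] = (@enorm R n) @^-1` `]-oo, r[%classic); last first.
  by apply/seteqP; split => x /=; rewrite in_itv.
exact: measurable_enorm_preimage.
Qed.

Lemma lebesgue_rV_cube n (c : R) : 0 < c ->
  lebesgue_rV n [set v : 'rV[R]_n | forall i, (`[- c, c]%classic : set R) (v 0 i)] = ((2 * c) ^+ n)%:E.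
Proof.
move=> c0.
rewrite (@lebesgue_rV_box R n (fun=> `[- c, c]%classic))//.
under eq_bigr do rewrite lebesgue_measure_itv.
rewrite big_const card_ord /= lte_fin.
rewrite ifT; last by rewrite gtrN.
rewrite opprK -EFinD -mulr2n -[c *+ 2]mulr_natl.
by elim: n => [//|n IH]; rewrite iterS IH exprS -EFinM.
Qed.

Lemma measurable_cube n (c : R) :
  measurable [set v : 'rV[R]_n | forall i, (`[- c, c]%classic : set R) (v 0 i)].
Proof.
rewrite [X in measurable X](_ : _ = \bigcap_(i in [set: 'I_n])
    ((fun v : 'rV[R]_n => v 0 i) @^-1` (`[- c, c]%classic : set R))).
  apply: fin_bigcap_measurable => // i _.
  by rewrite -[X in measurable X]setTI; exact: measurable_mxE.
by apply/seteqP; split => [v vA i _|v vA i] /=; exact: vA.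
Qed.

Lemma lebesgue_rV_ball1_lty n : (lebesgue_rV n [set x : 'rV[R]_n | (enorm x < 1)%R] < +oo)%E.
Proof.
apply: (@le_lt_trans _ _ (((2 * 1) ^+ n)%:E)); last by rewrite ltry.
rewrite -lebesgue_rV_cube//; apply: le_measure.
- by rewrite inE; exact: measurable_enorm_lt.
- by rewrite inE; exact: measurable_cube.
- move=> x /= x1 i; rewrite /= in_itv/=.
  by rewrite -ler_norml (le_trans (ler_coord_enorm x i))// ltW.
Qed.

Lemma ballvolE n : lebesgue_rV n [set x : 'rV[R]_n | enorm x < 1] = (ballvol n)%:E.
Proof. by rewrite fineK// ge0_fin_numE// lebesgue_rV_ball1_lty. Qed.

Lemma ballvol_gt0 n : 0 < ballvol n.
Proof.
rewrite -lte_fin -ballvolE.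
(* The cube of half-side 1/(n+1) lies in the open unit ball because n/(n+1)^2 < 1. *)
have c0 : 0 < n.+1%:R^-1 :> R by rewrite invr_gt0.
apply: (@lt_le_trans _ _ (((2 * n.+1%:R^-1) ^+ n)%:E)).
  by rewrite lte_fin exprn_gt0// mulr_gt0.
rewrite -lebesgue_rV_cube//; apply: le_measure.
- by rewrite inE; exact: measurable_cube.
- by rewrite inE; exact: measurable_enorm_lt.
- move=> x /= x1; rewrite -(@ltr_pXn2r _ 2)// ?nnegrE ?enorm_ge0// sqr_enorm dotrVE expr1n.
  apply: (@le_lt_trans _ _ (\sum_(i < n) n.+1%:R^-1 ^+ 2)).
    apply: ler_sum => i _; have := x1 i; rewrite in_itv/= -ler_norml => xi.
    by rewrite -real_normK ?num_real// lerXn2r// nnegrE ltW.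
  rewrite sumr_const card_ord -[X in X < _]mulr_natl exprVn ltr_pdivrMr ?exprn_gt0// mul1r.
  by rewrite -natrX ltr_nat; lia.
Qed.

Lemma radial_measureNy n r : 0 < r -> nu n `]-oo, r[%classic = (r ^+ n * ballvol n)%:E.
Proof.
move=> r0.
have m1 := @measurable_enorm_lt n 1.
have mr : measurable ((@enorm R n) @^-1` `]-oo, r[%classic).
  exact: measurable_enorm_preimage.
rewrite /radial_measure /pushforward EFinM -ballvolE.
rewrite -[X in lebesgue_rV n X = _]setIT -integral_indic//.
rewrite -[X in (_ * lebesgue_rV n X)%E]setIT -[X in (_ * X)%E]integral_indic//.
rewrite -(@ge0_integral_rV_scale _ _ r)//; last by apply/measurable_EFinP.
congr (_ * _)%E; apply: eq_integral => x _.
rewrite !indicE; congr ((nat_of_bool _)%:R%:E).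
have xr : (enorm (r *: x) < r) = (enorm x < 1).
  by rewrite enormZ ?ltW// -[X in _ < X]mulr1 ltr_pM2l.
by apply/idP/idP => /set_mem/=; rewrite ?in_itv/= => h; apply/mem_set; rewrite /= ?in_itv/= ?xr// -xr.
Qed.

(** Only the origin has norm at most 0, and for r <= 1 and n > 0 it lies in a ball of volume at most
    r |B|. For n = 0 the measure is a unit mass at 0. *)
Lemma radial_measure_le0 n : (0 < n)%N -> nu n `]-oo, 0]%classic = 0%E.
Proof.
move=> n0; apply/eqP; rewrite eq_le measure_ge0 andbT; apply/lee_addgt0Pr => e e0.
rewrite add0e.
pose r := Num.min 1 (e / ballvol n).
have r0 : 0 < r by rewrite lt_min ltr01 divr_gt0// ballvol_gt0.
apply: (@le_trans _ _ (nu n `]-oo, r[%classic)).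
  apply: le_measure; rewrite ?inE//.
  by move=> x /=; rewrite !in_itv/= => /le_lt_trans; exact.
rewrite radial_measureNy// lee_fin -ler_pdivlMr ?ballvol_gt0//.
apply: (@le_trans _ _ r); last by rewrite /r ge_min lexx orbT.
have r1 : r <= 1 by rewrite ge_min lexx.
by rewrite -(prednK n0) exprS ler_piMr ?exprn_ile1// ltW.
Qed.

Let sigma_finite_radial_measure n : sigma_finite setT (nu n).
Proof.
exists (fun i => `]-oo, i.+1%:R[%classic).
  apply/esym; rewrite -subTset => x _; exists (Num.truncn x) => //=.
  by rewrite in_itv/= truncnS_gt.
by move=> i; split => //; rewrite radial_measureNy ?ltry.
Qed.

HB.instance Definition _ n := @Measure_isSigmaFinite.Build _ _ _ (nu n) (@sigma_finite_radial_measure n).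

Lemma ge0_integral_radial_scale n c (g : R -> \bar R) : 0 < c -> measurable_fun setT g ->
  (forall x, 0 <= g x)%E -> ((c ^+ n)%:E * \int[nu n]_r g (c * r)%R = \int[nu n]_r g r)%E.
Proof.
move=> c0 mg g0.
rewrite !ge0_integral_radial//; last first.
  by apply: (measurableT_comp mg); exact: measurable_funM.
rewrite -(@ge0_integral_rV_scale _ _ c (fun x => g (enorm x)))//; last first.
  exact: (measurableT_comp mg (@measurable_enorm R n)).
by congr (_ * _)%E; apply: eq_integral => x _; rewrite enormZ// ltW.
Qed.

(** Slices R^(k+m) by parallel k-planes: in a plane at distance [rho] from the origin, a point at
    distance [r] from the foot has norm sqrt (r^2 + rho^2). This ties L^p norms to integrals over
    planes. *)
Lemma ge0_integral_radialD k m (g : R -> \bar R) : measurable_fun setT g ->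
  (forall x, 0 <= g x)%E -> (\int[nu (k + m)]_r g r =
     \int[nu m]_rho \int[nu k]_r g (Num.sqrt (r ^+ 2 + rho ^+ 2)))%E.
Proof.
move=> mg g0.
have mgs : measurable_fun setT (fun r : R => g (Num.sqrt r)).
  by apply: measurableT_comp => //; exact: measurable_sqrtr.
have mgD : measurable_fun setT
  (fun p : R * R => g (Num.sqrt (p.1 ^+ 2 + p.2 ^+ 2))).
  apply: measurableT_comp => //; apply: measurableT_comp; first exact: measurable_sqrtr.
  by apply: measurable_funD; apply: measurable_funX.
rewrite ge0_integral_radial//.
rewrite (ge0_integral_rV_dotrVD _ _ mgs)//.
rewrite (fubini_tonelli (fun p : 'rV[R]_k * 'rV[R]_m => g (Num.sqrt (dotrV p.1 p.1 + dotrV p.2 p.2))))//; last first.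
  apply: (measurableT_comp mgs); apply: measurable_funD.
    exact: measurableT_comp (@measurable_dotrV _ _) measurable_fst.
  exact: measurableT_comp (@measurable_dotrV _ _) measurable_snd.
rewrite [RHS]ge0_integral_radial//; last 2 first.
- exact: (measurable_fun_fubini_tonelli_G _ mgD).
- by move=> x; exact: integral_ge0.
apply: eq_integral => y _; rewrite ge0_integral_radial//.
  by apply: eq_integral => x _; rewrite !sqr_enorm.
exact: (measurable_fun_pair1 _ mgD).
Qed.

End radial.

(** * The k-plane transform of radial functions *)

Section null_sets.
Context {R : realType}.

(* Two sigma-finite translation invariant measures, neither of them zero, have the same null sets:
   integrate the indicator of N at w + h(x) over both variables in both orders. *)
Lemma lebesgue_rV_null_preimage n k m (B : 'M[R]_(k, n)) (C : 'M[R]_(m, n)) (N : set 'rV[R]_n) :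
  (forall w : 'rV[R]_n, exists u v, w = u *m B + v *m C) ->
  measurable N -> lebesgue_rV n N = 0%E ->
  {ae lebesgue_rV m, forall v, lebesgue_rV k [set u : 'rV[R]_k | N (u *m B + v *m C)] = 0%E}.
Proof.
move=> surj mN N0.
have mI p (h : 'rV[R]_p -> 'rV[R]_n) : measurable_fun setT h ->
    measurable_fun setT (fun x : 'rV[R]_p => (\1_N (h x))%:E : \bar R).
  by move=> mh; apply/measurable_EFinP; apply: measurableT_comp mh; exact: measurable_indic.
(* Every [w] is itself of the form u B + v C, so translation invariance in [u] and [v] makes [phi]
   constant. *)
pose phi (w : 'rV[R]_n) := (\int[lebesgue_rV m]_v \int[lebesgue_rV k]_u (\1_N (w + (u *m B + v *m C))%R)%:E)%E.
have mF (w : 'rV[R]_n) : measurable_fun setT (fun p : 'rV[R]_k * 'rV[R]_m =>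
    (\1_N (w + (p.1 *m B + p.2 *m C)))%:E : \bar R).
  apply/measurable_EFinP; apply: measurableT_comp; first exact: measurable_indic.
  apply: measurable_funD_mx => //; apply: measurable_funD_mx.
    exact: measurableT_comp (measurable_mulmx B) measurable_fst.
  exact: measurableT_comp (measurable_mulmx C) measurable_snd.
have phiE w : phi w = phi 0.
  have [a [b ->]] := surj w.
  rewrite /phi -(@ge0_integral_rV_shift _ _ b (fun v => \int[lebesgue_rV k]_u (\1_N (0 + (u *m B + v *m C))%R)%:E)%E); first last.
  - by move=> v; exact: integral_ge0.
  - exact: (measurable_fun_fubini_tonelli_G _ (mF 0)).
  apply: eq_integral => v _.
  rewrite -(@ge0_integral_rV_shift _ _ a (fun u => (\1_N (0 + (u *m B + (v + b) *m C))%R)%:E)%E)//; last first.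
    exact: (measurable_fun_pair1 _ (mF 0)).
  apply: eq_integral => u _; congr (\1_N _)%:E.
  by rewrite !mulmxDl add0r addrACA; congr (_ + _); rewrite addrC.
have phi0 : phi 0 = 0%E.
  have mG : measurable_fun setT (fun p : ('rV[R]_n * 'rV[R]_m) * 'rV[R]_k  =>
    (\1_N (p.1.1 + (p.2 *m B + p.1.2 *m C)))%:E : \bar R).
    apply/measurable_EFinP; apply: measurableT_comp; first exact: measurable_indic.
    apply: measurable_funD_mx; last apply: measurable_funD_mx.
    - exact: measurableT_comp measurable_fst measurable_fst.
    - exact: measurableT_comp (measurable_mulmx B) measurable_snd.
    - apply: measurableT_comp (measurable_mulmx C) _.
      exact: measurableT_comp measurable_snd measurable_fst.
  have mGv v : measurable_fun setT (fun p : 'rV[R]_n * 'rV[R]_k =>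
    (\1_N (p.1 + (p.2 *m B + v *m C)))%:E : \bar R).
    apply/measurable_EFinP; apply: measurableT_comp; first exact: measurable_indic.
    apply: measurable_funD_mx => //; apply: measurable_funD_mx => //.
    exact: measurableT_comp (measurable_mulmx B) measurable_snd.
  (* With [w] integrated first, each inner integral is the measure of a translate of [N], which is
     0. *)
  have mu0 : (\int[lebesgue_rV n]_w phi w = 0)%E.
    have mH : measurable_fun setT (fun p : 'rV[R]_n * 'rV[R]_m =>
        \int[lebesgue_rV k]_u (\1_N (p.1 + (u *m B + p.2 *m C))%R)%:E)%E.
      exact: (@measurable_fun_fubini_tonelli_F _ _ _ _ _ (lebesgue_rV k) _ mG).
    rewrite (@fubini_tonelli _ _ _ _ _ (lebesgue_rV n) (lebesgue_rV m) _ mH); last first.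
      by move=> p; exact: integral_ge0.
    rewrite integral0_eq// => v _ /=.
    rewrite (@fubini_tonelli _ _ _ _ _ (lebesgue_rV n) (lebesgue_rV k) _ (mGv v))//=.
    rewrite integral0_eq// => u _.
    rewrite (@ge0_integral_rV_shift _ _ (u *m B + v *m C) (fun w => (\1_N w)%:E))//; last exact: mI.
    by rewrite integral_indic// setIT; exact: N0.
  (* The integral of a constant is its value times the total mass, and the total mass is at least
     that of the unit ball. *)
  have : (phi 0%R * lebesgue_rV n setT = 0)%E.
    have E := @integral_cst _ _ _ (lebesgue_rV n) setT measurableT (phi 0%R).
    by rewrite -E; apply: etrans mu0; apply: eq_integral => w _; exact/esym/phiE.
  move/eqP; rewrite mule_eq0 => /orP[/eqP//|].
  rewrite eq_le => /andP[+ _]; rewrite leNgt.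
  rewrite (@lt_le_trans _ _ (lebesgue_rV n [set x : 'rV[R]_n | enorm x < 1]))//.
    by rewrite ballvolE lte_fin ballvol_gt0.
  by rewrite le_measure// inE//; exact: measurable_enorm_lt.
have mK : measurable_fun setT (fun v : 'rV[R]_m => \int[lebesgue_rV k]_u (\1_N (0 + (u *m B + v *m C))%R)%:E)%E.
  exact: (measurable_fun_fubini_tonelli_G _ (mF 0)).
have /(ae_eq_integral_abs (lebesgue_rV m) measurableT mK) : (\int[lebesgue_rV m]_v `|\int[lebesgue_rV k]_u (\1_N (0 + (u *m B + v *m C))%R)%:E| = 0)%E.
  rewrite -phi0; apply: eq_integral => v _; rewrite gee0_abs//; exact: integral_ge0.
apply: filterS => v /(_ I) E; apply: etrans E.
have mNv : measurable [set u : 'rV[R]_k | N (u *m B + v *m C)].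
  rewrite -[X in measurable X]setTI; apply: (@measurable_funD_mx _ _ _ _ (fun u : 'rV[R]_k => u *m B) (fun=> v *m C)) => //.
  exact: measurable_mulmx.
rewrite -[X in lebesgue_rV k X = _]setIT -integral_indic//; apply: eq_integral => u _.
rewrite !indicE add0r; congr ((nat_of_bool _)%:R%:E).
Qed.

End null_sets.

(** * Orthogonal decomposition along a subspace and its complement *)

Section perp.
Context {R : realType} {n : nat}.
Implicit Types V : {vspace 'rV[R]_n}.

Lemma memv_onb V u : u *m onb V \in V.
Proof. by have [_ BV] := onbP V; apply/BV; exists u. Qed.

Lemma onb_perp V : onb V *m (onb (perp V))^T = 0.
Proof.
apply/matrixP => i j; rewrite [RHS]mxE.
have /memv_perp/(_ (delta_mx 0 i *m onb V)) : delta_mx 0 j *m onb (perp V) \in perp V by exact: memv_onb.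
rewrite memv_onb => /(_ isT); rewrite /dotrV -!rowE => <-.
by rewrite !mxE; apply: eq_bigr => l _; rewrite !mxE mulrC.
Qed.

Lemma orthoproj_id V x : x \in V -> x *m orthoproj V = x.
Proof.
have [BB BV] := onbP V => /BV[u ->].
by rewrite /orthoproj mulmxA -(mulmxA u) BB mulmx1.
Qed.

Lemma perp_decomp V x : x - x *m orthoproj V \in perp V.
Proof.
rewrite memv_ker lfunE /= mulmxBl -(mulmxA x); apply/eqP.
have [BB BV] := onbP V.
have -> : orthoproj V *m orthoproj V = orthoproj V.
  by rewrite /orthoproj mulmxA -(mulmxA (onb V)^T) BB mulmx1.
by rewrite subrr.
Qed.

Lemma onb_surj V (w : 'rV[R]_n) : exists u v, w = u *m onb V + v *m onb (perp V).
Proof.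
have [_ /(_ (w - w *m orthoproj V))] := onbP (perp V).
case=> /(_ (perp_decomp V w))[v wv] _; exists (w *m (onb V)^T), v.
by rewrite -wv /orthoproj mulmxA addrC subrK.
Qed.

Lemma dim_perp V : \dim (perp V) = (n - \dim V)%N.
Proof.
pose h : 'Hom('rV[R]_n, 'rV[R]_n) := linfun (mulmxr (orthoproj V)).
have := limg_ker_dim h fullv.
rewrite capfv dimvf dim_matrix mul1r -/(perp V).
suff -> : limg h = V by move/(congr1 (subn^~ (\dim V))); rewrite addnK.
apply/vspaceP => x; apply/idP/idP => [/memv_imgP[y _ ->]|xV].
  by rewrite lfunE/= /orthoproj mulmxA memv_onb.
by rewrite -(orthoproj_id xV) (_ : x *m _ = h x) ?memv_img ?memvf// lfunE.
Qed.

Lemma dotrV_onb V u v : dotrV (u *m onb V + v *m onb (perp V)) (u *m onb V + v *m onb (perp V)) =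
  dotrV u u + dotrV v v.
Proof.
have [BB _] := onbP V; have [CC _] := onbP (perp V).
have CB : onb (perp V) *m (onb V)^T = 0 by rewrite -[LHS]trmxK trmx_mul trmxK onb_perp trmx0.
rewrite /dotrV linearD/= mulmxDl !mulmxDr !trmx_mul !mulmxA.
rewrite -(mulmxA u (onb V)) BB mulmx1 -(mulmxA v (onb (perp V)) (onb (perp V))^T) CC mulmx1.
rewrite -(mulmxA u (onb V)) onb_perp -(mulmxA v) CB !(mulmx0, mul0mx) addr0 add0r.
by rewrite mxE.
Qed.

End perp.

Section ktrans.
Context {R : realType}.
Local Notation nu := (@radial_measure R).

(** The operator S: [rho] is the distance of the plane to the origin, [r] the distance inside the
    plane to its point nearest the origin. *)
Definition ktrans k (phi : R -> R) (rho : R) : \bar R :=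
  (\int[nu k]_r (phi (Num.sqrt (r ^+ 2 + rho ^+ 2)))%:E)%E.

Lemma measurable_hypot (rho : R) : measurable_fun setT (fun r : R => Num.sqrt (r ^+ 2 + rho ^+ 2)).
Proof.
apply: measurableT_comp; first exact: measurable_sqrtr.
by apply: measurable_funD => //; apply: measurable_funX.
Qed.

Lemma measurable_hypot2 : measurable_fun setT (fun p : R * R => Num.sqrt (p.1 ^+ 2 + p.2 ^+ 2)).
Proof.
apply: measurableT_comp; first exact: measurable_sqrtr.
by apply: measurable_funD; apply: measurable_funX.
Qed.

Lemma measurable_ktrans k (phi : R -> R) : measurable_fun setT phi -> (forall r, 0 <= phi r) ->
  measurable_fun setT (ktrans k phi).
Proof.
move=> mphi phi0.
apply: (measurable_fun_fubini_tonelli_G (fun p : R * R => (phi (Num.sqrt (p.1 ^+ 2 + p.2 ^+ 2)))%:E)); last first.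
  by move=> p; rewrite lee_fin.
by apply/measurable_EFinP; apply: (measurableT_comp mphi); exact: measurable_hypot2.
Qed.

Lemma ktrans_ge0 k (phi : R -> R) rho : (forall r, 0 <= phi r) -> (0 <= ktrans k phi rho)%E.
Proof. by move=> phi0; apply: integral_ge0 => r _; rewrite lee_fin. Qed.

(** Positive and negative parts are transported separately, so integrability is not at stake. The
    function transformed by [kplane] is known to be nonnegative only almost everywhere. *)
Lemma integral_pushforward_measurable d1 d2 (X : measurableType d1) (Y : measurableType d2)
  (h : X -> Y) (mu : {measure set X -> \bar R}) (D : set Y) (f : Y -> \bar R) :
  measurable_fun setT h -> measurable D -> measurable_fun D f ->
  (\int[pushforward mu h]_(y in D) f y = \int[mu]_(x in h @^-1` D) f (h x))%E.
Proof.
move=> mh mD mf; rewrite [LHS]integralE [RHS]integralE; congr (_ - _)%E.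
  by rewrite (ge0_integral_pushforward mh _ mD (measurable_funepos mf)) => [|y _]; rewrite ?funepos_ge0 ?funeneg_ge0//; apply: eq_integral => x _; rewrite /= !(funeposE, funenegE).
by rewrite (ge0_integral_pushforward mh _ mD (measurable_funeneg mf)) => [|y _]; rewrite ?funepos_ge0 ?funeneg_ge0//; apply: eq_integral => x _; rewrite /= !(funeposE, funenegE).
Qed.

(** A subspace is the zero set of x P - x, with P its orthogonal projection, and this is tested on
    coordinates. *)
Lemma measurable_vspace n (V : {vspace 'rV[R]_n}) : measurable [set x : 'rV[R]_n | x \in V].
Proof.
rewrite (_ : [set _ | _] = \bigcap_(i in [set: 'I_n])
    ((fun v : 'rV[R]_n => (v *m orthoproj V - v) 0 i) @^-1` (`[0, 0]%classic : set R))).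
  apply: fin_bigcap_measurable => // i _.
  rewrite -[X in measurable X]setTI.
  have mm : measurable_fun setT (fun v : 'rV[R]_n => (v *m orthoproj V - v) 0 i).
    under eq_fun do rewrite !mxE.
    apply: measurable_funB; last exact: measurable_mxE.
    apply: measurable_sum => j; apply: measurable_funM => //; exact: measurable_mxE.
  exact: mm.
apply/seteqP; split => x /=.
  by move=> xV i _ /=; rewrite orthoproj_id// subrr mxE in_itv/= lexx.
move=> H; suff -> : x = x *m orthoproj V by rewrite /orthoproj mulmxA memv_onb.
apply/eqP; rewrite eq_sym -subr_eq0; apply/eqP/rowP => i; rewrite [RHS]mxE.
by have := H i I; rewrite /= in_itv/= => /andP[a b]; apply/eqP; rewrite eq_le a b.
Qed.

Section onb.
Variables (n : nat) (V : {vspace 'rV[R]_n}) (f : 'rV[R]_n -> R).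
Hypothesis mf : measurable_fun setT f.

Lemma kplaneE (y : 'rV[R]_n) : kplane f (V : subspaces R n) y =
  (\int[lebesgue_rV (\dim V)]_u (f (u *m onb V + y)%R)%:E)%E.
Proof.
rewrite /kplane integral_pushforward_measurable//; last 2 first.
- exact: measurable_vspace.
- apply/measurable_EFinP; apply: measurable_funTS; apply: measurableT_comp => //.
  exact: measurable_addmx.
by rewrite (_ : _ @^-1` _ = setT)//; apply/seteqP; split => // u _ /=; exact: memv_onb.
Qed.

Lemma measurable_kplane : measurable_fun setT (kplane f (V : subspaces R n)).
Proof.
have mfD : measurable_fun setT (fun p : 'rV[R]_(\dim V) * 'rV[R]_n => (f (p.1 *m onb V + p.2))%:E).
  apply/measurable_EFinP; apply: measurableT_comp => //; apply: measurable_funD_mx => //.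
  exact: measurableT_comp (measurable_mulmx _) measurable_fst.
rewrite (_ : kplane f _ = fun y => (\int[lebesgue_rV (\dim V)]_u (fun p => (f (p.1 *m onb V + p.2))%:E)^\+ (u, y) -
  \int[lebesgue_rV (\dim V)]_u (fun p => (f (p.1 *m onb V + p.2))%:E)^\- (u, y))%E); last first.
  by apply/funext => y; rewrite kplaneE [LHS]integralE; congr (_ - _)%E; apply: eq_integral => u _; rewrite !(funeposE, funenegE).
apply: emeasurable_funB.
  by apply: (measurable_fun_fubini_tonelli_G _ (measurable_funepos mfD)).
by apply: (measurable_fun_fubini_tonelli_G _ (measurable_funeneg mfD)).
Qed.

(** The null set where [f] differs from its radial form is null on almost every translate of [V], by
    [lebesgue_rV_null_preimage]. On such a translate Pythagoras turns the plane integral into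
    [ktrans]. This holds for each [V], not just for almost every one. *)
Lemma integral_kplane_radial (q : R) (phi : R -> R) : measurable_fun setT phi -> (forall r, 0 <= phi r) ->
  (\forall x \ae lebesgue_rV n, f x = phi (enorm x)) ->
  (\int[lebesgue_vs (perp V)]_(y in [set y | y \in perp V]) `|kplane f (V : subspaces R n) y| `^ q =
   \int[nu (n - \dim V)]_rho `|ktrans (\dim V) phi rho| `^ q)%E.
Proof.
move=> mphi phi0 [N [mN N0 subN]].
have mvs (W : {vspace 'rV[R]_n}) : measurable [set x : 'rV[R]_n | x \in W].
  exact: measurable_vspace.
have mpow d (T : measurableType d) (h : T -> \bar R) (D : set T) : measurable_fun D h ->
    measurable_fun D (fun x => `|h x| `^ q)%E.
  move=> mh; apply: (measurableT_comp (measurable_poweR _)).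
  exact: measurableT_comp.
rewrite integral_pushforward_measurable//; last first.
- by apply: mpow; apply: measurable_funTS; exact: measurable_kplane.
rewrite (_ : _ @^-1` _ = setT); last by apply/seteqP; split => // u _ /=; exact: memv_onb.
rewrite -dim_perp ge0_integral_radial//; last 2 first.
- by apply: mpow; exact: measurable_ktrans.
- by move=> x; exact: poweR_ge0.
have H := lebesgue_rV_null_preimage (onb_surj V) mN N0.
apply: ge0_ae_eq_integral => //.
- apply: mpow; apply: measurableT_comp; first exact: measurable_kplane.
  exact: measurable_mulmx_onb.
- apply: mpow; apply: measurableT_comp; first exact: measurable_ktrans.
  exact: measurable_enorm.
- by move=> x _; exact: poweR_ge0.
- by move=> x _; exact: poweR_ge0.
move: H; apply: filterS => v Hv _; congr (`| _ | `^ _)%E.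
rewrite kplaneE /ktrans /mulmx_onb.
rewrite ge0_integral_radial//; last 2 first.
- by apply/measurable_EFinP; apply: (measurableT_comp mphi); exact: measurable_hypot.
- by move=> x; rewrite lee_fin.
have mline : measurable_fun setT (fun u : 'rV[R]_(\dim V) => u *m onb V + v *m onb (perp V)).
  by apply: measurable_funD_mx => //; exact: measurable_mulmx.
rewrite [LHS](@ae_eq_integral _ _ _ _ setT (fun u => (phi (Num.sqrt (enorm u ^+ 2 + enorm v ^+ 2)))%:E))//.
- by apply/measurable_EFinP; exact: measurableT_comp mf mline.
- apply/measurable_EFinP; apply: (measurableT_comp mphi).
  exact: (measurableT_comp (measurable_hypot _) (@measurable_enorm _ _)).
exists [set u : 'rV[R]_(\dim V) | N (u *m onb V + v *m onb (perp V))]; split => //.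
  by rewrite -[X in measurable X]setTI; exact: mline.
move=> u /= /not_implyP[_ fu]; apply: subN => /=; apply: contra_not fu => ->.
by rewrite /enorm dotrV_onb !sqr_sqrtr// dotrV_ge0.
Qed.

End onb.

(** The inner integral takes one value for all k-dimensional [V], and averaging a constant over
    [Gr k], of mass 1, returns it. *)
Lemma affLnorm_radial n k (dtheta : probability (subspaces R n) R) (q : R) (f : 'rV[R]_n -> R) (phi : R -> R) :
  dtheta (Gr k) = 1%E -> measurable_fun setT f -> measurable_fun setT phi -> (forall r, 0 <= phi r) ->
  (\forall x \ae lebesgue_rV n, f x = phi (enorm x)) ->
  affLnorm k dtheta q (kplane f) = 'N[nu (n - k)]_q%:E[ktrans k phi]%E.
Proof.
move=> dG mf mphi phi0 fphi; rewrite /affLnorm unlock; congr (_ `^ _)%E.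
rewrite -[RHS]mule1 -dG -integral_cst; last exact: measurable_Gr.
apply: eq_integral => V /set_mem <-.
exact: integral_kplane_radial.
Qed.

Lemma Lnorm_radial n (p : R) (f : 'rV[R]_n -> R) (phi : R -> R) :
  measurable_fun setT f -> measurable_fun setT phi ->
  (\forall x \ae lebesgue_rV n, f x = phi (enorm x)) ->
  'N[lebesgue_rV n]_p%:E[EFin \o f]%E = 'N[nu n]_p%:E[EFin \o phi]%E.
Proof.
move=> mf mphi fphi; rewrite unlock; congr (_ `^ _)%E.
have mpow d (T : measurableType d) (h : T -> R) : measurable_fun setT h ->
    measurable_fun setT (fun x => `|(EFin \o h) x| `^ p)%E.
  move=> mh; apply: (measurableT_comp (measurable_poweR _)).
  by apply: measurableT_comp => //; exact/measurable_EFinP.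
have := @ge0_integral_radial _ n (fun r => `|(EFin \o phi) r| `^ p)%E (mpow _ _ _ mphi) (fun=> poweR_ge0 _ _).
move=> ->.
apply: ge0_ae_eq_integral => //.
- exact: mpow.
- by apply: (mpow _ _ (phi \o @enorm R n)); apply: measurableT_comp => //; exact: measurable_enorm.
- by move=> x _; exact: poweR_ge0.
- by move=> x _; exact: poweR_ge0.
by apply: filterS fphi => x /= -> _.
Qed.

End ktrans.

(** * Symmetric decreasing rearrangement and profiles *)

Section profile.
Context {R : realType}.
Local Notation nu := (@radial_measure R).
Implicit Types (phi : R -> R).

(* The half-line r <= 0 is null for the radial measures; prescribing 0 there makes profiles measurable. *)
Definition profile phi := [/\ forall r, 0 <= phi r, forall r, r <= 0 -> phi r = 0 &
  forall r s, 0 < r -> r <= s -> phi s <= phi r].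

(** A superlevel set is all of R when the level is at most 0; otherwise it lies in the positive
    half-line, where monotonicity makes it an interval. *)
Lemma measurable_profile phi : profile phi -> measurable_fun setT phi.
Proof.
move=> [phi0 phiN phinin]; apply: (measurability (@RGenCInfty.G R)) => [|/= _ [_] [c] -> <-].
  exact: RGenCInfty.measurableE.
rewrite setTI; have [c0|c0] := leP c 0.
  rewrite (_ : _ @^-1` _ = setT)//; apply/seteqP; split => // x _ /=.
  by rewrite in_itv/= andbT (le_trans c0).
apply: is_interval_measurable => s t/=; rewrite !in_itv/= !andbT => fs ft u /andP[su ut].
have s0 : 0 < s by rewrite ltNge; apply/negP => /phiN E; move: fs; rewrite E leNgt c0.
by rewrite in_itv/= andbT (le_trans ft)// phinin// (lt_le_trans s0).
Qed.

Lemma radial_measureU n (A B : set R) : measurable A -> measurable B -> A `&` B = set0 ->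
  nu n (A `|` B) = (nu n A + nu n B)%E.
Proof. by move=> mA mB AB; exact: measureU. Qed.

Lemma radial_measureU2 n (A B : set R) : measurable A -> measurable B ->
  (nu n (A `|` B) <= nu n A + nu n B)%E.
Proof. by move=> mA mB; exact: measureU2. Qed.

(** The volume r^n |B| of a ball depends continuously on r, which leaves no mass for a sphere. *)
Lemma radial_measure1 n r : (0 < n)%N -> nu n [set r] = 0%E.
Proof.
move=> n0; have [r0|r0] := leP r 0.
  apply/eqP; rewrite eq_le measure_ge0 andbT -(@radial_measure_le0 R n)//.
  by rewrite le_measure ?inE// => x /= ->; rewrite in_itv.
have w0 := @ballvol_gt0 R n.
apply/eqP; rewrite eq_le measure_ge0 andbT; apply/lee_addgt0Pr => e e0; rewrite add0e.
have [d /= d0 dP] : \forall s \near (0 : R)^'+, (r + s) ^+ n * ballvol n < r ^+ n * ballvol n + e.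
  have : (fun s : R => (r + s) ^+ n * ballvol n) @ (0:R)^'+ --> (r + 0) ^+ n * ballvol n.
    apply: cvg_at_right_filter; apply: cvgM; last exact: cvg_cst.
    apply: (@continuous_comp _ _ _ (fun s => r + s) (fun x => x ^+ n)); last exact: exprn_continuous.
    by apply: cvgD; [exact: cvg_cst|exact: cvg_id].
  by move/cvgr_lt; apply; rewrite addr0 ltrDl.
have d20 : 0 < d / 2 by rewrite divr_gt0.
have {}dP : (r + d / 2) ^+ n * ballvol n < r ^+ n * ballvol n + e.
  apply: dP => //=; rewrite sub0r normrN gtr0_norm// ltr_pdivrMr// ltr_pMr// ltr1n//.
have : (nu n (`]-oo, r[%classic `|` [set r]) <= nu n `]-oo, (r + d / 2)%R[%classic)%E.
  rewrite le_measure ?inE//; first exact: measurableU.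
  move=> x /= [|->]; rewrite !in_itv/= ?ltrDl// => /lt_trans; apply.
  by rewrite ltrDl.
rewrite radial_measureU//; last by rewrite -subset0 => x [/=]; rewrite in_itv/= => /[swap] ->; rewrite ltxx.
rewrite !radial_measureNy// ?addr_gt0// => H.
have : ((r ^+ n * ballvol n)%:E + nu n [set r] <= (r ^+ n * ballvol n)%:E + e%:E)%E.
  by apply: (le_trans H); rewrite lee_fin ltW.
by rewrite leeD2lE.
Qed.

Lemma radial_measure_countable n (E : set R) : (0 < n)%N -> countable E -> measurable E /\ nu n E = 0%E.
Proof.
move=> n0 cE; split; first exact: countable_measurable.
have /countable_injP [f injf] := cE.
have : (nu n).-negligible (\bigcup_i [set x | E x /\ f x = i]).
  apply: negligible_bigcup => i.
  have [[x [Ex fx]]|H] := pselect (exists x, E x /\ f x = i); last first.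
    rewrite (_ : [set _ | _] = set0); first exact: negligible_set0.
    by rewrite -subset0 => x Hx; apply: H; exists x.
  exists [set x]; split => //; first exact: radial_measure1.
  by move=> y /= [Ey fy]; apply: injf; rewrite ?inE// fy.
move=> H; apply: measure_negligible; first exact: countable_measurable.
by apply: negligibleS H => x Ex; exists (f x).
Qed.

(** A jump is recorded by a gap [e] between all values to its left and all values to its right. This
    avoids one-sided limits, and the value at [r] itself does not enter. *)
Definition jumps phi := [set r | 0 < r /\ exists2 e, 0 < e &
  forall s t, 0 < s -> s < r -> r < t -> phi t + e <= phi s].

(** Each jump has a rational in its gap. By monotonicity the gaps of distinct jumps lie one above
    the other, so the rationals differ. *)
Lemma countable_jumps phi : profile phi -> countable (jumps phi).
Proof.
move=> [phi0 phiN phinin].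
have H r : exists u : rat, jumps phi r ->
    (forall s, 0 < s -> s < r -> ratr u < phi s) /\ (forall t, r < t -> phi t < ratr u).
  have [[r0 [e e0 He]]|nJ] := pselect (jumps phi r); last by exists 0.
  pose S := [set phi t | t in `]r, +oo[%classic].
  have r2 : 0 < r / 2 < r.
    by rewrite divr_gt0//= ltr_pdivrMr// ltr_pMr// ltr1n.
  have uS : ubound S (phi (r / 2) - e).
    move=> _ [t /= + <-]; rewrite in_itv/= andbT => rt; rewrite lerBrDr.
    by case/andP: r2 => ? ?; exact: He.
  have hS : has_sup S.
    split; first by exists (phi (r + 1)), (r + 1) => //=; rewrite in_itv/= andbT ltrDl.
    by eexists; exact: uS.
  (* All values to the right are at most [sup S], all values to the left at least [sup S + e]. *)
  have [u] : exists u : rat, (ratr u : R) \in `]sup S, sup S + e[ by apply: rat_in_itvoo; rewrite ltrDl.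
  rewrite in_itv/= => /andP[u1 u2]; exists u => _; split => [s s0 sr|t rt].
    apply: (lt_le_trans u2); rewrite -lerBrDr; apply: ge_sup.
      by exists (phi (r + 1)), (r + 1) => //=; rewrite in_itv/= andbT ltrDl.
    by move=> _ [t /= + <-]; rewrite in_itv/= andbT => rt; rewrite lerBrDr He.
  apply: le_lt_trans u1; apply: sup_upper_bound => //.
  by exists t => //=; rewrite in_itv/= andbT.
have [u uP] := choice H.
apply/countable_injP; exists (fun r => pickle (u r)).
have mono r s : r < s -> jumps phi r -> jumps phi s -> (ratr (u s) : R) < ratr (u r).
  move=> rs Jr Js; have [h _] := uP s Js; have [_ h'] := uP r Jr.
  have m1 : r < (r + s) / 2 by rewrite midf_lt.
  have m2 : (r + s) / 2 < s by rewrite midf_lt.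
  by rewrite (lt_trans (h ((r + s) / 2) (lt_trans Jr.1 m1) m2))// h'.
move=> r s /set_mem Jr /set_mem Js /(pcan_inj pickleK) E.
have [/mono/(_ Jr Js)|/mono/(_ Js Jr)|] := ltgtP r s; rewrite ?E ?ltxx//.
Qed.

Lemma not_jump phi r e : ~ jumps phi r -> 0 < r -> 0 < e ->
  exists s t, [/\ 0 < s, s < r, r < t & phi s < phi t + e].
Proof.
move=> nJ r0 e0; apply: contrapT => H; apply: nJ; split => //; exists e => // s t s0 sr rt.
by rewrite leNgt; apply/negP => h; apply: H; exists s, t.
Qed.

End profile.

(** * Equality with the rearrangement, in terms of profiles *)

Section rearr.
Context {R : realType} {n : nat}.
Local Notation nu := (@radial_measure R).
Hypothesis n0 : (0 < n)%N.
Implicit Types (f : 'rV[R]_n -> R) (phi : R -> R).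

(** The levels whose superlevel set is larger than the ball of radius [r]. They form an interval
    starting at 0, whose length is the rearrangement at radius [r]. *)
Let layer f r : set R := [set t | 0 < t /\ (nu n `]-oo, r[%classic < lebesgue_rV n [set z | (t < `|f z|)%R])%E].

Lemma enorm_ltE r : lebesgue_rV n [set z : 'rV[R]_n | (enorm z < r)%R] = nu n `]-oo, r[%classic.
Proof.
rewrite /radial_measure /pushforward; congr (lebesgue_rV n _).
Qed.

Lemma measurable_superlevel f t : measurable_fun setT f -> measurable [set z | t < `|f z|].
Proof.
move=> mf; rewrite (_ : [set _ | _] = (fun z => `|f z|) @^-1` `]t, +oo[%classic); last first.
  by apply/seteqP; split => x /=; rewrite in_itv/= andbT.
have mnf : measurable_fun setT (fun z => `|f z|) by exact: measurableT_comp.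
by rewrite -[X in measurable X]setTI; exact: mnf.
Qed.

Let layer_down f r s t : measurable_fun setT f -> 0 < s -> s <= t -> layer f r t -> layer f r s.
Proof.
move=> mf s0 st [t0 H]; split => //; apply: (lt_le_trans H).
rewrite le_measure ?inE//; try exact: measurable_superlevel.
by move=> z /=; exact: le_lt_trans.
Qed.

Let measurable_layer f r : measurable_fun setT f -> measurable (layer f r : set (measurableTypeR R)).
Proof.
move=> mf; apply: is_interval_measurable => s t ls lt u /andP[su ut].
exact: (layer_down mf (lt_le_trans ls.1 su) ut lt).
Qed.

Let rearrE f x : measurable_fun setT f -> rearr f x = lebesgue_measure (layer f (enorm x)).
Proof.
move=> mf; rewrite /rearr.
have -> : (layer f (enorm x)) = (layer f (enorm x)) `&` `]0, +oo[%classic.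
  by apply/esym/setIidl => t /= [t0 _]; rewrite in_itv/= andbT.
rewrite -integral_indic//; last exact: measurable_layer.
apply: eq_integral => t; rewrite inE/= in_itv/= andbT => t0.
rewrite !indicE; congr ((nat_of_bool _)%:R%:E).
apply/idP/idP => /set_mem H; apply/mem_set.
  by split => //; rewrite -enorm_ltE; exact: H.
by case: H => _; rewrite -enorm_ltE; exact.
Qed.

(** The rearrangement depends on [x] only through its norm, and fewer levels qualify as the ball
    grows; the profile is this function of the radius, set to 0 on r <= 0. *)
Lemma eq_rearr_profile f : measurable_fun setT f -> eq_rearr f ->
  exists2 phi, profile phi & \forall x \ae lebesgue_rV n, f x = phi (enorm x).
Proof.
move=> mf fE; pose Phi r := lebesgue_measure (layer f r : set (measurableTypeR R)).
have Phinin r s : r <= s -> (Phi s <= Phi r)%E.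
  move=> rs; rewrite le_measure ?inE//; try exact: measurable_layer.
  move=> t [t0 H]; split => //; apply: le_lt_trans H.
  by rewrite le_measure ?inE// => x /=; rewrite !in_itv/= => /lt_le_trans; exact.
have ae0 : \forall x \ae lebesgue_rV n, 0 < enorm (x : 'rV[R]_n).
  exists ((@enorm R n) @^-1` `]-oo, 0]%classic); split.
  - exact: measurable_enorm_preimage.
  - exact: radial_measure_le0.
  - by move=> x /=; rewrite in_itv/= => /negP; rewrite -leNgt.
have fE' : \forall x \ae lebesgue_rV n, 0 < enorm x /\ (f x)%:E = Phi (enorm x).
  by apply: filterS2 fE ae0 => x + ?; rewrite rearrE.
(* The ball of radius [r] is not null, so it contains a point where [Phi] equals the real number
   [f x]; monotonicity carries finiteness from there to [r]. *)
have Phifin r : 0 < r -> (Phi r < +oo)%E.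
  move=> r0; case: fE' => N [mN N0 subN].
  have [x [xr [x0 xE]]] : exists x, enorm x < r /\ (0 < enorm x /\ (f x)%:E = Phi (enorm x)).
    apply: contrapT => H.
    have : (nu n `]-oo, r[%classic <= lebesgue_rV n N)%E.
      rewrite -enorm_ltE le_measure ?inE//; first exact: measurable_enorm_lt.
      by move=> x /= xr; apply: subN => /= h; apply: H; exists x.
    rewrite N0 radial_measureNy// lee_fin leNgt mulr_gt0// ?exprn_gt0//; exact: ballvol_gt0.
  by apply: (le_lt_trans (Phinin _ _ (ltW xr))); rewrite -xE ltry.
exists (fun r => if 0 < r then fine (Phi r) else 0).
  split => [r|r|r s r0 rs].
  - by case: ifP => // _; rewrite fine_ge0//.
  - by rewrite leNgt => /negbTE ->.
  - rewrite r0 (lt_le_trans r0 rs) fine_le//.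
    + by rewrite ge0_fin_numE ?Phifin// (lt_le_trans r0).
    + by rewrite ge0_fin_numE ?Phifin.
    + exact: Phinin.
by apply: filterS fE' => x [x0 E]; rewrite x0 -E.
Qed.

Lemma ae_enorm (P : R -> Prop) : {ae nu n, forall r, P r} -> \forall x \ae lebesgue_rV n, P (enorm x).
Proof.
move=> [N [mN N0 subN]]; exists (@enorm R n @^-1` N); split => //.
  exact: measurable_enorm_preimage.
by move=> x /= nP; exact: subN.
Qed.

Lemma ae_profile_continuous phi : profile phi -> {ae nu n, forall r, 0 < r /\ ~ jumps phi r}.
Proof.
move=> pphi; have [mJ J0] := radial_measure_countable n0 (countable_jumps pphi).
exists (`]-oo, 0]%classic `|` jumps phi); split.
- exact: measurableU.
- apply/eqP; rewrite eq_le measure_ge0 andbT; apply: le_trans; first exact: radial_measureU2.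
  by rewrite J0 adde0 radial_measure_le0.
- move=> r /= /not_andP[/negP|/contrapT]; last by right.
  by rewrite -leNgt => r0; left; rewrite in_itv.
Qed.

(** At radius |x| the rearrangement lies between phi (t) and phi (s) for all s < |x| < t. Off the
    jumps these two values, and phi (|x|) between them, can be brought arbitrarily close. *)
Lemma profile_eq_rearr f phi : measurable_fun setT f -> profile phi ->
  (\forall x \ae lebesgue_rV n, f x = phi (enorm x)) -> eq_rearr f.
Proof.
move=> mf pphi fE; have [phi0 phiN phinin] := pphi.
have mphi := measurable_profile pphi.
have levelE t : 0 <= t -> lebesgue_rV n [set z | t < `|f z|] = nu n [set r | t < phi r].
  move=> t0; have m1 := measurable_superlevel t mf.
  have m2 : measurable [set r | t < phi r].
    rewrite (_ : [set _ | _] = phi @^-1` `]t, +oo[%classic); last first.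
      by apply/seteqP; split => x /=; rewrite in_itv/= andbT.
    by rewrite -[X in measurable X]setTI; exact: mphi.
  rewrite /radial_measure /pushforward.
  rewrite -[X in lebesgue_rV n X = _]setIT -[X in _ = lebesgue_rV n X]setIT -!integral_indic//; last first.
    exact: measurable_enorm_preimage.
  apply: ge0_ae_eq_integral => //.
  - by apply/measurable_EFinP.
  - by apply/measurable_EFinP; apply: measurable_indic; exact: measurable_enorm_preimage.
  - apply: filterS fE => z fz _; rewrite !indicE; congr ((nat_of_bool _)%:R%:E).
    by apply/idP/idP => /set_mem/= H; apply/mem_set => /=; move: H; rewrite fz ger0_norm.
have := ae_enorm (ae_profile_continuous pphi).
move: fE; apply: filterS2 => x -> [x0 nJ]; rewrite rearrE//.
(* A level [u] below [phi t] is exceeded on all of ]0, t], so its superlevel set is strictly larger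
   than the ball of radius |x|. *)
have low t : enorm x < t -> ((phi t)%:E <= lebesgue_measure (layer f (enorm x)))%E.
  move=> xt; rewrite [leLHS](_ : _ = lebesgue_measure (`]0, phi t[%classic : set R)); last first.
    rewrite lebesgue_measure_itv/= lte_fin -EFinB subr0; case: ltP => // pt0.
    by congr (_%:E); apply/eqP; rewrite eq_le pt0 phi0.
  rewrite le_measure ?inE//; first exact: measurable_layer.
  move=> u /=; rewrite in_itv/= => /andP[u0 ut]; split => //.
  rewrite levelE ?(ltW u0)//; apply: (@lt_le_trans _ _ (nu n `]-oo, t[%classic)).
    rewrite !radial_measureNy//; last exact: lt_trans xt.
    by rewrite lte_fin ltr_pM2r ?ballvol_gt0// ltrXn2r ?ltW//; lia.
  apply: (@le_trans _ _ (nu n (`]-oo, 0]%classic `|` [set r | u < phi r]))).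
    rewrite le_measure ?inE//.
      apply: measurableU => //.
      rewrite (_ : [set _ | _] = phi @^-1` `]u, +oo[%classic); last first.
        by apply/seteqP; split => y /=; rewrite in_itv/= andbT.
      by rewrite -[X in measurable X]setTI; exact: mphi.
    move=> r /=; rewrite !in_itv/= => rt; have [r0|r0] := leP r 0; first by left.
    by right; rewrite (lt_le_trans ut)// phinin// ltW.
  apply: le_trans; first apply: radial_measureU2 => //.
    rewrite (_ : [set _ | _] = phi @^-1` `]u, +oo[%classic); last first.
      by apply/seteqP; split => y /=; rewrite in_itv/= andbT.
    by rewrite -[X in measurable X]setTI; exact: mphi.
  by rewrite radial_measure_le0// add0e.
(* A level above [phi s] is exceeded only at radii smaller than |x|, so it does not belong to the
   layer. *)
have high s : 0 < s -> s < enorm x -> (lebesgue_measure (layer f (enorm x)) <= (phi s)%:E)%E.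
  move=> s0 sx; rewrite [leRHS](_ : _ = lebesgue_measure (`]0, phi s]%classic : set R)); last first.
    rewrite lebesgue_measure_itv/= lte_fin -EFinB subr0; case: ltP => // pt0.
    by congr (_%:E); apply/eqP; rewrite eq_le pt0 phi0.
  rewrite le_measure ?inE//; first exact: measurable_layer.
  move=> u [u0 H] /=; rewrite in_itv/= u0 leNgt; apply/negP => ups.
  move: H; rewrite levelE ?(ltW u0)// ltNge => /negP; apply.
  rewrite le_measure ?inE//.
    rewrite (_ : [set _ | _] = phi @^-1` `]u, +oo[%classic); last first.
      by apply/seteqP; split => y /=; rewrite in_itv/= andbT.
    by rewrite -[X in measurable X]setTI; exact: mphi.
  move=> r /= ur; rewrite in_itv/= ltNge; apply/negP => xr.
  have : phi r <= phi s by rewrite phinin// (le_trans (ltW sx)).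
  by rewrite leNgt (lt_trans ups).
apply/eqP; rewrite eq_le; apply/andP; split; apply/lee_addgt0Pr => e e0.
  have [s [t [s0 sx xt st]]] := not_jump nJ x0 e0.
  apply: (@le_trans _ _ (phi t + e)%:E); last by rewrite EFinD leeD2r// low.
  by rewrite lee_fin (le_trans _ (ltW st))// phinin// ltW.
have [s [t [s0 sx xt st]]] := not_jump nJ x0 e0.
apply: (le_trans (high s s0 sx)); rewrite -EFinD lee_fin (le_trans (ltW st))// lerD2r.
by rewrite phinin// ltW.
Qed.

End rearr.

(** * The one-dimensional transform estimates *)

Section powR_facts.
Context {R : realType}.

Lemma cvg_powR T (F : set_system T) {FF : Filter F} (u : T -> R) (l p : R) : 0 < p ->
  (forall t, 0 <= u t) -> 0 <= l -> u t @[t --> F] --> l -> u t `^ p @[t --> F] --> l `^ p.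
Proof.
move=> p0 u0; rewrite le_eqVlt => /predU1P[<-|l0] ul.
  rewrite powR0 ?gt_eqF//; apply/cvgrPdist_lt => e e0.
  have e1 : 0 < e `^ p^-1 by exact: powR_gt0.
  have /cvgrPdist_lt/(_ _ e1) := ul; apply: filterS => t.
  rewrite !sub0r !normrN !ger0_norm ?powR_ge0// => ut.
  have := @gt0_ltr_powR R p p0 (u t) (e `^ p^-1).
  rewrite !nnegrE u0 powR_ge0 => /(_ isT isT ut) /lt_le_trans; apply.
  by rewrite -powRrM mulVf ?gt_eqF// powRr1// ltW.
apply: (@cvg_comp _ _ _ u (fun x => x `^ p)); first exact: ul.
have : {for l, continuous (fun x : R => x `^ p)}.
  apply: differentiable_continuous; apply/derivable1_diffP.
  by apply: derivable_powR; rewrite in_itv/= andbT.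
exact.
Qed.

Lemma geometric_sum_le (x : R) N : 0 <= x -> x < 1 -> \sum_(0 <= i < N) x ^+ i <= (1 - x)^-1.
Proof.
move=> x0 x1; have x1' : 0 < 1 - x by rewrite subr_gt0.
rewrite -[leRHS]mul1r ler_pdivlMr// mulrC -[1 - x]opprB mulNr big_mkord -subrX1.
by rewrite opprB lerBlDr lerDl exprn_ge0.
Qed.

Lemma powR_lt1 (s : R) : s < 0 -> (2 : R) `^ s < 1.
Proof.
move=> s0; rewrite /powR pnatr_eq0/= expR_lt1 nmulr_rlt0// ln_gt0// ltr1n//.
Qed.

Lemma poweR_Lnorm_ge0 d (T : measurableType d) (mu : {measure set T -> \bar R}) (g : T -> R) (q : R) :
  0 < q -> (forall x, 0 <= g x) ->
  ('N[mu]_q%:E[EFin \o g] `^ q = \int[mu]_x (g x `^ q)%:E)%E.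
Proof.
move=> q0 g0; have q_neq0 : q != 0 by rewrite gt_eqF.
rewrite (poweR_Lnorm _ _ q_neq0); apply: eq_integral => r _.
by rewrite /= ger0_norm.
Qed.

End powR_facts.

(** * Dyadic shells and a Hardy-type inequality for the transform *)

Section hardy.
Context {R : realType}.
Local Notation nu := (@radial_measure R).

Lemma integral_radial_ball n (r : R) : 0 < r ->
  (\int[nu n]_x (\1_(`]-oo, r[%classic) x)%:E = (r ^+ n * ballvol n)%:E)%E.
Proof. by move=> r0; rewrite -radial_measureNy// integral_indic// setIT. Qed.

Variables (k : nat) (phi : R -> R).
Hypothesis pphi : profile phi.

Let phi0 r : 0 <= phi r. Proof. by have [] := pphi. Qed.

(** The ball of radius 2^(i+1) rho in R^k has volume [ck] times (2^i rho)^k. *)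
Let ck : R := 2 ^+ k * ballvol k.

Let ck_ge0 : 0 <= ck. Proof. by rewrite mulr_ge0 ?exprn_ge0// ltW// ballvol_gt0. Qed.

Definition shell (r : R) := r ^+ k * phi r.

Let shell_ge0 r : 0 <= r -> 0 <= shell r.
Proof. by move=> r0; rewrite mulr_ge0 ?exprn_ge0. Qed.

(** The least [i] with r < 2^(i+1) rho. Shell 0 is the whole ball of radius 2 rho; there the lower
    bound comes from [rho] instead of [r]. *)
Let dyadic (r rho : R) : 0 < rho -> exists i, r < 2 ^+ i.+1 * rho /\ 2 ^+ i * rho <= Num.sqrt (r ^+ 2 + rho ^+ 2).
Proof.
move=> rho0; have [r2|r2] := ltP r (2 * rho).
  exists 0; rewrite expr1 expr0 mul1r; split => //.
  apply: (le_trans (ler_norm _)).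
  by rewrite -sqrtr_sqr ler_wsqrtr// lerDr sqr_ge0.
have ex : exists i, r < 2 ^+ i.+1 * rho.
  exists (Num.truncn (r / rho)); rewrite -ltr_pdivrMr//; apply: (lt_trans (truncnS_gt _)).
  by rewrite -natrX ltr_nat ltn_expl.
case: (ex_minnP ex) => -[|i] ri mini; first by move: ri; rewrite expr1 ltNge r2.
exists i.+1; split => //.
have {}mini : 2 ^+ i.+1 * rho <= r by rewrite leNgt; apply/negP => /mini; rewrite ltnn.
apply: (le_trans mini); apply: (le_trans (ler_norm _)).
by rewrite -sqrtr_sqr ler_wsqrtr// lerDl sqr_ge0.
Qed.

(** On shell [i] the profile is at most its value at 2^i rho, and the shell is contained in a ball
    of volume [ck] times (2^i rho)^k. *)
Lemma ktrans_le_shells (rho : R) : 0 < rho ->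
  (ktrans k phi rho <= \sum_(0 <= i <oo) (ck * shell (2 ^+ i * rho))%:E)%E.
Proof.
move=> rho0; have [_ _ phinin] := pphi.
have mphi := measurable_profile pphi.
have i2 i : 0 < 2 ^+ i * rho by rewrite mulr_gt0// exprn_gt0.
apply: (@le_trans _ _ (\int[nu k]_r \sum_(0 <= i <oo) (phi (2 ^+ i * rho) * \1_(`]-oo, (2 ^+ i.+1 * rho)[%classic) r)%:E)%E).
  apply: ge0_le_integral => //.
  - by move=> r _; rewrite lee_fin.
  - by apply/measurable_EFinP; apply: (measurableT_comp mphi); exact: measurable_hypot.
  - apply: ge0_emeasurable_sum => [i r _ _|i _].
      by rewrite lee_fin mulr_ge0.
    by apply/measurable_EFinP; apply: measurable_funM.
  - move=> r _; have [i [ri ir]] := dyadic r rho0.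
    apply: le_trans (nneseries_lim_ge i.+1 _); last first.
      by move=> j _ _; rewrite lee_fin mulr_ge0.
    rewrite big_nat_recr//= [leRHS](_ : _ = (\sum_(0 <= j < i) phi (2 ^+ j * rho) * \1_(`]-oo, (2 ^+ j.+1 * rho)[%classic) r +
      phi (2 ^+ i * rho) * \1_(`]-oo, (2 ^+ i.+1 * rho)[%classic) r)%:E); last by rewrite EFinD -sumEFin.
    rewrite lee_fin -[leLHS]add0r lerD//.
      by apply: sumr_ge0 => j _; rewrite mulr_ge0.
    by rewrite indicE mem_set ?mulr1 ?phinin//= in_itv.
rewrite integral_nneseries//; last 2 first.
- move=> i; apply/measurable_EFinP; apply: measurable_funM => //.
- by move=> i r _; rewrite lee_fin mulr_ge0.
apply: lee_nneseries => [i _ _|i _]; first by apply: integral_ge0 => r _; rewrite lee_fin mulr_ge0.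
under eq_integral do rewrite EFinM.
rewrite ge0_integralZl_EFin//; last by apply/measurable_EFinP.
rewrite integral_radial_ball// -EFinM lee_fin /shell /ck.
rewrite exprS -mulrA [in leLHS]exprMn le_eqVlt; apply/orP; left; apply/eqP; ring.
Qed.

(** Under the weak bound the shell terms are dominated by a geometric series of ratio 2^(k-a), which
    is less than 1 because a > k. *)
Lemma ktrans_weak (a B rho : R) : k%:R < a -> 0 <= B -> (forall r, 0 < r -> phi r <= B * r `^ (- a)) ->
  0 < rho -> (ktrans k phi rho <= (ck / (1 - 2 `^ (k%:R - a)) * B * rho `^ (k%:R - a))%:E)%E.
Proof.
move=> ka B0 phiB rho0; apply: (le_trans (ktrans_le_shells rho0)).
have i2 i : 0 < 2 ^+ i * rho by rewrite mulr_gt0// exprn_gt0.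
have x1 : (2 : R) `^ (k%:R - a) < 1 by rewrite powR_lt1// subr_lt0.
apply: lime_le.
  by apply: is_cvg_nneseries => i _ _; rewrite lee_fin mulr_ge0// shell_ge0// ltW.
apply: nearW => N; rewrite sumEFin lee_fin.
apply: (@le_trans _ _ (\sum_(0 <= i < N) (ck * B * rho `^ (k%:R - a)) * (2 `^ (k%:R - a)) ^+ i)).
  apply: ler_sum => i _.
  rewrite [leRHS](_ : _ = ck * (B * (rho `^ (k%:R - a) * (2 `^ (k%:R - a)) ^+ i))); last by ring.
  rewrite ler_wpM2l//.
  have -> : rho `^ (k%:R - a) * (2 `^ (k%:R - a)) ^+ i = (2 ^+ i * rho) `^ (k%:R - a).
    by rewrite powRM ?exprn_ge0 ?(ltW rho0)// mulrC -powR_mulrn ?powR_ge0// powRAC powR_mulrn.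
  have -> : (2 ^+ i * rho) `^ (k%:R - a) = (2 ^+ i * rho) ^+ k * (2 ^+ i * rho) `^ (- a).
    by rewrite powRD ?(gt_eqF (i2 _)) ?implybT// powR_mulrn// ltW.
  rewrite /shell [leRHS]mulrCA ler_wpM2l ?exprn_ge0 ?(ltW (i2 _))//; exact: phiB.
rewrite -mulr_sumr.
rewrite [leRHS](_ : _ = (ck * B * rho `^ (k%:R - a)) * (1 - 2 `^ (k%:R - a))^-1); last by ring.
apply: ler_wpM2l; first by rewrite mulr_ge0 ?powR_ge0// mulr_ge0.
by apply: geometric_sum_le => //; exact: powR_ge0.
Qed.

(** Minkowski on the sum of shells: in L^q of the radial measure of R^m the i-th dilate has norm
    2^(-im/q) times the original, so the norms form a convergent geometric series. *)
Lemma hardy_ktrans m (q : R) : 1 <= q -> (0 < m)%N -> (forall rho, 0 < rho -> (ktrans k phi rho < +oo)%E) ->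
  (\int[nu m]_rho `|ktrans k phi rho| `^ q <= ((ck / (1 - 2 `^ (- (m%:R / q)))) `^ q)%:E *
     \int[nu m]_rho ((shell `|rho| `^ q)%:E))%E.
Proof.
move=> q1 m0 Kfin; have [_ _ phinin] := pphi.
have q0 : 0 < q by apply: lt_le_trans q1.
have mphi := measurable_profile pphi.
have mk := measurable_ktrans k mphi phi0.
pose K rho := fine (ktrans k phi rho) * \1_(`]0, +oo[%classic) rho.
have mK : measurable_fun setT K by apply: measurable_funM => //; exact: measurableT_comp.
have K0 rho : 0 <= K rho by rewrite mulr_ge0// fine_ge0// ktrans_ge0.
have KE rho : 0 < rho -> ktrans k phi rho = (K rho)%:E.
  move=> r0; rewrite /K indicE mem_set/= ?in_itv/= ?andbT// mulr1.
  by rewrite fineK// ge0_fin_numE ?Kfin// ktrans_ge0.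
have KN rho : rho <= 0 -> K rho = 0.
  by move=> r0; rewrite /K indicE memNset ?mulr0//= in_itv/= andbT; apply/negP; rewrite -leNgt.
(* The absolute value makes [h] nonnegative on all of R and changes it only on the null
   half-line. *)
pose h (r : R) := shell `|r|.
have h0 r : 0 <= h r by exact: shell_ge0.
have mh : measurable_fun setT h.
  by apply: measurable_funM; [exact: measurable_funX|exact: (measurableT_comp mphi)].
pose F N r := \sum_(0 <= i < N) ck * h (2 ^+ i * r).
have mhi i : measurable_fun setT (fun r : R => h (2 ^+ i * r)).
  by apply: (measurableT_comp mh); exact: measurable_funM.
have mF N : measurable_fun setT (F N).
  by apply: measurable_sum => i; apply: measurable_funM.
have F0 N r : 0 <= F N r by apply: sumr_ge0 => i _; rewrite mulr_ge0.
(* The factor by which the dilation g (rho) -> g (2 rho) changes the L^q norm. *)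
set x : R := 2 `^ (- (m%:R / q)).
have x1 : x < 1 by rewrite powR_lt1// oppr_lt0 divr_gt0// ltr0n.
have mpow (g : R -> R) : measurable_fun setT g -> measurable_fun setT (fun r : R => ((g r) `^ q)%:E : \bar R).
  move=> mg; apply/measurable_EFinP.
  by apply: (@measurableT_comp _ _ _ _ _ _ (fun x => x `^ q)) mg; exact: measurable_powR.
have Nh i : ('N[nu m]_q%:E[EFin \o (fun r => ck * h (2 ^+ i * r))%R] = (ck * x ^+ i)%:E * 'N[nu m]_q%:E[EFin \o h])%E.
  rewrite unlock -[in RHS](_ : ((ck * x ^+ i) `^ q)%:E `^ q^-1 = (ck * x ^+ i)%:E)%E; last first.
    by rewrite poweR_EFin -powRrM mulfV ?gt_eqF// powRr1// mulr_ge0 ?exprn_ge0 ?powR_ge0.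
  rewrite -poweRM; last 2 first.
  - by rewrite lee_fin powR_ge0.
  - by apply: integral_ge0 => r _; exact: poweR_ge0.
  congr (_ `^ _)%E.
  have -> : (\int[nu m]_r `|(EFin \o h) r| `^ q = \int[nu m]_r (h r `^ q)%:E)%E.
    by apply: eq_integral => r _; rewrite /= ger0_norm.
  rewrite -(@ge0_integral_radial_scale _ m (2 ^+ i) (fun r => (h r `^ q)%:E))//; last 2 first.
  - exact: mpow.
  - by move=> r; rewrite lee_fin powR_ge0.
  rewrite muleA -EFinM -ge0_integralZl//; last 3 first.
  - exact: (mpow (fun r => h (2 ^+ i * r))).
  - by move=> r _; rewrite lee_fin powR_ge0.
  - by rewrite lee_fin mulr_ge0 ?powR_ge0// ?exprn_ge0// exprn_ge0.
  apply: eq_integral => r _; rewrite /= ger0_norm ?(mulr_ge0 ck_ge0)// powRM// -EFinM; congr (_%:E).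
  rewrite powRM ?exprn_ge0 ?powR_ge0// -!mulrA; congr (_ * _).
  rewrite mulrA -[LHS]mul1r; congr (_ * _).
  rewrite -powR_mulrn ?powR_ge0// /x powRAC -powRrM mulrC -[(2 ^+ i) ^+ m]powR_mulrn ?exprn_ge0//.
  rewrite -[2 ^+ i]powR_mulrn// -!powRrM -powRD ?pnatr_eq0 ?implybT//.
  rewrite (_ : _ + _ = 0) ?powRr0//; field; lra.
have NF N : ('N[nu m]_q%:E[EFin \o F N] <= (ck / (1 - x))%:E * 'N[nu m]_q%:E[EFin \o h])%E.
  apply: (@le_trans _ _ ((\sum_(0 <= i < N) ck * x ^+ i)%:E * 'N[nu m]_q%:E[EFin \o h])%E); last first.
    apply: lee_wpmul2r; first exact: Lnorm_ge0.
    rewrite lee_fin -mulr_sumr; apply: ler_wpM2l => //.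
    by apply: geometric_sum_le x1; rewrite powR_ge0.
  elim: N => [|N IH].
    rewrite big_geq// mul0e (_ : EFin \o F 0 = cst 0%E) ?Lnorm0// ?eqe ?gt_eqF//.
    by apply/funext => r; rewrite /= /F big_geq.
  rewrite (_ : F N.+1 = F N \+ (fun r => ck * h (2 ^+ N * r))); last first.
    by apply/funext => r; rewrite /= /F big_nat_recr.
  apply: le_trans; first apply: eminkowski => //; first exact: measurable_funM.
  have ckx i : 0 <= ck * x ^+ i.
    by apply: mulr_ge0 => //; rewrite exprn_ge0 ?powR_ge0.
  rewrite Nh big_nat_recr//= EFinD ge0_muleDl ?leeD2r// lee_fin ?ckx//.
  exact: sumr_ge0.
(* Partial sums capped by the transform converge to it exactly, so Fatou carries the uniform bound
   on the partial sums over to the transform. *)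
pose G N r := Num.min (F N r) (K r).
have G0 N r : 0 <= G N r by rewrite le_min F0 K0.
have mG N : measurable_fun setT (G N) by exact: measurable_minr.
have F_nd r : nondecreasing_seq (F ^~ r).
  apply/nondecreasing_seqP => N.
  by rewrite /F big_nat_recr//= lerDl mulr_ge0.
have GK r : G N r @[N --> \oo] --> K r.
  have [r0|r0] := leP r 0.
    by rewrite /G KN// [X in X @ _](_ : _ = cst 0); [exact: cvg_cst|apply/funext => N; rewrite min_r].
  apply/cvgrPdist_le => e e0.
  have cF : cvgn (fun N => (F N r)%:E).
    by apply: ereal_nondecreasing_is_cvgn => i j ij; rewrite lee_fin F_nd.
  have FE : (\sum_(0 <= i <oo) (ck * shell (2 ^+ i * r))%:E = limn (fun N => (F N r)%:E))%E.
    congr (limn _); apply/funext => N; rewrite sumEFin; congr (_%:E).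
    by apply: eq_bigr => i _; rewrite /h ger0_norm// mulr_ge0 ?exprn_ge0// ltW.
  have : ((K r - e)%:E < limn (fun N => (F N r)%:E))%E.
    by rewrite -FE (lt_le_trans _ (ktrans_le_shells r0))// KE// lte_fin ltrBlDr ltrDl.
  move/(lte_lim _ cF) => H; apply: filterS (H _) => [N|i j ij]; last by rewrite lee_fin F_nd.
  rewrite lee_fin => FN; rewrite ger0_norm ?subr_ge0 ?ge_min ?lexx ?orbT//.
  by rewrite lerBlDr -lerBlDl le_min FN lerBlDr lerDl ltW.
have GKq r : ((G N r) `^ q)%:E @[N --> \oo] --> ((K r `^ q)%:E : \bar R).
  by apply: cvg_EFin; [exact: nearW|apply: cvg_powR (GK r)].
have -> : (\int[nu m]_rho `|ktrans k phi rho| `^ q = \int[nu m]_rho limn_einf (fun N => ((G N rho) `^ q)%:E))%E.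
  transitivity (\int[nu m]_rho (K rho `^ q)%:E)%E.
    apply: ge0_ae_eq_integral => //.
    - apply: (measurableT_comp (measurable_poweR _)); exact: measurableT_comp.
    - exact: mpow.
    - by move=> r _; exact: poweR_ge0.
    - by move=> r _; rewrite lee_fin powR_ge0.
    exists `]-oo, 0]%classic; split => //; first exact: radial_measure_le0.
    move=> r /= /not_implyP[_] H; rewrite in_itv/= leNgt; apply/negP => r0.
    by apply: H; rewrite KE//= ger0_norm.
  by apply: eq_integral => r _; have [->] := cvg_limn_einf_sup (GKq r).
apply: (le_trans (fatou _ _ _ _)) => //.
- by move=> N; exact: mpow.
- by move=> N r _; rewrite lee_fin powR_ge0.
rewrite limn_einf_lim; apply: lime_le; first exact: is_cvg_einfs.
apply: nearW => N; apply: (@le_trans _ _ (\int[nu m]_r ((G N r) `^ q)%:E)%E).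
  by apply: ereal_inf_lbound; exists N => /=.
apply: (@le_trans _ _ (\int[nu m]_r ((F N r) `^ q)%:E)%E).
  apply: ge0_le_integral => //.
  - by move=> r _; rewrite lee_fin powR_ge0.
  - exact: mpow.
  - exact: mpow.
  - by move=> r _; rewrite lee_fin ge0_ler_powR// ?nnegrE ?F0 ?G0 ?ge_min ?lexx// ltW.
rewrite -[leLHS]poweR_Lnorm_ge0//.
have -> : (\int[nu m]_rho (shell `|rho| `^ q)%:E = 'N[nu m]_q%:E[EFin \o h] `^ q)%E by rewrite poweR_Lnorm_ge0.
have c0 : (0 <= (ck / (1 - x))%:E)%E by rewrite lee_fin divr_ge0// subr_ge0 ltW.
rewrite -poweR_EFin -poweRM// ?Lnorm_ge0//.
apply: gt0_ler_poweR; [exact: ltW| | |exact: NF]; rewrite in_itv/= leey andbT ?Lnorm_ge0//.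
by rewrite mule_ge0// Lnorm_ge0.
Qed.

End hardy.

(** * Exponents, scaling and the bound by the weak norm *)

Section exponents.
Context {R : realType}.
Local Notation nu := (@radial_measure R).

Lemma ae_radial_gt0 n : (0 < n)%N -> {ae nu n, forall r, 0 < r}.
Proof.
move=> n0; exists `]-oo, 0]%classic; split => //; first exact: radial_measure_le0.
by move=> r /=; rewrite in_itv/= leNgt => /negP.
Qed.

Lemma measurable_powR_fun d (T : measurableType d) (f : T -> R) (p : R) :
  measurable_fun setT f -> measurable_fun setT (fun x => f x `^ p).
Proof.
by move=> mf; apply: (@measurableT_comp _ _ _ _ _ _ (fun x => x `^ p)) mf; exact: measurable_powR.
Qed.

(* k + m is the dimension of the ambient space and p^-1 = (m + k q) / ((k + m) q) *)
Variables (k m : nat) (q : R).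
Hypotheses (k0 : (0 < k)%N) (m0 : (0 < m)%N) (q1 : 1 < q).

Definition pexp : R := (k + m)%:R * q / (m%:R + k%:R * q).
(** With n = k + m this is n / p; it also equals k + m / q, which is why it exceeds k. *)
Definition aexp : R := (m%:R + k%:R * q) / q.
Local Notation p := pexp.
Local Notation a := aexp.

Lemma qgt0 : 0 < q. Proof. exact: lt_trans q1. Qed.

Let k0R : 0 < k%:R :> R. Proof. by rewrite ltr0n. Qed.
Let m0R : 0 < m%:R :> R. Proof. by rewrite ltr0n. Qed.
Let den0 : 0 < m%:R + k%:R * q. Proof. by rewrite addr_gt0// mulr_gt0// qgt0. Qed.

Lemma pexp_gt1 : 1 < p.
Proof. by rewrite /pexp ltr_pdivlMr// mul1r natrD mulrDl addrC ltrD2l ltr_pMr. Qed.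

Lemma pexp_gt0 : 0 < p. Proof. exact: lt_trans pexp_gt1. Qed.

Lemma pexp_ltq : p < q.
Proof.
by rewrite /pexp ltr_pdivrMr// mulrC ltr_pM2l ?qgt0// natrD addrC ltrD2l ltr_pMr.
Qed.

Lemma aexpE : a = m%:R / q + k%:R.
Proof. by rewrite /aexp; field; rewrite gt_eqF// qgt0. Qed.

Lemma aexpMp : a * p = (k + m)%:R.
Proof. by rewrite /aexp /pexp; field; rewrite !gt_eqF// qgt0. Qed.

Lemma aexp_gtk : k%:R < a.
Proof. by rewrite aexpE ltrDr divr_gt0// qgt0. Qed.

Lemma aexp_gt0 : 0 < a. Proof. exact: lt_trans aexp_gtk. Qed.

Definition Np (phi : R -> R) : \bar R := (\int[nu (k + m)]_r (phi r `^ p)%:E)%E.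
Definition Mq (phi : R -> R) : \bar R := (\int[nu m]_rho `|ktrans k phi rho| `^ q)%E.

Lemma Np_ge0 phi : (0 <= Np phi)%E.
Proof. by apply: integral_ge0 => r _; rewrite lee_fin powR_ge0. Qed.

Lemma Mq_ge0 phi : (0 <= Mq phi)%E.
Proof. by apply: integral_ge0 => r _; exact: poweR_ge0. Qed.

(** In a k-plane at distance [rho], the points within [rho] of the foot have norm at most 2 rho, so
    phi is at least phi (2 rho) on a ball of volume rho^k |B|. Replacing 2 rho by rho costs 2^m in
    the measure and 2^k in the weight. *)
Lemma radial_tail_mass phi : profile phi ->
  (\int[nu m]_rho (`|rho| ^+ k * phi `|rho| `^ p)%:E <= (2 ^+ (k + m) / ballvol k)%:E * Np phi)%E.
Proof.
move=> pphi; have [phi0 phiN phinin] := pphi.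
have mphi := measurable_profile pphi.
have mg : measurable_fun setT (fun rho : R => `|rho| ^+ k * phi `|rho| `^ p).
  apply: measurable_funM; first exact: measurable_funX.
  by apply: measurable_powR_fun; exact: (measurableT_comp mphi).
have g0 (rho : R) : 0 <= `|rho| ^+ k * phi `|rho| `^ p.
  by rewrite mulr_ge0 ?exprn_ge0 ?powR_ge0.
have mpp : measurable_fun setT (fun r => (phi r `^ p)%:E).
  by apply/measurable_EFinP; exact: measurable_powR_fun.
rewrite -(@ge0_integral_radial_scale _ m 2 (fun rho => (`|rho| ^+ k * phi `|rho| `^ p)%:E))//; last first.
  by apply/measurable_EFinP.
rewrite /Np (@ge0_integral_radialD _ k m (fun r => (phi r `^ p)%:E))//; last first.
  by move=> r; rewrite lee_fin powR_ge0.
have mi : measurable_fun setT (fun rho : R => \int[nu k]_r (phi (Num.sqrt (r ^+ 2 + rho ^+ 2)) `^ p)%:E)%E.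
  apply: (measurable_fun_fubini_tonelli_G (fun z : R * R => (phi (Num.sqrt (z.1 ^+ 2 + z.2 ^+ 2)) `^ p)%:E)).
    by apply: (measurableT_comp mpp); exact: measurable_hypot2.
  by move=> z; rewrite lee_fin powR_ge0.
have i0 (rho : R) : (0 <= \int[nu k]_r (phi (Num.sqrt (r ^+ 2 + rho ^+ 2)) `^ p)%:E)%E.
  by apply: integral_ge0 => r _; rewrite lee_fin powR_ge0.
have mg2 : measurable_fun setT (fun rho : R => `|2 * rho| ^+ k * phi `|2 * rho| `^ p).
  by apply: (measurableT_comp mg); exact: measurable_funM.
have w0 := @ballvol_gt0 R k.
rewrite -ge0_integralZl_EFin//; last 2 first.
- by move=> r _; rewrite lee_fin.
- by apply/measurable_EFinP.
rewrite -ge0_integralZl_EFin//; last by rewrite divr_ge0 ?exprn_ge0 ?ltW.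
apply: ae_ge0_le_integral => //.
- by move=> r _; rewrite mule_ge0 ?lee_fin ?exprn_ge0.
- by apply: emeasurable_funM => //; apply/measurable_EFinP.
- by move=> r _; rewrite mule_ge0 ?lee_fin ?divr_ge0 ?exprn_ge0// ltW.
- by apply: emeasurable_funM.
apply: filterS (ae_radial_gt0 m0) => rho rho0 _.
apply: (@le_trans _ _ ((2 ^+ (k + m) / ballvol k)%:E * \int[nu k]_r ((phi (2 * rho) `^ p)%:E * (\1_(`]-oo, rho[%classic) r)%:E))%E).
  rewrite ge0_integralZl_EFin//; last 2 first.
  - by apply/measurable_EFinP.
  - by rewrite powR_ge0.
  rewrite integral_radial_ball// -!EFinM lee_fin gtr0_norm ?mulr_gt0//.
  rewrite exprMn exprD le_eqVlt; apply/orP; left; apply/eqP; field; rewrite gt_eqF//.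
apply: lee_wpmul2l; first by rewrite lee_fin divr_ge0 ?exprn_ge0// ltW.
apply: ae_ge0_le_integral => //.
- by move=> r _; rewrite -EFinM lee_fin mulr_ge0// powR_ge0.
- by apply/measurable_EFinP; apply: measurable_funM.
- by move=> r _; rewrite lee_fin powR_ge0.
- by apply: (measurableT_comp mpp); exact: measurable_hypot.
apply: filterS (ae_radial_gt0 k0) => r r0 _; rewrite -EFinM lee_fin indicE.
have [|rr] := boolP (r \in _); last by rewrite mulr0 powR_ge0.
rewrite inE/= in_itv/= mulr1 => rr.
apply: ge0_ler_powR; rewrite ?nnegrE//; first exact: ltW pexp_gt0.
apply: phinin; first by rewrite sqrtr_gt0 addr_gt0// exprn_gt0.
rewrite -[leRHS]gtr0_norm ?mulr_gt0// -sqrtr_sqr ler_wsqrtr//.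
by rewrite exprMn; nra.
Qed.

(** The constant of [hardy_ktrans] times that of [radial_tail_mass]. *)
Definition strong_cst : R := ((2 ^+ k * ballvol k) / (1 - 2 `^ (- (m%:R / q)))) `^ q * (2 ^+ (k + m) / ballvol k).

Lemma strong_cst_gt0 : 0 < strong_cst.
Proof.
have w0 := @ballvol_gt0 R k.
rewrite mulr_gt0 ?divr_gt0 ?exprn_gt0// powR_gt0// divr_gt0 ?mulr_gt0 ?exprn_gt0//.
by rewrite subr_gt0 powR_lt1// oppr_lt0 divr_gt0 ?qgt0.
Qed.

Lemma ktrans_lty phi B rho : profile phi -> 0 <= B -> (forall r, 0 < r -> phi r <= B * r `^ (- a)) ->
  0 < rho -> (ktrans k phi rho < +oo)%E.
Proof.
move=> pphi B0 phiB rho0; apply: (le_lt_trans (ktrans_weak pphi aexp_gtk B0 phiB rho0)).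
exact: ltry.
Qed.

(* The gain over L^p boundedness: for q > p the weak norm B enters with a positive power. *)
Lemma strong_bound phi B : profile phi -> 0 <= B -> (forall r, 0 < r -> phi r <= B * r `^ (- a)) ->
  (Mq phi <= (strong_cst * B `^ (q - p))%:E * Np phi)%E.
Proof.
move=> pphi B0 phiB; have [phi0 phiN phinin] := pphi.
have mphi := measurable_profile pphi.
have H := @hardy_ktrans _ k phi pphi m q (ltW q1) m0 (fun rho => ktrans_lty pphi B0 phiB).
apply: (le_trans H); rewrite /strong_cst.
set c1 := (2 ^+ k * ballvol k / (1 - 2 `^ (- (m%:R / q)))) `^ q; set c2 := 2 ^+ (k + m) / ballvol k.
rewrite (EFinM (c1 * c2)) (EFinM c1) -!muleA; apply: lee_wpmul2l; first by rewrite lee_fin powR_ge0.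
rewrite muleCA.
apply: (@le_trans _ _ ((B `^ (q - p))%:E * \int[nu m]_rho (`|rho| ^+ k * phi `|rho| `^ p)%:E)%E); last first.
  by apply: lee_wpmul2l; rewrite ?lee_fin ?powR_ge0// radial_tail_mass.
have mg : measurable_fun setT (fun rho : R => `|rho| ^+ k * phi `|rho| `^ p).
  apply: measurable_funM; first exact: measurable_funX.
  by apply: measurable_powR_fun; exact: (measurableT_comp mphi).
have g0 (rho : R) : 0 <= `|rho| ^+ k * phi `|rho| `^ p.
  by rewrite mulr_ge0 ?exprn_ge0 ?powR_ge0.
rewrite -ge0_integralZl_EFin//; last 3 first.
- by move=> r _; rewrite lee_fin.
- by apply/measurable_EFinP.
- by rewrite powR_ge0.
apply: ge0_le_integral => //.
- by move=> r _; rewrite lee_fin powR_ge0.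
- apply/measurable_EFinP; apply: measurable_powR_fun.
  by apply: measurable_funM; [exact: measurable_funX|exact: (measurableT_comp mphi)].
- by apply: emeasurable_funM => //; apply/measurable_EFinP.
move=> rho _; rewrite -EFinM lee_fin /shell.
set r := `|rho|; have := normr_ge0 rho; rewrite -/r le_eqVlt => /predU1P[<-|r0].
  have p00 : phi 0 = 0 by exact: phiN.
  have qn0 : q != 0 by rewrite gt_eqF// qgt0.
  have pn0 : p != 0 by rewrite gt_eqF// pexp_gt0.
  by rewrite p00 mulr0 (powR0 qn0) (powR0 pn0) !mulr0.
(* Exponents balance: a p = k + m and a q = m + k q give k q - a (q - p) = k. *)
have rkE : r ^+ k = (r ^+ k) `^ q * r `^ (- (a * (q - p))).
  rewrite -powR_mulrn ?(ltW r0)// -powRrM -powRD ?(gt_eqF r0) ?implybT//; congr (_ `^ _).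
  by rewrite mulrBr aexpMp natrD aexpE; field; rewrite gt_eqF// qgt0.
rewrite [in leRHS]rkE powRM ?exprn_ge0 ?(ltW r0)//.
have -> : phi r `^ q = phi r `^ (q - p) * phi r `^ p.
  by rewrite -powRD ?subrK// gt_eqF ?qgt0.
rewrite [leRHS](_ : _ = (r ^+ k) `^ q * ((B `^ (q - p) * r `^ (- (a * (q - p)))) * phi r `^ p)); last by ring.
rewrite ler_wpM2l ?powR_ge0// ler_wpM2r ?powR_ge0//.
have -> : r `^ (- (a * (q - p))) = (r `^ (- a)) `^ (q - p) by rewrite -powRrM (mulNr a).
rewrite -powRM ?powR_ge0//.
apply: ge0_ler_powR; rewrite ?nnegrE ?mulr_ge0 ?powR_ge0//; first by rewrite subr_ge0 ltW// pexp_ltq.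
exact: phiB.
Qed.

Lemma profile_chebyshev phi r : profile phi -> 0 < r ->
  ((phi r `^ p * (r ^+ (k + m) * ballvol (k + m)))%:E <= Np phi)%E.
Proof.
move=> pphi r0; have [phi0 phiN phinin] := pphi.
have mphi := measurable_profile pphi.
have km0 : (0 < k + m)%N by rewrite addn_gt0 k0.
rewrite EFinM -integral_radial_ball// -ge0_integralZl_EFin//; last 2 first.
- by apply/measurable_EFinP.
- by rewrite powR_ge0.
apply: ae_ge0_le_integral => //.
- by move=> s _; rewrite -EFinM lee_fin mulr_ge0// powR_ge0.
- by apply: emeasurable_funM => //; apply/measurable_EFinP.
- by move=> s _; rewrite lee_fin powR_ge0.
- by apply/measurable_EFinP; exact: measurable_powR_fun.
apply: filterS (ae_radial_gt0 km0) => s s0 _; rewrite -EFinM lee_fin indicE.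
have [|rr] := boolP (s \in _); last by rewrite mulr0 powR_ge0.
rewrite inE/= in_itv/= mulr1 => rr.
apply: ge0_ler_powR; rewrite ?nnegrE//; first exact: ltW pexp_gt0.
by apply: phinin => //; exact: ltW.
Qed.

(** What Chebyshev on a ball yields for the weak norm when [Np] is at most 1. *)
Definition weak_cst : R := (ballvol (k + m))^-1 `^ p^-1.

Lemma weak_cst_ge0 : 0 <= weak_cst. Proof. exact: powR_ge0. Qed.

Lemma profile_weak phi r : profile phi -> (Np phi <= 1)%E -> 0 < r -> phi r <= weak_cst * r `^ (- a).
Proof.
move=> pphi N1 r0; have [phi0 _ _] := pphi.
have w0 := @ballvol_gt0 R (k + m).
have := le_trans (profile_chebyshev pphi r0) N1; rewrite lee_fin => H.
have rn : 0 < r ^+ (k + m) * ballvol (k + m) by rewrite mulr_gt0// exprn_gt0.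
rewrite -ler_pdivlMr// div1r in H.
have p0 := pexp_gt0.
have -> : phi r = (phi r `^ p) `^ p^-1 by rewrite -powRrM mulfV ?gt_eqF// powRr1.
have -> : weak_cst * r `^ (- a) = ((r ^+ (k + m) * ballvol (k + m))^-1) `^ p^-1.
  rewrite invfM mulrC powRM ?invr_ge0 ?exprn_ge0 ?(ltW r0) ?(ltW w0)//; congr (_ * _).
  rewrite -powR_mulrn ?(ltW r0)// -powRN -powRrM -aexpMp; congr (_ `^ _).
  by field; rewrite gt_eqF.
by apply: ge0_ler_powR; rewrite ?nnegrE ?powR_ge0 ?invr_ge0 ?(ltW p0) ?(ltW rn).
Qed.

(** The dilation normalized in L^p. It preserves both [Np] and [Mq], so it is the symmetry along
    which a maximizing sequence can escape. *)
Definition scale (s : R) (phi : R -> R) : R -> R := fun r => s `^ (- a) * phi (s^-1 * r).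

Lemma profile_scale s phi : 0 < s -> profile phi -> profile (scale s phi).
Proof.
move=> s0 [phi0 phiN phinin]; split => [r|r r0|r t r0 rt].
- by rewrite mulr_ge0// powR_ge0.
- by rewrite /scale phiN ?mulr0// pmulr_rle0// invr_gt0.
- rewrite ler_wpM2l ?powR_ge0// phinin//; first by rewrite mulr_gt0// invr_gt0.
  by rewrite ler_pM2l// invr_gt0.
Qed.

Lemma Np_scale s phi : 0 < s -> profile phi -> Np (scale s phi) = Np phi.
Proof.
move=> s0 pphi; have [phi0 _ _] := pphi; have mphi := measurable_profile pphi.
have mpp : measurable_fun setT (fun r => (phi r `^ p)%:E).
  by apply/measurable_EFinP; exact: measurable_powR_fun.
have sV : 0 < s^-1 by rewrite invr_gt0.
have sc : measurable_fun setT (fun r : R => s^-1 * r) by exact: measurable_funM.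
rewrite /Np -(@ge0_integral_radial_scale _ (k + m) s^-1 (fun r => (phi r `^ p)%:E))//; last first.
  by move=> r; rewrite lee_fin powR_ge0.
rewrite -ge0_integralZl_EFin//; last 3 first.
- by move=> r _; rewrite lee_fin powR_ge0.
- exact: (measurableT_comp mpp sc).
- by rewrite exprn_ge0// ltW.
apply: eq_integral => r _; rewrite -EFinM; congr (_%:E).
rewrite /scale powRM ?powR_ge0// -powRrM mulNr aexpMp; congr (_ * _).
by rewrite powRN powR_mulrn ?(ltW s0)// exprVn.
Qed.

Lemma ktrans_scale s phi rho : 0 < s -> profile phi ->
  ktrans k (scale s phi) rho = ((s `^ (k%:R - a))%:E * ktrans k phi (s^-1 * rho))%E.
Proof.
move=> s0 pphi; have [phi0 _ _] := pphi; have mphi := measurable_profile pphi.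
have sV : 0 < s^-1 by rewrite invr_gt0.
have mh : measurable_fun setT (fun r : R => (phi (Num.sqrt (r ^+ 2 + (s^-1 * rho) ^+ 2)))%:E).
  by apply/measurable_EFinP; apply: (measurableT_comp mphi); exact: measurable_hypot.
rewrite /ktrans -(@ge0_integral_radial_scale _ k s^-1 (fun r : R => (phi (Num.sqrt (r ^+ 2 + (s^-1 * rho) ^+ 2)))%:E))//; last first.
  by move=> r; rewrite lee_fin.
rewrite muleA -EFinM -ge0_integralZl_EFin//; last 3 first.
- by move=> r _; rewrite lee_fin.
- apply: (measurableT_comp mh); exact: measurable_funM.
- by rewrite mulr_ge0 ?powR_ge0// exprn_ge0// ltW.
apply: eq_integral => r _; rewrite -EFinM; congr (_%:E).
rewrite /scale powRD ?(gt_eqF s0) ?implybT// powR_mulrn ?(ltW s0)// exprVn.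
rewrite [s ^+ k * _]mulrC mulfK ?gt_eqF ?exprn_gt0//; congr (_ * phi _).
rewrite !exprMn -mulrDr sqrtrM ?sqr_ge0// sqrtr_sqr gtr0_norm//.
Qed.

Lemma Mq_scale s phi : 0 < s -> profile phi -> Mq (scale s phi) = Mq phi.
Proof.
move=> s0 pphi; have [phi0 _ _] := pphi; have mphi := measurable_profile pphi.
have sV : 0 < s^-1 by rewrite invr_gt0.
have mK : measurable_fun setT (fun rho => `|ktrans k phi rho| `^ q)%E.
  apply: (measurableT_comp (measurable_poweR _)); apply: measurableT_comp => //.
  exact: measurable_ktrans.
rewrite /Mq -(@ge0_integral_radial_scale _ m s^-1 (fun rho => `|ktrans k phi rho| `^ q)%E)//; last first.
  by move=> rho; exact: poweR_ge0.
rewrite -ge0_integralZl_EFin//; last 3 first.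
- by move=> r _; exact: poweR_ge0.
- apply: (measurableT_comp mK); exact: measurable_funM.
- by rewrite exprn_ge0// ltW.
apply: eq_integral => rho _; rewrite ktrans_scale// abseM poweRM ?abse_ge0//; congr (_ * _)%E.
rewrite gee0_abs ?lee_fin ?powR_ge0// poweR_EFin -powRrM; congr (_%:E).
rewrite (_ : _ * q = - m%:R); first by rewrite powRN powR_mulrn ?(ltW s0)// exprVn.
by rewrite aexpE; field; rewrite gt_eqF// qgt0.
Qed.

Lemma profileZ (c : R) (phi : R -> R) : 0 <= c -> profile phi -> profile (fun r => c * phi r).
Proof.
move=> c0 [phi0 phiN phinin]; split => [r|r r0|r t r0 rt].
- by rewrite mulr_ge0.
- by rewrite phiN ?mulr0.
- by rewrite ler_wpM2l// phinin.
Qed.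

Lemma NpZ c phi : 0 <= c -> profile phi -> Np (fun r => c * phi r) = ((c `^ p)%:E * Np phi)%E.
Proof.
move=> c0 pphi; have [phi0 _ _] := pphi; have mphi := measurable_profile pphi.
rewrite /Np -ge0_integralZl_EFin//; last 3 first.
- by move=> r _; rewrite lee_fin powR_ge0.
- by apply/measurable_EFinP; exact: measurable_powR_fun.
- exact: powR_ge0.
by apply: eq_integral => r _; rewrite powRM.
Qed.

Lemma MqZ c phi : 0 <= c -> profile phi -> Mq (fun r => c * phi r) = ((c `^ q)%:E * Mq phi)%E.
Proof.
move=> c0 pphi; have [phi0 _ _] := pphi; have mphi := measurable_profile pphi.
rewrite /Mq -ge0_integralZl_EFin//; last 3 first.
- by move=> r _; exact: poweR_ge0.
- apply: (measurableT_comp (measurable_poweR _)); apply: measurableT_comp => //.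
  exact: measurable_ktrans.
- exact: powR_ge0.
apply: eq_integral => rho _.
rewrite (_ : ktrans k (fun r => c * phi r) rho = (c%:E * ktrans k phi rho)%E).
  by rewrite abseM poweRM ?abse_ge0// gee0_abs.
rewrite /ktrans -ge0_integralZl_EFin//.
- by move=> r _; rewrite lee_fin.
- by apply/measurable_EFinP; apply: (measurableT_comp mphi); exact: measurable_hypot.
Qed.

End exponents.

(** * Compactness of maximizing sequences of profiles *)

Section helly.
Context {R : realType}.

Lemma ultra_bounded_cvg (U : set_system nat) (u : nat -> R) (D : R) : UltraFilter U ->
  (forall j, 0 <= u j <= D) -> exists l : R, u j @[j --> U] --> l.
Proof.
move=> UU uD; have PU := @ultra_proper _ _ UU.
have UuD : (u j @[j --> U]) `[0, D]%classic.
  by apply: (@filterE _ U) => j; rewrite /= in_itv/= uD.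
have [l [_ ul]] := @segment_compact R 0 D _ (fmap_proper_filter u PU) UuD.
exists l => V lV.
have [//|UV] := in_ultra_setVsetC (u @^-1` V) UU.
have [x [/= + Vx]] := ul (~` V) V UV lV.
by [].
Qed.

(** A member of an ultrafilter finer than [\oo] has elements beyond any bound, so an element of each
    [E i] can be chosen strictly larger than the one before. *)
Lemma ultra_subsequence (U : set_system nat) (E : nat -> set nat) : UltraFilter U -> \oo `<=` U ->
  (forall i, U (E i)) -> exists h : nat -> nat, {homo h : i j / (i < j)%N} /\ forall i, E i (h i).
Proof.
move=> UU oU EU; have PU := @ultra_proper _ _ UU.
have /choice[F FP] : forall i : nat * nat, exists j, (i.2 < j)%N /\ E i.1 j.
  move=> [i M].
  have : U (E i `&` [set j | (M < j)%N]).
    by apply: filterI => //; apply: oU; exists M.+1.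
  by move/filter_ex => [j [Ej Mj]]; exists j.
pose h := fix h i := if i is i'.+1 then F (i, h i') else F (0, 0).
exists h; split; last by case=> [|i]; [exact: (FP (0, 0)%N).2|exact: (FP (i.+1, h i)).2].
by apply: homo_ltn => [|i]; [exact: ltn_trans|exact: (FP (i.+1, h i)).1].
Qed.

(** An ultrafilter gives limits at all radii at once and so produces the limit profile without a
    diagonal argument. A true subsequence is then extracted for rational radii only; at a radius
    that is not a jump, two nearby rationals squeeze the values. *)
Lemma helly_profile (psi : nat -> R -> R) (D : R -> R) : (forall j, profile (psi j)) ->
  (forall j (r : R), 0 < r -> psi j r <= D r) ->
  exists (h : nat -> nat) (f : R -> R), [/\ {homo h : i j / (i < j)%N}, profile f &
    forall r : R, 0 < r -> ~ jumps f r -> psi (h j) r @[j --> \oo] --> f r].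
Proof.
move=> ppsi psiD.
have [U [UU oU]] := @ultraFilterLemma nat \oo _.
have PU := @ultra_proper _ _ UU.
have [f0 f0P] : {f0 : R -> R & forall r : R, 0 < r -> psi j r @[j --> U] --> f0 r}.
  apply: (@choice _ _ (fun r l => 0 < r -> psi j r @[j --> U] --> l)).
  move=> r; have [r0|r0] := ltP 0 r; last by exists 0.
  have [|l ul] := @ultra_bounded_cvg U (psi ^~ r) (D r) UU; last by exists l.
  by move=> j; rewrite psiD// andbT; have [] := ppsi j.
pose f (r : R) := if 0 < r then f0 r else 0.
have fU (r : R) : 0 < r -> psi j r @[j --> U] --> f r by move=> r0; rewrite /f r0; exact: f0P.
have pf : profile f.
  split => [r|r r0|r s r0 rs].
  - rewrite /f; case: ifP => // r0.
    have := f0P r r0; apply: (@closed_cvg _ _ U PU (fun j => psi j r) (>= 0)%R) => //.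
    by apply: nearW => j; have [] := ppsi j.
  - by rewrite /f ltNge r0.
  - apply: (@ler_cvg_to _ U PU _ (psi ^~ s) (psi ^~ r) (f s) (f r)); [exact: fU (lt_le_trans r0 rs)|exact: fU|].
    by apply: nearW => j; have [_ _] := ppsi j; apply.
(* Enumerates the rationals; codes of no rational are sent to the harmless radius 1. *)
pose rt i : R := if unpickle i is Some x then ratr (x : rat) else 1.
(* The indices that are accurate to 1/(N+1) at the positive radii among the first N+1 enumerated. *)
pose E N := [set j | forall i, (i <= N)%N -> 0 < rt i -> `|psi j (rt i) - f (rt i)| < N.+1%:R^-1].
have EU N : U (E N).
  have H i : U [set j | 0 < rt i -> `|psi j (rt i) - f (rt i)| < N.+1%:R^-1].
    have [r0|r0] := ltP 0 (rt i); last by apply: filterE => j /=.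
    have := fU _ r0; move/cvgrPdist_lt => /(_ N.+1%:R^-1); rewrite invr_gt0 ltr0n => /(_ isT).
    by apply: filterS => j /=; rewrite distrC.
  rewrite /E; set e := N.+1%:R^-1 in H *; elim: (N) => [|M IH].
    by apply: filterS (H 0) => j Hj i; rewrite leqn0 => /eqP->.
  apply: filterS2 IH (H M.+1) => j Hj HjM i.
  by rewrite leq_eqVlt => /predU1P[->//|]; exact: Hj.
have [h [hh hE]] := ultra_subsequence UU oU EU.
exists h, f; split => // r r0 nJ.
have rcvg (x : rat) : 0 < ratr x :> R -> forall e, 0 < e ->
    \forall j \near \oo, `|psi (h j) (ratr x) - f (ratr x)| < e.
  move=> x0 e e0; have [N N1] : exists N, N.+1%:R^-1 < e.
    by exists (Num.truncn e^-1); rewrite invf_plt ?posrE// truncnS_gt.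
  exists (maxn N (pickle x)) => // j /=; rewrite geq_max => /andP[Nj xj].
  have := hE j (pickle x) xj; rewrite /rt pickleK => /(_ x0) /lt_trans; apply.
  by apply: le_lt_trans N1; rewrite lef_pV2 ?posrE// ler_nat.
apply/cvgrPdist_lt => e e0.
have e20 : 0 < e / 2 by rewrite divr_gt0.
have [s [t [s0 sr rt' st]]] := not_jump nJ r0 e20.
have [u] : exists u : rat, (ratr u : R) \in `]s, r[ by apply: rat_in_itvoo.
rewrite in_itv/= => /andP[su ur].
have [v] : exists u : rat, (ratr u : R) \in `]r, t[ by apply: rat_in_itvoo.
rewrite in_itv/= => /andP[rv vt].
have u0 : 0 < ratr u :> R by exact: lt_trans su.
have v0 : 0 < ratr v :> R by exact: lt_trans rv.
move: (rcvg u u0 _ e20) (rcvg v v0 _ e20); apply: filterS2 => j.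
have [_ _ fnin] := pf; have [_ _ pnin] := ppsi (h j).
have := fnin _ _ s0 (ltW su); have := fnin _ _ u0 (ltW ur).
have := fnin _ _ r0 (ltW rv); have := fnin _ _ v0 (ltW vt).
have := pnin _ _ u0 (ltW ur); have := pnin _ _ r0 (ltW rv).
by rewrite !ltr_norml => *; lra.
Qed.

End helly.

(** * Cutting a profile between two levels *)

Section clamp.
Context {R : realType}.
Variables (al be : R).
Hypotheses (al0 : 0 < al) (albe : al < be).
Local Notation nu := (@radial_measure R).

(** The height of [t] inside the band from [al] to [be]; [out] is the height below the band plus
    that above it. Both are nondecreasing in [t], so both pieces of a profile are profiles. *)
Definition mid (t : R) := Num.min (Num.max t al) be - al.
Definition out (t : R) := Num.min t al + Num.max (t - be) 0.

Lemma midDout t : mid t + out t = t.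
Proof.
rewrite /mid /out; have [tal|tal] := leP t al.
  by rewrite (min_l (ltW albe)) subrr add0r max_r ?addr0// subr_le0 (le_trans tal)// ltW.
have [tbe|tbe] := leP t be; first by rewrite max_r ?subr_le0// addr0 subrK.
by rewrite max_l ?subr_ge0 ?ltW//; lra.
Qed.

Lemma mid_ge0 t : 0 <= mid t.
Proof. by rewrite subr_ge0 le_min le_max lexx orbT ltW. Qed.

Lemma mid_le_be t : mid t <= be.
Proof. by rewrite lerBlDr ge_min lerDl (ltW al0) orbT. Qed.

Lemma mid_eq0 t : t <= al -> mid t = 0.
Proof. by move=> tal; rewrite /mid max_r// min_l ?subrr// ltW. Qed.

Lemma mid_le s t : s <= t -> mid s <= mid t.
Proof.
move=> st; rewrite lerD2r le_min !ge_min lexx orbT andbT; apply/orP; left.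
by rewrite ge_max !le_max st lexx orbT.
Qed.

Lemma out_ge0 t : 0 <= t -> 0 <= out t.
Proof. by move=> t0; rewrite addr_ge0// ?le_min ?t0 ?(ltW al0)// le_max lexx orbT. Qed.

Lemma out_le s t : s <= t -> out s <= out t.
Proof.
move=> st; apply: lerD; first by rewrite le_min !ge_min st lexx !orbT.
by rewrite ge_max !le_max lerD2r st lexx !orbT.
Qed.

Lemma mid_le_id t : 0 <= t -> mid t <= t.
Proof. by move=> t0; rewrite -[leRHS]midDout lerDl out_ge0. Qed.

Lemma out_le_id t : out t <= t.
Proof. by rewrite -[leRHS]midDout lerDr mid_ge0. Qed.

(** [mid] and [out] are nondecreasing and add up to the identity, so neither can grow faster than
    it. *)
Lemma mid_dist s t : `|mid s - mid t| <= `|s - t|.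
Proof.
wlog st : s t / s <= t.
  by move=> H; have [/H//|/ltW/H] := leP s t; rewrite distrC [leRHS]distrC.
have := mid_le st; have := out_le st; have := midDout s; have := midDout t.
by move=> ? ? ? ?; rewrite ler0_norm ?subr_le0// ler0_norm ?subr_le0//; lra.
Qed.

Lemma mid_continuous T (F : set_system T) {FF : Filter F} (u : T -> R) (l : R) :
  u t @[t --> F] --> l -> mid (u t) @[t --> F] --> mid l.
Proof.
move=> /cvgrPdist_lt ul; apply/cvgrPdist_lt => e /ul; apply: filterS => t.
exact: le_lt_trans (mid_dist _ _).
Qed.

Lemma profile_mid phi : profile phi -> profile (mid \o phi).
Proof.
move=> [phi0 phiN phinin]; split => [r|r r0|r s r0 rs] /=.
- exact: mid_ge0.
- by rewrite phiN// mid_eq0// ltW.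
- by rewrite mid_le// phinin.
Qed.

Lemma profile_out phi : profile phi -> profile (out \o phi).
Proof.
move=> [phi0 phiN phinin]; split => [r|r r0|r s r0 rs] /=.
- exact: out_ge0.
- by apply/eqP; rewrite eq_le out_ge0 ?phi0// phiN// out_le_id.
- by rewrite out_le// phinin.
Qed.

End clamp.

(** * Power inequalities behind the splitting of mass *)

Section powR_convexity.
Context {R : realType}.

(** With s = x + y, the fractions x/s and y/s are at most 1, so their p-th powers are at most
    themselves, and they add up to 1. *)
Lemma powR_superadditive (x y p : R) : 1 <= p -> 0 <= x -> 0 <= y -> x `^ p + y `^ p <= (x + y) `^ p.
Proof.
move=> p1 x0 y0; have p0 : 0 < p by apply: lt_le_trans p1.
have pn0 : p != 0 by rewrite gt_eqF.
move: x0; rewrite le_eqVlt => /predU1P[<-|x0]; first by rewrite powR0// !add0r.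
move: y0; rewrite le_eqVlt => /predU1P[<-|y0]; first by rewrite powR0// !addr0.
have s0 : 0 < x + y by rewrite addr_gt0.
have H z : 0 < z -> z <= x + y -> z `^ p <= (x + y) `^ p * (z / (x + y)).
  move=> z0 zs; have zE : z = (x + y) * (z / (x + y)) by field; rewrite gt_eqF.
  rewrite [in leLHS]zE powRM ?(ltW s0)//; last by rewrite divr_ge0// ltW.
  rewrite ler_wpM2l ?powR_ge0// ge1r_powR// divr_gt0//= ler_pdivrMr// mul1r//.
rewrite (le_trans (lerD (H x x0 _) (H y y0 _))) ?lerDl ?lerDr ?(ltW x0) ?(ltW y0)//.
by rewrite -mulrDr -mulrDl divff ?mulr1// gt_eqF.
Qed.

(** Used with s = q/p: strictness is what forbids a limit carrying only part of the mass. *)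
Lemma powR_split_lt1 (x s : R) : 1 < s -> 0 < x -> x < 1 -> x `^ s + (1 - x) `^ s < 1.
Proof.
move=> s1 x0 x1; have s0 : 0 < s - 1 by rewrite subr_gt0.
have xs : x `^ s < x.
  have -> : x `^ s = x * x `^ (s - 1) by rewrite mulr_powRB1 ?ltW// (lt_trans _ s1).
  rewrite -[ltRHS]mulr1 ltr_pM2l//.
  have := @gt0_ltr_powR R (s - 1) s0 x 1.
  by rewrite !nnegrE powR1; apply => //; exact: ltW.
have xs' : (1 - x) `^ s <= 1 - x.
  by apply: ge1r_powR; [rewrite subr_gt0 x1 gerBl ltW|exact: ltW].
lra.
Qed.

End powR_convexity.

Section dominated.
Context {R : realType}.

Lemma ge0_dominated_cvg d (T : measurableType d) (mu : {measure set T -> \bar R})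
    (u : nat -> T -> R) (g G : T -> R) :
  (forall j, measurable_fun setT (u j)) -> measurable_fun setT g -> measurable_fun setT G ->
  {ae mu, forall x, u j x @[j --> \oo] --> g x} ->
  {ae mu, forall x, forall j, 0 <= u j x <= G x} -> (forall x, 0 <= G x) ->
  (\int[mu]_x (G x)%:E < +oo)%E ->
  (\int[mu]_x (u j x)%:E @[j --> \oo] --> \int[mu]_x (g x)%:E)%E.
Proof.
move=> mu_ mg mG ug uG G0 Goo.
have [] := @dominated_convergence _ _ _ mu setT measurableT (fun j x => (u j x)%:E)
  (fun x => (g x)%:E) (fun x => (G x)%:E) => //.
- by move=> j; exact/measurable_EFinP.
- exact/measurable_EFinP.
- by apply: filterS ug => x Hx _; apply: cvg_EFin => //; exact: nearW.
- apply/integrableP; split; first exact/measurable_EFinP.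
  by under eq_integral do rewrite gee0_abs ?lee_fin//.
- apply: filterS uG => x Hx j _.
  by have /andP[u0 uG'] := Hx j; rewrite gee0_abs ?lee_fin.
Qed.

(** On r > 0 the map sqrt (r^2 + rho^2) is injective, so countably many exceptional norms remain
    countably many distances inside a plane. *)
Lemma countable_hypot_preimage (rho : R) (J : set R) : countable J ->
  countable [set r : R | 0 < r /\ J (Num.sqrt (r ^+ 2 + rho ^+ 2))].
Proof.
move=> /countable_injP[f finj]; apply/countable_injP.
exists (fun r => f (Num.sqrt (r ^+ 2 + rho ^+ 2))) => r s /set_mem[r0 Jr] /set_mem[s0 Js].
move=> /finj; rewrite !inE => /(_ Jr Js) /eqP.
rewrite eqr_sqrt ?addr_ge0 ?sqr_ge0// => /eqP /addIr /eqP.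
by rewrite eqrXn2 ?ltW// => /eqP.
Qed.

End dominated.

(** * Convergence of the transform and of the norms under domination *)

Section truncated_ktrans.
Context {R : realType}.
Local Notation nu := (@radial_measure R).
Variables (k m : nat) (q : R).
Hypotheses (k0 : (0 < k)%N) (m0 : (0 < m)%N) (q1 : 1 < q).
Local Notation p := (pexp k m q).
Local Notation a := (aexp k m q).
Local Notation W := (weak_cst k m q).

Let km0 : (0 < k + m)%N. Proof. by rewrite addn_gt0 k0. Qed.
Let q0 : 0 < q. Proof. exact: qgt0. Qed.

(** The weak bound with the constant valid on the whole unit ball. Smaller profiles inherit it, and
    it makes the transform finite at every rho > 0. *)
Definition weak_profile (phi : R -> R) := profile phi /\ forall r : R, 0 < r -> phi r <= W * r `^ (- a).

Lemma weak_cst_gt0 : 0 < W.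
Proof. by rewrite powR_gt0// invr_gt0 ballvol_gt0. Qed.

Definition rktrans (phi : R -> R) (rho : R) : R := fine (ktrans k phi rho).

Definition Mq_on (D : set R) (phi : R -> R) : \bar R :=
  (\int[nu m]_rho ((rktrans phi rho * \1_D rho) `^ q)%:E)%E.

Lemma rktransE phi rho : weak_profile phi -> 0 < rho -> ktrans k phi rho = (rktrans phi rho)%:E.
Proof.
move=> [pphi phiW] rho0; have [phi0 _ _] := pphi.
rewrite /rktrans fineK// ge0_fin_numE ?ktrans_ge0//.
exact: (ktrans_lty m0 q1 pphi (weak_cst_ge0 k m q) phiW).
Qed.

Lemma rktrans_ge0 phi rho : profile phi -> 0 <= rktrans phi rho.
Proof. by move=> [phi0 _ _]; rewrite fine_ge0// ktrans_ge0. Qed.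

Lemma measurable_rktrans phi : profile phi -> measurable_fun setT (rktrans phi).
Proof.
move=> pphi; have [phi0 _ _] := pphi; apply: measurableT_comp => //.
exact: measurable_ktrans (measurable_profile pphi) phi0.
Qed.

Lemma measurable_rktrans_on D phi : measurable D -> profile phi ->
  measurable_fun setT (fun rho => rktrans phi rho * \1_D rho).
Proof. by move=> mD pphi; apply: measurable_funM => //; exact: measurable_rktrans. Qed.

Let mpow (g : R -> R) : measurable_fun setT g -> measurable_fun setT (fun r : R => ((g r) `^ q)%:E : \bar R).
Proof. by move=> mg; apply/measurable_EFinP; exact: measurable_powR_fun. Qed.

Lemma Mq_onT phi : weak_profile phi -> Mq k m q phi = Mq_on setT phi.
Proof.
move=> wphi; have [pphi _] := wphi; have [phi0 _ _] := pphi.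
apply: ge0_ae_eq_integral => //.
- apply: (measurableT_comp (measurable_poweR _)); apply: measurableT_comp => //.
  exact: measurable_ktrans (measurable_profile pphi) phi0.
- by apply: mpow; exact: measurable_rktrans_on.
- by move=> r _; exact: poweR_ge0.
- by move=> r _; rewrite lee_fin powR_ge0.
apply: filterS (ae_radial_gt0 m0) => rho rho0 _.
by rewrite rktransE// indicT mulr1 gee0_abs ?lee_fin ?rktrans_ge0.
Qed.

Lemma Mq_on_ge0 D phi : (0 <= Mq_on D phi)%E.
Proof. by apply: integral_ge0 => r _; rewrite lee_fin powR_ge0. Qed.

Lemma Mq_onC D phi : measurable D -> profile phi ->
  Mq_on setT phi = (Mq_on D phi + Mq_on (~` D) phi)%E.
Proof.
move=> mD pphi; rewrite /Mq_on -ge0_integralD//; last 4 first.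
- by move=> r _; rewrite lee_fin powR_ge0.
- by apply: mpow; exact: measurable_rktrans_on.
- by move=> r _; rewrite lee_fin powR_ge0.
- by apply: mpow; apply: measurable_rktrans_on => //; exact: measurableC.
apply: eq_integral => rho _; rewrite -EFinD; congr (_%:E).
rewrite !indicE in_setT mulr1 in_setC.
by case: (rho \in D) => /=; rewrite ?mulr1 ?mulr0 powR0 ?gt_eqF ?addr0 ?add0r.
Qed.

Lemma Mq_on_le D phi psi : measurable D -> weak_profile phi -> weak_profile psi ->
  (forall r, phi r <= psi r) -> (Mq_on D phi <= Mq_on D psi)%E.
Proof.
move=> mD wphi wpsi le; have [pphi _] := wphi; have [ppsi _] := wpsi.
have [phi0 _ _] := pphi; have [psi0 _ _] := ppsi.
apply: ae_ge0_le_integral => //.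
- by move=> r _; rewrite lee_fin powR_ge0.
- by apply: mpow; exact: measurable_rktrans_on.
- by move=> r _; rewrite lee_fin powR_ge0.
- by apply: mpow; exact: measurable_rktrans_on.
apply: filterS (ae_radial_gt0 m0) => rho rho0 _; rewrite lee_fin.
apply: ge0_ler_powR; rewrite ?nnegrE ?mulr_ge0 ?rktrans_ge0 ?(ltW q0)//.
rewrite ler_wpM2r// -lee_fin -!rktransE//.
apply: ge0_le_integral => //.
- by move=> r _; rewrite lee_fin.
- by apply/measurable_EFinP; apply: (measurableT_comp (measurable_profile pphi)); exact: measurable_hypot.
- by apply/measurable_EFinP; apply: (measurableT_comp (measurable_profile ppsi)); exact: measurable_hypot.
- by move=> r _; rewrite lee_fin.
Qed.

Lemma Mq_on_subT D phi : measurable D -> profile phi -> (Mq_on D phi <= Mq_on setT phi)%E.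
Proof. by move=> mD pphi; rewrite (Mq_onC mD pphi) leeDl// Mq_on_ge0. Qed.

(** The dominating function is the extremal weak profile W r^(-a) taken along the plane; since a > k
    and rho > 0 its integral is finite. *)
Lemma rktrans_cvg (u : nat -> R -> R) (g : R -> R) (J : set R) (rho : R) :
  (forall j, weak_profile (u j)) -> weak_profile g -> countable J ->
  (forall r : R, 0 < r -> ~ J r -> u j r @[j --> \oo] --> g r) -> 0 < rho ->
  rktrans (u j) rho @[j --> \oo] --> rktrans g rho.
Proof.
move=> wu wg cJ ug rho0.
pose w (r : R) : R := if 0 < r then W * r `^ (- a) else 0.
have wgt0 := weak_cst_gt0.
have pw : profile w.
  split => [r|r r0|r s r0 rs]; rewrite /w.
  - by case: ifP => // r0; rewrite mulr_ge0 ?powR_ge0 ?ltW.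
  - by rewrite ltNge r0.
  - rewrite r0 (lt_le_trans r0)// ler_wpM2l ?(ltW wgt0)// !powRN lef_pV2 ?posrE ?powR_gt0 ?(lt_le_trans r0)//.
    have s0 : 0 < s by exact: lt_le_trans rs.
    apply: ge0_ler_powR => //; rewrite ?nnegrE; [|exact: ltW..].
    by rewrite ltW// aexp_gt0.
have ww : weak_profile w by split => // r r0; rewrite /w r0.
have [w0 _ _] := pw; have mw := measurable_profile pw.
have mhyp (f : R -> R) : measurable_fun setT f -> measurable_fun setT (fun r : R => f (Num.sqrt (r ^+ 2 + rho ^+ 2))).
  by move=> mf; apply: (measurableT_comp mf); exact: measurable_hypot.
have [mJ J0] := radial_measure_countable k0 (countable_hypot_preimage rho cJ).
have hgt0 (r : R) : 0 < r -> 0 < Num.sqrt (r ^+ 2 + rho ^+ 2).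
  by move=> r0; rewrite sqrtr_gt0 addr_gt0// exprn_gt0.
suff : ktrans k (u j) rho @[j --> \oo] --> (rktrans g rho)%:E.
  by move/fine_cvg.
rewrite -rktransE//; apply: (ge0_dominated_cvg (G := fun r : R => w (Num.sqrt (r ^+ 2 + rho ^+ 2)))) => //.
- by move=> j; apply: mhyp; have [/measurable_profile] := wu j.
- by apply: mhyp; have [/measurable_profile] := wg.
- exact: mhyp.
- have : {ae nu k, forall r : R, ~ [set r : R | 0 < r /\ J (Num.sqrt (r ^+ 2 + rho ^+ 2))] r}.
    by exists [set r : R | 0 < r /\ J (Num.sqrt (r ^+ 2 + rho ^+ 2))]; split => // r /= /contrapT.
  apply: filterS2 (ae_radial_gt0 k0) => r r0 /= nJ.
  by apply: ug; [exact: hgt0|move=> Jr; exact: nJ].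
- apply: filterS (ae_radial_gt0 k0) => r r0 j.
  have [[u0 _ _] uW] := wu j; rewrite u0/= /w hgt0//.
  exact: uW (hgt0 _ r0).
- have /= := rktransE ww rho0; rewrite /ktrans => ->; exact: ltry.
Qed.

(** The majorant on the right is integrable because balls have finite measure. It is available in
    two situations: [D] is an annulus, or the profiles are truncated. *)
Lemma Mq_on_cvg (u : nat -> R -> R) (g : R -> R) (J D : set R) (c S : R) :
  (forall j, weak_profile (u j)) -> weak_profile g -> countable J -> measurable D ->
  (forall r : R, 0 < r -> ~ J r -> u j r @[j --> \oo] --> g r) -> 0 <= c -> 0 < S ->
  (forall j (rho : R), 0 < rho -> rktrans (u j) rho * \1_D rho <= c * \1_(`]-oo, S[%classic) rho) ->
  (Mq_on D (u j) @[j --> \oo] --> Mq_on D g)%E.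
Proof.
move=> wu wg cJ mD ug c0 S0 uc.
apply: (ge0_dominated_cvg (G := fun rho => c `^ q * \1_(`]-oo, S[%classic) rho)).
- move=> j; apply: measurable_powR_fun; apply: measurable_rktrans_on => //.
  by have [] := wu j.
- by apply: measurable_powR_fun; apply: measurable_rktrans_on => //; have [] := wg.
- by apply: measurable_funM.
- apply: filterS (ae_radial_gt0 m0) => rho rho0; apply: cvg_powR => //.
  + by move=> j; rewrite mulr_ge0// rktrans_ge0//; have [] := wu j.
  + by rewrite mulr_ge0// rktrans_ge0//; have [] := wg.
  + by apply: cvgM; [exact: rktrans_cvg cJ ug rho0|exact: cvg_cst].
- apply: filterS (ae_radial_gt0 m0) => rho rho0 j; rewrite powR_ge0/=.
  have := uc j rho rho0; rewrite (indicE _ `]-oo, S[%classic).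
  have r0 : 0 <= rktrans (u j) rho * \1_D rho by rewrite mulr_ge0// rktrans_ge0//; have [] := wu j.
  case: (_ \in _); rewrite ?mulr1 ?mulr0 => H.
    by apply: ge0_ler_powR; rewrite ?nnegrE// ltW.
  by rewrite (_ : _ * _ = 0) ?powR0 ?gt_eqF//; apply/eqP; rewrite eq_le H.
- by move=> rho; rewrite mulr_ge0// powR_ge0.
- under eq_integral do rewrite EFinM.
  rewrite ge0_integralZl_EFin//; last 2 first.
  + by apply/measurable_EFinP.
  + by rewrite powR_ge0.
  by rewrite integral_radial_ball// -EFinM ltry.
Qed.

Lemma Mq_on_minkowski D phi f g : measurable D -> weak_profile phi -> weak_profile f -> weak_profile g ->
  (forall r, phi r = f r + g r) ->
  (Mq_on D phi <= (Mq_on D f `^ q^-1 + Mq_on D g `^ q^-1) `^ q)%E.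
Proof.
move=> mD wphi wf wg phiE; have [pphi _] := wphi; have [pf _] := wf; have [pg _] := wg.
pose F h rho := rktrans h rho * \1_D rho.
have F0 h rho : profile h -> 0 <= F h rho by move=> ph; rewrite mulr_ge0// rktrans_ge0.
have ME h : profile h -> Mq_on D h = ('N[nu m]_q%:E[EFin \o F h] `^ q)%E.
  by move=> ph; rewrite poweR_Lnorm_ge0// => rho; exact: F0.
have NE h : profile h -> (Mq_on D h `^ q^-1 = 'N[nu m]_q%:E[EFin \o F h])%E.
  by move=> ph; rewrite ME// -poweRrM mulfV ?gt_eqF// poweRe1// Lnorm_ge0.
rewrite [X in (X + _)%E](NE f pf) [X in (_ + X)%E](NE g pg).
apply: (@le_trans _ _ ('N[nu m]_q%:E[EFin \o (F f \+ F g)%R] `^ q)%E); last first.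
  apply: gt0_ler_poweR; rewrite ?in_itv/= ?leey ?andbT ?Lnorm_ge0 ?adde_ge0 ?Lnorm_ge0//; first exact: ltW.
  apply: minkowski_EFin; [exact: measurable_rktrans_on|exact: measurable_rktrans_on|exact: ltW].
rewrite poweR_Lnorm_ge0//; last by move=> rho; rewrite addr_ge0// F0.
apply: ae_ge0_le_integral => //.
- by move=> r _; rewrite lee_fin powR_ge0.
- by apply: mpow; exact: measurable_rktrans_on.
- by move=> r _; rewrite lee_fin powR_ge0.
- by apply: mpow; apply: measurable_funD; exact: measurable_rktrans_on.
apply: filterS (ae_radial_gt0 m0) => rho rho0 _; rewrite lee_fin /= /F -mulrDl.
suff -> : rktrans phi rho = rktrans f rho + rktrans g rho by [].
apply: EFin_inj; rewrite EFinD -!rktransE// /ktrans.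
have [f0 _ _] := pf; have [g0 _ _] := pg.
rewrite -ge0_integralD//.
- by apply: eq_integral => r _; rewrite phiE.
- by move=> r _; rewrite lee_fin.
- by apply/measurable_EFinP; apply: (measurableT_comp (measurable_profile pf)); exact: measurable_hypot.
- by move=> r _; rewrite lee_fin.
- by apply/measurable_EFinP; apply: (measurableT_comp (measurable_profile pg)); exact: measurable_hypot.
Qed.

Lemma Np_cvg (u : nat -> R -> R) (g G : R -> R) (J : set R) :
  (forall j, profile (u j)) -> profile g -> measurable_fun setT G -> (forall r, 0 <= G r) -> countable J ->
  (forall r : R, 0 < r -> ~ J r -> u j r @[j --> \oo] --> g r) ->
  (forall j (r : R), 0 < r -> u j r <= G r) -> (\int[nu (k + m)]_r (G r `^ p)%:E < +oo)%E ->
  (Np k m q (u j) @[j --> \oo] --> Np k m q g)%E.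
Proof.
move=> pu pg mG G0 cJ ug uG Goo; have p0 := pexp_gt0 k0 m0 q1.
have [g0 _ _] := pg.
apply: (ge0_dominated_cvg (G := fun r => G r `^ p)) => //.
- by move=> j; apply: measurable_powR_fun; exact: measurable_profile.
- by apply: measurable_powR_fun; exact: measurable_profile.
- exact: measurable_powR_fun.
- have [mJ J0] := radial_measure_countable km0 cJ.
  have : {ae nu (k + m), forall r : R, ~ J r}.
    by exists J; split => // r /= /contrapT.
  apply: filterS2 (ae_radial_gt0 km0) => r r0 nJ; apply: cvg_powR => //.
    by move=> j; have [] := pu j.
  exact: ug.
- apply: filterS (ae_radial_gt0 km0) => r r0 j; rewrite powR_ge0/=.
  have [u0 _ _] := pu j.
  by apply: ge0_ler_powR; rewrite ?nnegrE ?u0 ?G0 ?(ltW p0) ?uG.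
- by move=> r; exact: powR_ge0.
Qed.

End truncated_ktrans.

(** * Near-maximizers and the cutting inequality *)

Section maximizing.
Context {R : realType}.
Local Notation nu := (@radial_measure R).
Variables (k m : nat) (q : R).
Hypotheses (k0 : (0 < k)%N) (m0 : (0 < m)%N) (q1 : 1 < q).
Local Notation p := (pexp k m q).
Local Notation a := (aexp k m q).
Local Notation W := (weak_cst k m q).
Local Notation Np := (Np k m q).
Local Notation Mq := (Mq k m q).
Local Notation Mq_on := (Mq_on k m q).
Local Notation weak_profile := (weak_profile k m q).

Let km0 : (0 < k + m)%N. Proof. by rewrite addn_gt0 k0. Qed.
Let q0 : 0 < q. Proof. exact: qgt0. Qed.
Let p0 : 0 < p. Proof. exact: pexp_gt0. Qed.
Let a0 : 0 < a. Proof. exact: aexp_gt0. Qed.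
Let W0 : 0 < W. Proof. exact: weak_cst_gt0. Qed.
Let s1 : 1 < q / p. Proof. by rewrite ltr_pdivlMr// mul1r pexp_ltq. Qed.

(** A bound for [Mq] on profiles of norm 1; in the end it is the q-th power of the supremum. *)
Variable A : R.
Hypothesis A0 : 0 < A.
Hypothesis MqA : forall phi, profile phi -> Np phi = 1%E -> (Mq phi <= A%:E)%E.

Lemma profile_Np_le1 phi : profile phi -> (Np phi <= 1)%E -> weak_profile phi.
Proof. by move=> pphi N1; split => // r r0; exact: profile_weak. Qed.

Lemma weak_profile_le phi psi : profile phi -> weak_profile psi -> (forall r, phi r <= psi r) -> weak_profile phi.
Proof. by move=> pphi [_ psiW] le; split => // r r0; apply: le_trans (psiW r r0). Qed.

Lemma Np_le phi psi : profile phi -> profile psi -> (forall r, phi r <= psi r) -> (Np phi <= Np psi)%E.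
Proof.
move=> pphi ppsi le; have [phi0 _ _] := pphi; have [psi0 _ _] := ppsi.
apply: ge0_le_integral => //.
- by move=> r _; rewrite lee_fin powR_ge0.
- by apply/measurable_EFinP; apply: measurable_powR_fun; exact: measurable_profile.
- by apply/measurable_EFinP; apply: measurable_powR_fun; exact: measurable_profile.
- by move=> r _; rewrite lee_fin; apply: ge0_ler_powR; rewrite ?nnegrE ?phi0 ?psi0 ?le ?(ltW p0).
Qed.

Lemma Mq_homogeneous phi (x : R) : profile phi -> Np phi = x%:E -> 0 <= x -> x <= 1 ->
  (Mq phi <= (A * x `^ (q / p))%:E)%E.
Proof.
move=> pphi Nx; rewrite le_eqVlt => /predU1P[xE|x0] x1.
  (* At x = 0 the profile cannot be normalized; [strong_bound] gives [Mq phi] = 0 instead. *)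
  have [_ phiW] : weak_profile phi by apply: profile_Np_le1; rewrite ?Nx ?lee_fin.
  have := strong_bound k0 m0 q1 pphi (ltW W0) phiW.
  rewrite Nx -xE mule0 => /le_trans; apply.
  by rewrite lee_fin mulr_ge0 ?powR_ge0 ?ltW.
pose c := x `^ p^-1; have c0 : 0 < c by rewrite powR_gt0.
have cV0 : 0 <= c^-1 by rewrite invr_ge0 ltW.
pose psi r := c^-1 * phi r; have ppsi : profile psi by exact: profileZ.
have phiE : phi = (fun r => c * psi r).
  by apply/funext => r; rewrite /psi mulVKf// gt_eqF.
have N1 : Np psi = 1%E.
  have cp : c `^ p = x by rewrite /c -powRrM mulVf ?gt_eqF// powRr1// ltW.
  rewrite NpZ// Nx -EFinM -[x in LHS]cp -powRM ?(ltW c0)// mulVf ?powR1//.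
  by rewrite gt_eqF.
rewrite phiE MqZ ?(ltW c0)// EFinM muleC.
apply: (le_trans (lee_wpmul2r _ (MqA ppsi N1))); first by rewrite lee_fin powR_ge0.
by rewrite /c -powRrM [_ / p]mulrC.
Qed.

(** Were r^a phi (r) below [dl] everywhere, [strong_bound] with B = [dl] would give Mq <= A/4; [dl]
    solves strong_cst dl^(q-p) = A/4. *)
Lemma nonvanishing : exists2 dl : R, 0 < dl & forall phi, profile phi -> Np phi = 1%E ->
  ((A / 2)%:E <= Mq phi)%E -> exists2 r : R, 0 < r & dl <= r `^ a * phi r.
Proof.
have S0 := strong_cst_gt0 k m0 q1.
have qp : 0 < q - p by rewrite subr_gt0 pexp_ltq.
pose dl := (A / 4 / strong_cst k m q) `^ (q - p)^-1.
have dl0 : 0 < dl by rewrite powR_gt0// !divr_gt0.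
exists dl => // phi pphi N1 MA; apply: contrapT => H.
have phidl (r : R) : 0 < r -> phi r <= dl * r `^ (- a).
  move=> r0; rewrite powRN ler_pdivlMr ?powR_gt0// mulrC leNgt; apply/negP => /ltW Hr.
  by apply: H; exists r.
have := le_trans MA (strong_bound k0 m0 q1 pphi (ltW dl0) phidl).
have E0 : 0 <= A / 4 / strong_cst k m q by rewrite ltW// !divr_gt0.
rewrite N1 mule1 lee_fin /dl -powRrM mulVf ?gt_eqF// (powRr1 E0) mulrCA divff ?gt_eqF// mulr1.
by move: A0; lra.
Qed.

(** On [E] the transform is left whole; only off [E] is it split by Minkowski. The outer piece has
    p-th power of norm at most 1 - x by superadditivity, whence the term in [A]. *)
Lemma mid_out_bound (al be : R) (E : set R) phi (x b e : R) : 0 < al -> al < be -> measurable E ->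
  profile phi -> Np phi = 1%E -> Np (mid al be \o phi) = x%:E ->
  Mq_on (~` E) (mid al be \o phi) = b%:E -> Mq_on E phi = e%:E -> 0 <= b ->
  (Mq phi <= (e + (b `^ q^-1 + (A * (1 - x) `^ (q / p)) `^ q^-1) `^ q)%:E)%E.
Proof.
move=> al0 albe mE pphi N1 Nx Mb Me b0.
have [phi0 _ _] := pphi.
have pm := profile_mid al0 albe pphi; have po := profile_out al0 albe pphi.
have wphi : weak_profile phi by apply: profile_Np_le1 => //; rewrite N1.
have wm : weak_profile (mid al be \o phi) by apply: weak_profile_le pm wphi _ => r; exact: mid_le_id.
have wo : weak_profile (out al be \o phi) by apply: weak_profile_le po wphi _ => r; exact: out_le_id.
have mF : measurable (~` E) by exact: measurableC.
have := Np_ge0 k m q (out al be \o phi).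
have Ny : (Np (mid al be \o phi) + Np (out al be \o phi) <= 1)%E.
  rewrite -N1 -ge0_integralD//.
  - apply: ge0_le_integral => //.
    + by move=> r _; rewrite -EFinD lee_fin addr_ge0 ?powR_ge0.
    + by apply: emeasurable_funD; apply/measurable_EFinP; apply: measurable_powR_fun; exact: measurable_profile.
    + by apply/measurable_EFinP; apply: measurable_powR_fun; exact: measurable_profile.
    + move=> r _; rewrite -EFinD lee_fin -[X in _ <= X `^ _](midDout albe (phi r)).
      apply: powR_superadditive; [exact: ltW (pexp_gt1 _ _ _)|exact: mid_ge0|exact: out_ge0].
  - by move=> r _; rewrite lee_fin powR_ge0.
  - by apply/measurable_EFinP; apply: measurable_powR_fun; exact: measurable_profile.
  - by move=> r _; rewrite lee_fin powR_ge0.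
  - by apply/measurable_EFinP; apply: measurable_powR_fun; exact: measurable_profile.
have x0 : 0 <= x by rewrite -lee_fin -Nx Np_ge0.
case Ey : (Np (out al be \o phi)) Ny => [y| |]; rewrite Nx//.
rewrite -EFinD !lee_fin => xy y0.
have Mo : (Mq_on (~` E) (out al be \o phi) <= (A * (1 - x) `^ (q / p))%:E)%E.
  apply: (le_trans (Mq_on_subT k m q1 mF po)); rewrite -Mq_onT//.
  apply: (le_trans (Mq_homogeneous po Ey y0 _)); first lra.
  rewrite lee_fin ler_wpM2l ?(ltW A0)//; apply: ge0_ler_powR; rewrite ?nnegrE//; last 2 first.
  - by lra.
  - by lra.
  by rewrite ltW// divr_gt0.
rewrite (Mq_onT m0 q1 wphi) (Mq_onC k m q1 mE pphi) Me EFinD; apply: leeD2l.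
apply: (le_trans (Mq_on_minkowski m0 q1 mF wphi wm wo _)) => [r|].
  by rewrite /= midDout.
rewrite -poweR_EFin; apply: gt0_ler_poweR; rewrite ?in_itv/= ?leey ?andbT ?(ltW q0)//.
- by rewrite adde_ge0 ?poweR_ge0.
- by rewrite lee_fin addr_ge0// powR_ge0.
rewrite EFinD; apply: leeD; first by rewrite Mb.
rewrite -poweR_EFin; apply: gt0_ler_poweR; rewrite ?in_itv/= ?leey ?andbT ?Mq_on_ge0 ?lee_fin ?mulr_ge0 ?powR_ge0 ?(ltW A0)//.
by rewrite invr_ge0 ltW.
Qed.

(** The bound of [ktrans_weak] decreases in [rho], so [ep] is the worst case. The [+ 1] puts the
    closed annulus inside an open half-line. *)
Lemma rktrans_le_annulus phi (ep rho : R) : weak_profile phi -> 0 < ep -> 0 < rho ->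
  rktrans k phi rho * \1_(`[ep, ep^-1]%classic) rho <=
  2 ^+ k * ballvol k / (1 - 2 `^ (k%:R - a)) * W * ep `^ (k%:R - a) * \1_(`]-oo, (ep^-1 + 1)[%classic) rho.
Proof.
move=> wphi ep0 rho0; have [pphi phiW] := wphi.
have ka : k%:R < a by exact: aexp_gtk.
rewrite !indicE; have [|_] := boolP (rho \in `[ep, ep^-1]%classic); last first.
  rewrite mulr0 !mulr_ge0 ?powR_ge0 ?exprn_ge0 ?(ltW W0) ?(ltW (ballvol_gt0 _))// invr_ge0 subr_ge0 ltW// powR_lt1//.
  by rewrite subr_lt0.
rewrite inE/= in_itv/= => /andP[er re].
rewrite mem_set/=; last by rewrite in_itv/= (le_lt_trans re)// ltrDl.
rewrite !mulr1 -lee_fin -(rktransE m0 q1 wphi rho0).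
apply: (le_trans (ktrans_weak pphi ka (ltW W0) phiW rho0)).
rewrite lee_fin ler_wpM2l//.
  rewrite !mulr_ge0 ?powR_ge0 ?exprn_ge0 ?(ltW W0) ?(ltW (ballvol_gt0 _))// invr_ge0 subr_ge0 ltW// powR_lt1//.
  by rewrite subr_lt0.
rewrite -opprB !powRN lef_pV2 ?posrE ?powR_gt0//.
by apply: ge0_ler_powR; rewrite ?nnegrE ?subr_ge0 // ltW.
Qed.

(** A profile supported in the ball of radius [S] has zero transform on planes at distance at least
    [S], and any other plane meets that ball in a set of volume at most S^k |B|. *)
Lemma rktrans_le_bounded phi (b S rho : R) (D : set R) : weak_profile phi -> 0 <= b -> 0 < S ->
  (forall r : R, 0 < r -> phi r <= b * \1_(`]-oo, S[%classic) r) -> 0 < rho ->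
  rktrans k phi rho * \1_D rho <= b * (S ^+ k * ballvol k) * \1_(`]-oo, S[%classic) rho.
Proof.
move=> wphi b0 S0 phib rho0; have [pphi phiW] := wphi; have [phi0 _ _] := pphi.
have mphi := measurable_profile pphi.
apply: (@le_trans _ _ (rktrans k phi rho)).
  by rewrite -[leRHS]mulr1 ler_wpM2l ?rktrans_ge0// indicE; case: (_ \in _).
rewrite -lee_fin -(rktransE m0 q1 wphi rho0).
apply: (@le_trans _ _ (\int[nu k]_r ((b * \1_(`]-oo, S[%classic) rho)%:E * (\1_(`]-oo, S[%classic) r)%:E))%E); last first.
  rewrite ge0_integralZl_EFin//; last 2 first.
  - by apply/measurable_EFinP.
  - by rewrite mulr_ge0.
  by rewrite integral_radial_ball// -EFinM lee_fin mulrAC.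
apply: ae_ge0_le_integral => //.
- by move=> r _; rewrite lee_fin.
- by apply/measurable_EFinP; apply: (measurableT_comp mphi); exact: measurable_hypot.
- by move=> r _; rewrite -EFinM lee_fin !mulr_ge0.
- by apply: emeasurable_funM => //; apply/measurable_EFinP.
apply: filterS (ae_radial_gt0 k0) => r r0 _; rewrite -EFinM lee_fin.
have h0 : 0 < Num.sqrt (r ^+ 2 + rho ^+ 2) by rewrite sqrtr_gt0 addr_gt0// exprn_gt0.
apply: (le_trans (phib _ h0)); rewrite -mulrA ler_wpM2l// !indicE.
have [|_] := boolP (_ \in _); last by rewrite mulr_ge0.
rewrite inE/= in_itv/= => hS.
have hr : r <= Num.sqrt (r ^+ 2 + rho ^+ 2).
  by rewrite -[leLHS]gtr0_norm// -sqrtr_sqr ler_wsqrtr// lerDl sqr_ge0.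
have hrho : rho <= Num.sqrt (r ^+ 2 + rho ^+ 2).
  by rewrite -[leLHS]gtr0_norm// -sqrtr_sqr ler_wsqrtr// lerDr sqr_ge0.
by rewrite !mem_set ?mulr1//= in_itv/=; exact: le_lt_trans hS.
Qed.

(** Beyond [S], where W S^(-a) = al, the weak bound is at most [al] and the cut profile vanishes.
    The value of [S] is part of the conclusion because it does not depend on [phi], which makes the
    majorant uniform along a sequence. *)
Lemma mid_bounded phi (al be : R) : 0 < al -> al < be -> weak_profile phi ->
  exists2 S : R, 0 < S & S = (W / al) `^ a^-1 /\
    forall r : R, 0 < r -> mid al be (phi r) <= be * \1_(`]-oo, S[%classic) r.
Proof.
move=> al0 albe [_ phiW]; set S := (W / al) `^ a^-1.
have S0 : 0 < S by rewrite powR_gt0// divr_gt0.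
exists S => //; split => // r r0; rewrite indicE.
have [_|] := boolP (_ \in _); first by rewrite mulr1 mid_le_be.
rewrite notin_setE/= in_itv/= => /negP; rewrite -leNgt mulr0 => Sr.
rewrite mid_eq0//; apply: (le_trans (phiW r r0)).
rewrite powRN ler_pdivrMr ?powR_gt0// mulrC -ler_pdivrMr//.
rewrite (_ : W / al = S `^ a); last by rewrite -powRrM mulVf ?gt_eqF// powRr1// ltW// divr_gt0.
by apply: ge0_ler_powR; rewrite ?nnegrE ?(ltW a0) ?(ltW S0) ?(ltW r0).
Qed.

End maximizing.

(** * The limit of a maximizing sequence *)

Section maximizing_limit.
Context {R : realType}.
Local Notation nu := (@radial_measure R).
Variables (k m : nat) (q : R).
Hypotheses (k0 : (0 < k)%N) (m0 : (0 < m)%N) (q1 : 1 < q).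
Local Notation p := (pexp k m q).
Local Notation a := (aexp k m q).
Local Notation W := (weak_cst k m q).
Local Notation Np := (Np k m q).
Local Notation Mq := (Mq k m q).
Local Notation Mq_on := (Mq_on k m q).
Local Notation weak_profile := (weak_profile k m q).

Let km0 : (0 < k + m)%N. Proof. by rewrite addn_gt0 k0. Qed.
Let q0 : 0 < q. Proof. exact: qgt0. Qed.
Let p0 : 0 < p. Proof. exact: pexp_gt0. Qed.
Let s1 : 1 < q / p. Proof. by rewrite ltr_pdivlMr// mul1r pexp_ltq. Qed.
Let s0 : 0 < q / p. Proof. exact: lt_trans s1. Qed.

Variable A : R.
Hypothesis A0 : 0 < A.
Hypothesis MqA : forall phi, profile phi -> Np phi = 1%E -> (Mq phi <= A%:E)%E.

Variables (psi : nat -> R -> R) (f : R -> R).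
Hypotheses (ppsi : forall j, profile (psi j)) (psiN : forall j, Np (psi j) = 1%E).
Hypotheses (pf : profile f)
  (psif : forall r : R, 0 < r -> ~ jumps f r -> psi j r @[j --> \oo] --> f r).

Let wpsi j : weak_profile (psi j).
Proof. by apply: profile_Np_le1 => //; rewrite psiN. Qed.

Let cJ : countable (jumps f). Proof. exact: countable_jumps. Qed.

Definition annulus (ep : R) : set R := `[ep, ep^-1]%classic.

(** Fatou, the limit being pointwise off the null set of jumps. *)
Lemma Np_limit_le1 : (Np f <= 1)%E.
Proof.
have [f0 _ _] := pf.
have -> : Np f = (\int[nu (k + m)]_r limn_einf (fun j => (psi j r `^ p)%:E))%E.
  apply: ae_eq_integral => //.
  - by apply/measurable_EFinP; apply: measurable_powR_fun; exact: measurable_profile.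
  - rewrite (_ : (fun r => _) = (fun r => - limn_esup (fun j => - (psi j r `^ p)%:E))%E).
      apply: measurableT_comp => //; apply: measurable_fun_limn_esup => j; apply: measurableT_comp => //.
      by apply/measurable_EFinP; apply: measurable_powR_fun; exact: measurable_profile.
    apply/funext => r; rewrite -limn_einfN; congr limn_einf.
    by apply/funext => j; rewrite [RHS]oppeK.
  apply: filterS (ae_profile_continuous km0 pf) => r [r0 nJ] _.
  suff /cvg_limn_einf_sup[-> _] : (psi j r `^ p)%:E @[j --> \oo] --> (f r `^ p)%:E by [].
  apply: cvg_EFin; first exact: nearW.
  by apply: cvg_powR => //; [move=> j; have [] := ppsi j|exact: psif].
apply: (le_trans (fatou _ _ _ _)) => //.
- by move=> j; apply/measurable_EFinP; apply: measurable_powR_fun; exact: measurable_profile.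
- by move=> j r _; rewrite lee_fin powR_ge0.
rewrite (_ : (fun j => _) = cst 1%E); last by apply/funext => j; exact: psiN.
suff /cvg_limn_einf_sup[-> _] : (cst 1%E : nat -> \bar R) j @[j --> \oo] --> 1%E by [].
exact: cvg_cst.
Qed.

Let wf : weak_profile f. Proof. exact: profile_Np_le1 Np_limit_le1. Qed.

Let mid_psif (al be : R) : al < be -> forall r : R, 0 < r -> ~ jumps f r ->
  mid al be (psi j r) @[j --> \oo] --> mid al be (f r).
Proof. by move=> albe r r0 nJ; apply: mid_continuous => //; exact: psif. Qed.

Let wmid (al be : R) phi : 0 < al -> al < be -> weak_profile phi -> weak_profile (mid al be \o phi).
Proof.
move=> al0 albe wphi; have [pphi _] := wphi; have [phi0 _ _] := pphi.
by apply: weak_profile_le (profile_mid _ _ _) wphi _ => // r; exact: mid_le_id.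
Qed.

Lemma Np_mid_cvg (al be : R) : 0 < al -> al < be ->
  (Np (mid al be \o psi j) @[j --> \oo] --> Np (mid al be \o f))%E.
Proof.
move=> al0 albe; have [S S0 [SE _]] := mid_bounded k0 m0 q1 al0 albe wf.
have be0 : 0 <= be by rewrite ltW// (lt_trans al0).
apply: (Np_cvg k0 m0 q1 (G := fun r => be * \1_(`]-oo, S[%classic) r) _ _ _ _ cJ) => //.
- by move=> j; exact: profile_mid.
- exact: profile_mid.
- by apply: measurable_funM.
- by move=> r; rewrite mulr_ge0.
- by move=> r r0 nJ; exact: mid_psif.
- by move=> j r r0; have [S' S'0 [S'E]] := mid_bounded k0 m0 q1 al0 albe (wpsi j); rewrite S'E -SE; apply.
- rewrite (eq_integral (fun r => (be `^ p)%:E * (\1_(`]-oo, S[%classic) r)%:E)%E); last first.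
    move=> r _; rewrite powRM// EFinM; congr (_ * _%:E)%E.
    by rewrite indicE; case: (_ \in _); rewrite ?powR1 ?powR0 ?gt_eqF.
  rewrite ge0_integralZl_EFin//; last 2 first.
  + by apply/measurable_EFinP.
  + by rewrite powR_ge0.
  by rewrite integral_radial_ball// -EFinM ltry.
Qed.

Lemma Mq_mid_cvg (D : set R) (al be : R) : measurable D -> 0 < al -> al < be ->
  (Mq_on D (mid al be \o psi j) @[j --> \oo] --> Mq_on D (mid al be \o f))%E.
Proof.
move=> mD al0 albe; have [S S0 [SE _]] := mid_bounded k0 m0 q1 al0 albe wf.
have be0 : 0 <= be by rewrite ltW// (lt_trans al0).
apply: (Mq_on_cvg k0 m0 q1 (c := be * (S ^+ k * ballvol k)) (S := S) _ _ cJ mD) => //.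
- by move=> j; exact: wmid.
- exact: wmid.
- by move=> r r0 nJ; exact: mid_psif.
- by rewrite !mulr_ge0 ?exprn_ge0 ?(ltW S0)// ltW// ballvol_gt0.
move=> j rho rho0; apply: (rktrans_le_bounded k0 m0 q1) => //; first exact: wmid.
by have [S' S'0 [S'E]] := mid_bounded k0 m0 q1 al0 albe (wpsi j); rewrite S'E -SE.
Qed.

Lemma Mq_annulus_cvg (ep : R) : 0 < ep ->
  (Mq_on (annulus ep) (psi j) @[j --> \oo] --> Mq_on (annulus ep) f)%E.
Proof.
move=> ep0; apply: (Mq_on_cvg k0 m0 q1 (c := 2 ^+ k * ballvol k / (1 - 2 `^ (k%:R - a)) * W * ep `^ (k%:R - a))
  (S := ep^-1 + 1) wpsi wf cJ _ psif) => //; first exact: measurable_itv.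
- rewrite !mulr_ge0 ?powR_ge0 ?exprn_ge0 ?(ltW (weak_cst_gt0 _ _ _)) ?(ltW (ballvol_gt0 _))// invr_ge0 subr_ge0 ltW// powR_lt1//.
  by rewrite subr_lt0 aexp_gtk.
- by rewrite addr_gt0 ?invr_gt0.
by move=> j rho rho0; exact: (rktrans_le_annulus m0 q1).
Qed.

Hypothesis psiM : (Mq (psi j) @[j --> \oo] --> A%:E)%E.
Hypothesis f0 : (0 < Np f)%E.

Let Mq_fin phi : profile phi -> (Np phi <= 1)%E -> exists2 x : R, 0 <= x & Mq phi = x%:E.
Proof.
move=> pphi N1; have [x Nx] : exists x : R, Np phi = x%:E.
  by move: N1 (Np_ge0 k m q phi); case: (Np phi) => // x; exists x.
have x0 : 0 <= x by rewrite -lee_fin -Nx Np_ge0.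
have x1 : x <= 1 by rewrite -lee_fin -Nx.
have := Mq_homogeneous k0 m0 q1 A0 MqA pphi Nx x0 x1.
have := Mq_ge0 k m q phi; case: (Mq phi) => // y; rewrite lee_fin => y0 _.
by exists y.
Qed.

Let Mq_on_fin (D : set R) phi : measurable D -> profile phi -> (Np phi <= 1)%E -> exists2 x : R, 0 <= x & Mq_on D phi = x%:E.
Proof.
move=> mD pphi N1; have [y y0 My] := Mq_fin pphi N1.
have := Mq_on_subT k m q1 mD pphi; rewrite -(Mq_onT m0 q1) ?My; last exact: profile_Np_le1.
by have := Mq_on_ge0 k m q D phi; case: (Mq_on D phi) => // z; rewrite lee_fin => z0 _; exists z.
Qed.

Let Np_fin phi : profile phi -> (Np phi <= 1)%E -> exists2 x : R, 0 <= x <= 1 & Np phi = x%:E.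
Proof.
move=> pphi N1; have := N1; have := Np_ge0 k m q phi; case: (Np phi) => // x.
by rewrite !lee_fin => x0 x1; exists x; rewrite ?x0.
Qed.

Let Np_mid_le (al be : R) phi : 0 < al -> al < be -> profile phi -> (Np (mid al be \o phi) <= Np phi)%E.
Proof.
move=> al0 albe pphi; have [phi0 _ _] := pphi; apply: Np_le => //; first exact: profile_mid.
by move=> r; exact: mid_le_id.
Qed.

(* Passing to the limit in mid_out_bound at fixed truncation levels. *)
Lemma limit_bound (al be ep M x b : R) : 0 < al -> al < be -> 0 < ep -> Mq f = M%:E ->
  Np (mid al be \o f) = x%:E -> Mq_on (~` annulus ep) f = b%:E ->
  A <= M + (b `^ q^-1 + (A * (1 - x) `^ (q / p)) `^ q^-1) `^ q.
Proof.
move=> al0 albe ep0 Mf Nx Mb; set E := annulus ep; have mE : measurable E by exact: measurable_itv.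
have mF : measurable (~` E) by exact: measurableC.
have Npsi1 j : (Np (psi j) <= 1)%E by rewrite psiN.
have pm phi : profile phi -> profile (mid al be \o phi) by exact: profile_mid.
have Nm1 phi : profile phi -> (Np phi <= 1)%E -> (Np (mid al be \o phi) <= 1)%E.
  by move=> pphi; apply: le_trans; exact: Np_mid_le.
have [ef ef0 Ef] := Mq_on_fin mE pf Np_limit_le1.
have [bf bf0 Bf] := Mq_on_fin mF (pm f pf) (Nm1 f pf Np_limit_le1).
have efM : ef <= M.
  by rewrite -lee_fin -Ef -Mf (Mq_onT m0 q1 wf) Mq_on_subT.
have bfb : bf <= b.
  rewrite -lee_fin -Bf -Mb; apply: Mq_on_le => //; first exact: wmid.
  by have [f0' _ _] := pf => r; exact: mid_le_id.
have x1 : 0 <= 1 - x by rewrite subr_ge0 -lee_fin -Nx; exact: Nm1 Np_limit_le1.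
pose Mj j := fine (Mq (psi j)); pose ej j := fine (Mq_on E (psi j)).
pose bj j := fine (Mq_on (~` E) (mid al be \o psi j)); pose xj j := fine (Np (mid al be \o psi j)).
have ej0 j : 0 <= ej j by rewrite fine_ge0// Mq_on_ge0.
have bj0 j : 0 <= bj j by rewrite fine_ge0// Mq_on_ge0.
have xj1 j : 0 <= 1 - xj j.
  have [x' /andP[_ x'1] E'] := Np_fin (pm _ (ppsi j)) (Nm1 _ (ppsi j) (Npsi1 j)).
  by rewrite /xj E' subr_ge0.
have H j : Mj j <= ej j + (bj j `^ q^-1 + (A * (1 - xj j) `^ (q / p)) `^ q^-1) `^ q.
  have [x' _ E1] := Np_fin (pm _ (ppsi j)) (Nm1 _ (ppsi j) (Npsi1 j)).
  have [e' _ E2] := Mq_on_fin mE (ppsi j) (Npsi1 j).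
  have [b' b'0 E3] := Mq_on_fin mF (pm _ (ppsi j)) (Nm1 _ (ppsi j) (Npsi1 j)).
  have [M' _ E4] := Mq_fin (ppsi j) (Npsi1 j).
  have := mid_out_bound k0 m0 q1 A0 MqA al0 albe mE (ppsi j) (psiN j) E1 E3 E2 b'0.
  by rewrite E4 lee_fin /Mj /ej /bj /xj E1 E2 E3 E4.
have qV0 : 0 < q^-1 by rewrite invr_gt0.
have cM : Mj j @[j --> \oo] --> A by exact: fine_cvg psiM.
have ce : ej j @[j --> \oo] --> ef.
  by apply: fine_cvg; rewrite -Ef; exact: Mq_annulus_cvg.
have cb : bj j @[j --> \oo] --> bf.
  by apply: fine_cvg; rewrite -Bf; exact: Mq_mid_cvg.
have cx : xj j @[j --> \oo] --> x.
  by apply: fine_cvg; rewrite -Nx; exact: Np_mid_cvg.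
move: (Mj) (ej) (bj) (xj) ej0 bj0 xj1 H cM ce cb cx => {Mj ej bj xj} Mj ej bj xj ej0 bj0 xj1 H cM ce cb cx.
have cR : ej j + (bj j `^ q^-1 + (A * (1 - xj j) `^ (q / p)) `^ q^-1) `^ q @[j --> \oo] -->
    ef + (bf `^ q^-1 + (A * (1 - x) `^ (q / p)) `^ q^-1) `^ q.
  apply: cvgD; [exact: ce|apply: (cvg_powR q0)].
  - by move=> j; rewrite addr_ge0 ?powR_ge0.
  - by rewrite addr_ge0 ?powR_ge0.
  apply: cvgD; first by apply: (cvg_powR qV0).
  apply: (cvg_powR qV0).
  - by move=> j; rewrite mulr_ge0 ?powR_ge0// ltW.
  - by rewrite mulr_ge0 ?powR_ge0// ltW.
  apply: cvgM; first exact: cvg_cst.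
  by apply: (cvg_powR s0 xj1 x1); apply: cvgB; [exact: cvg_cst|exact: cx].
apply: (le_trans (ler_cvg_to cM cR (nearW _ H))).
apply: (lerD efM); apply: (ge0_ler_powR (ltW q0)); rewrite ?nnegrE ?addr_ge0 ?powR_ge0//.
rewrite lerD2r; apply: ge0_ler_powR; rewrite ?nnegrE ?(ltW qV0)//.
exact: le_trans bfb.
Qed.

(* The truncation levels (l+2)^-1 < l+2 and the annuli exhaust as l grows. *)
Lemma maximizer_limit : Np f = 1%E /\ Mq f = A%:E.
Proof.
have [f_ge0 _ _] := pf; have N1 := Np_limit_le1.
have [X /andP[X0 X1] NX] := Np_fin pf N1; have [M M0 MM] := Mq_fin pf N1.
have Xgt0 : 0 < X by rewrite -lte_fin -NX.
have MX : M <= A * X `^ (q / p).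
  by rewrite -lee_fin -MM; exact: (Mq_homogeneous k0 m0 q1 A0 MqA pf NX X0 X1).
pose L l : R := l.+2%:R; have L0 l : 0 < L l by [].
have L1 l : 1 < L l by rewrite ltr1n.
have LV0 l : 0 < (L l)^-1 by rewrite invr_gt0.
have LV l : (L l)^-1 < L l by rewrite (lt_trans _ (L1 l))// invf_lt1.
have Lbig (x : R) : \forall l \near \oo, x <= L l.
  exists (Num.truncn `|x|) => // l /= xl; apply: (le_trans (ler_norm x)).
  by apply/ltW; apply: (lt_le_trans (truncnS_gt `|x|)); rewrite ler_nat leqW.
pose mf l := mid (L l)^-1 (L l) \o f.
have pmf l : profile (mf l) by exact: profile_mid.
have cN : (Np (mf l) @[l --> \oo] --> X%:E)%E.
  rewrite -NX; apply: (Np_cvg k0 m0 q1 pmf pf (measurable_profile pf) f_ge0 (@countable0 R)).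
  - move=> r r0 _; apply/cvgrPdist_le => e e0.
    have H1 : \forall l \near \oo, (L l)^-1 <= e.
      by apply: filterS (Lbig e^-1) => l el; rewrite -[e]invrK lef_pV2 ?posrE ?invr_gt0.
    move: H1 (Lbig (f r)); apply: filterS2 => l le fl.
    rewrite -{1}(midDout (LV l) (f r)) addrAC subrr add0r ger0_norm ?out_ge0//.
    rewrite /out (max_r (x := f r - L l)) ?subr_le0// addr0.
    by rewrite ge_min le orbT.
  - by move=> l r r0; exact: mid_le_id.
  - by rewrite -/(Np f) NX ltry.
(* Each rho > 0 eventually enters the annuli, and the full transform of [f] is a majorant with
   finite integral. *)
have cb : (Mq_on (~` annulus (L l)^-1) f @[l --> \oo] --> 0)%E.
  have -> : 0%E = (\int[nu m]_rho (0 : R)%:E)%E by rewrite integral0.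
  apply: (ge0_dominated_cvg (G := fun rho => (rktrans k f rho * \1_setT rho) `^ q)).
  - move=> l; apply: measurable_powR_fun; apply: measurable_rktrans_on => //.
    by apply: measurableC; exact: measurable_itv.
  - exact: measurable_cst.
  - by apply: measurable_powR_fun; exact: measurable_rktrans_on.
  - apply: filterS (ae_radial_gt0 m0) => rho rho0.
    apply: cvg_near_cst; move: (Lbig rho) (Lbig rho^-1); apply: filterS2 => l l1 l2.
    rewrite indicE memNset ?mulr0 ?powR0 ?gt_eqF//= => /(_ _); apply.
    by rewrite /annulus/= in_itv/= invrK l1 andbT -[leRHS]invrK lef_pV2 ?posrE ?invr_gt0.
  - apply: nearW => rho l; rewrite powR_ge0/=; apply: (ge0_ler_powR (ltW q0)).
    + by rewrite nnegrE mulr_ge0// rktrans_ge0.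
    + by rewrite nnegrE mulr_ge0// rktrans_ge0.
    + by rewrite ler_wpM2l ?rktrans_ge0// indicT indicE; case: (_ \in _).
  - by move=> rho; exact: powR_ge0.
  - have := Mq_onT m0 q1 wf; rewrite MM /Mq_on => <-; exact: ltry.
pose xl l := fine (Np (mf l)); pose bl l := fine (Mq_on (~` annulus (L l)^-1) f).
have cx : xl l @[l --> \oo] --> X by exact: fine_cvg cN.
have cbl : bl l @[l --> \oo] --> (0 : R) by exact: fine_cvg cb.
have mC l : measurable (~` annulus (L l)^-1) by apply: measurableC; exact: measurable_itv.
have bl0 l : 0 <= bl l by rewrite fine_ge0// Mq_on_ge0.
have Nm1 l : (Np (mf l) <= 1)%E by apply: le_trans N1; exact: Np_mid_le.
have xl1 l : 0 <= 1 - xl l.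
  by have [x' /andP[_ x'1] E'] := Np_fin (pmf l) (Nm1 l); rewrite /xl E' subr_ge0.
have H l : A <= M + (bl l `^ q^-1 + (A * (1 - xl l) `^ (q / p)) `^ q^-1) `^ q.
  have [x' _ E1] := Np_fin (pmf l) (Nm1 l).
  have [b' _ E2] := Mq_on_fin (mC l) pf N1.
  by apply: (limit_bound (LV0 l) (LV l) (LV0 l) MM); rewrite /xl /bl ?E1 ?E2.
move: (xl) (bl) cx cbl bl0 xl1 H => {xl bl} xl bl cx cbl bl0 xl1 H.
have qV0 : 0 < q^-1 by rewrite invr_gt0.
have X1' : 0 <= 1 - X by rewrite subr_ge0.
have cR : M + (bl l `^ q^-1 + (A * (1 - xl l) `^ (q / p)) `^ q^-1) `^ q @[l --> \oo] -->
    M + (0 `^ q^-1 + (A * (1 - X) `^ (q / p)) `^ q^-1) `^ q.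
  apply: cvgD; [exact: cvg_cst|apply: (cvg_powR q0)].
  - by move=> j; rewrite addr_ge0 ?powR_ge0.
  - by rewrite addr_ge0 ?powR_ge0.
  apply: cvgD; first by apply: (cvg_powR qV0).
  apply: (cvg_powR qV0).
  - by move=> j; rewrite mulr_ge0 ?powR_ge0// ltW.
  - by rewrite mulr_ge0 ?powR_ge0// ltW.
  apply: cvgM; first exact: cvg_cst.
  by apply: (cvg_powR s0 xl1 X1'); apply: cvgB; [exact: cvg_cst|exact: cx].
have AM : A <= M + A * (1 - X) `^ (q / p).
  have : A <= M + (0 `^ q^-1 + (A * (1 - X) `^ (q / p)) `^ q^-1) `^ q.
    exact: ler_cvg_to (cvg_cst A) cR (nearW _ H).
  rewrite (powR0 (lt0r_neq0 qV0)) add0r -powRrM mulVf ?gt_eqF// powRr1//.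
  by rewrite mulr_ge0 ?powR_ge0// ltW.
(* For 0 < X < 1 the bounds give A <= A (X^(q/p) + (1 - X)^(q/p)), which is less than A. *)
have XE : X = 1.
  apply/eqP; rewrite eq_le X1 leNgt; apply/negP => Xlt1.
  have := powR_split_lt1 s1 Xgt0 Xlt1; rewrite -(ltr_pM2l A0) mulr1 mulrDr; lra.
rewrite NX MM XE; split => //; congr (_%:E); apply/eqP; rewrite eq_le.
move: MX AM; rewrite XE powR1 mulr1 subrr powR0 ?gt_eqF// mulr0 addr0 => -> ->//.
Qed.

(** Since |x - y|^p + 2 min(x, y)^p <= x^p + y^p, the p-th power of the distance is at most 2 - 2
    [Np] (min (psi_j, f)). The minimum is dominated by [f] and converges to it, so no mass being
    lost makes this tend to 0. *)
Lemma maximizer_Lp_cvg : (\int[nu (k + m)]_r (`|psi j r - f r| `^ p)%:E @[j --> \oo] --> 0)%E.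
Proof.
have [N1 _] := maximizer_limit; have [f_ge0 _ _] := pf.
have mfp (g : R -> R) : measurable_fun setT g -> measurable_fun setT (fun r => (g r `^ p)%:E : \bar R).
  by move=> mg; apply/measurable_EFinP; exact: measurable_powR_fun.
have fp0 (g : R -> R) r : (0 <= (g r `^ p)%:E)%E by rewrite lee_fin powR_ge0.
have mf := measurable_profile pf; have mpsi j := measurable_profile (ppsi j).
pose mn j r := Num.min (psi j r) (f r).
have pmn j : profile (mn j).
  have [u0 uN un] := ppsi j; have [_ fN fn] := pf.
  split => [r|r r0|r s r0 rs].
  - by rewrite le_min u0 f_ge0.
  - by rewrite /mn uN// fN// minxx.
  - by rewrite le_min !ge_min un// fn// orbT.
have mmn j : measurable_fun setT (mn j) by exact: measurable_profile.
have cmn : (Np (mn j) @[j --> \oo] --> 1)%E.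
  rewrite -N1; apply: (Np_cvg k0 m0 q1 pmn pf mf f_ge0 cJ).
  - move=> r r0 nJ; have /cvgrPdist_le H := psif r0 nJ; apply/cvgrPdist_le => e e0.
    apply: filterS (H e e0) => j; rewrite /mn; case: (leP (psi j r) (f r)) => // _ _.
    by rewrite subrr normr0 ltW.
  - by move=> j r r0; rewrite ge_min lexx orbT.
  - by rewrite -/(Np f) N1 ltry.
have pt (x y : R) : 0 <= x -> 0 <= y ->
    `|x - y| `^ p + (Num.min x y `^ p + Num.min x y `^ p) <= x `^ p + y `^ p.
  move=> x0 y0; wlog xy : x y x0 y0 / x <= y.
    move=> Hw; case/orP: (le_total x y) => [xy|yx]; first exact: Hw.
    have := Hw y x y0 x0 yx; by rewrite distrC minC [leRHS]addrC.
  rewrite (min_l xy) addrA addrC lerD2l distrC ger0_norm ?subr_ge0//.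
  have := powR_superadditive (ltW (pexp_gt1 k0 m0 q1)) (_ : 0 <= y - x) x0.
  by rewrite subrK subr_ge0; apply.
have H j : (\int[nu (k + m)]_r (`|psi j r - f r| `^ p)%:E + (Np (mn j) + Np (mn j)) <= 1 + 1)%E.
  have md : measurable_fun setT (fun r => `|psi j r - f r|).
    by apply: measurableT_comp => //; exact: measurable_funB.
  rewrite -{1}(psiN j) -N1 -!ge0_integralD//; try by [exact: mfp|move=> r _; exact: fp0|
    move=> r _; rewrite adde_ge0|apply: emeasurable_funD; exact: mfp].
  apply: ge0_le_integral => //.
  - by move=> r _; rewrite !adde_ge0// lee_fin powR_ge0.
  - by apply: emeasurable_funD; [exact: (mfp (fun r => `|psi j r - f r|))|apply: emeasurable_funD; exact: mfp].
  - by apply: emeasurable_funD; exact: mfp.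
  - by move=> r _; rewrite -!EFinD lee_fin; apply: pt => //; have [] := ppsi j.
apply: (@squeeze_cvge _ _ _ _ (cst 0%E) _ (fun j => (1 + 1 - (Np (mn j) + Np (mn j)))%E)).
- apply: nearW => j; apply/andP; split; first by apply: integral_ge0 => r _; rewrite lee_fin powR_ge0.
  have mn1 : (Np (mn j) <= 1)%E.
    by apply: le_trans Np_limit_le1; apply: (Np_le k0 m0 q1) => // r; rewrite ge_min lexx orbT.
  have [y _ Ey] := Np_fin (pmn j) mn1.
  by rewrite leeBrDr ?Ey//= -Ey; exact: H.
- exact: cvg_cst.
- rewrite -[X in _ --> X](_ : (1 + 1 - (1 + 1))%E = 0%E); last by rewrite subee.
  apply: cvgeB => //; first exact: cvg_cst.
  exact: cvgeD.
Qed.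

End maximizing_limit.

Lemma cvg_subsequence (h : nat -> nat) : {homo h : i j / (i < j)%N} -> h j @[j --> \oo] --> \oo.
Proof.
move=> hh; have hge j : (j <= h j)%N.
  by elim: j => // j IH; exact: leq_ltn_trans IH (hh _ _ (ltnSn j)).
by apply/cvgnyPge => N; exists N => // j /= Nj; exact: leq_trans (hge j).
Qed.

(** * Rescaling and extraction for profiles *)

Section compactness.
Context {R : realType}.
Local Notation nu := (@radial_measure R).
Variables (k m : nat) (q : R).
Hypotheses (k0 : (0 < k)%N) (m0 : (0 < m)%N) (q1 : 1 < q).
Local Notation p := (pexp k m q).
Local Notation a := (aexp k m q).
Local Notation Np := (Np k m q).
Local Notation Mq := (Mq k m q).

Lemma Np_gt0 f (dl : R) : profile f -> 0 < dl -> (forall r : R, 0 < r -> r < 1 -> ~ jumps f r -> dl <= f r) ->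
  (0 < Np f)%E.
Proof.
move=> pf dl0 fdl; have [f0 _ _] := pf; have p0 := pexp_gt0 k0 m0 q1.
have km0 : (0 < k + m)%N by rewrite addn_gt0 k0.
have : (0 < (dl `^ p * (1 ^+ (k + m) * ballvol (k + m)))%:E)%E.
  by rewrite lte_fin expr1n mul1r mulr_gt0 ?powR_gt0 ?ballvol_gt0.
move/lt_le_trans; apply; rewrite EFinM -integral_radial_ball// -ge0_integralZl_EFin//; last 2 first.
- by apply/measurable_EFinP.
- by rewrite powR_ge0.
apply: ae_ge0_le_integral => //.
- by move=> r _; rewrite -EFinM lee_fin mulr_ge0// powR_ge0.
- by apply: emeasurable_funM => //; apply/measurable_EFinP.
- by move=> r _; rewrite lee_fin powR_ge0.
- by apply/measurable_EFinP; apply: measurable_powR_fun; exact: measurable_profile.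
apply: filterS (ae_profile_continuous km0 pf) => r [r0 nJ] _; rewrite -EFinM lee_fin indicE.
have [|_] := boolP (r \in _); last by rewrite mulr0 powR_ge0.
rewrite inE/= in_itv/= mulr1 => r1; apply: (ge0_ler_powR (ltW p0)); rewrite ?nnegrE//; first exact: ltW.
exact: fdl.
Qed.

(** After rescaling, every profile is at least [dl] at radius 1, hence on ]0, 1]. The Helly limit
    inherits this off its jumps and so is not zero. *)
Theorem profile_compactness (A : R) (phi : nat -> R -> R) : 0 < A ->
  (forall g, profile g -> Np g = 1%E -> (Mq g <= A%:E)%E) ->
  (forall j, profile (phi j)) -> (forall j, Np (phi j) = 1%E) ->
  (Mq (phi j) @[j --> \oo] --> A%:E)%E ->
  exists (h : nat -> nat) (s : nat -> R) (f : R -> R),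
    [/\ {homo h : i j / (i < j)%N}, forall j, 0 < s j, profile f, Np f = 1%E /\ Mq f = A%:E &
      (\int[nu (k + m)]_r (`|scale k m q (s j) (phi (h j)) r - f r| `^ p)%:E @[j --> \oo] --> 0)%E].
Proof.
move=> A0 MqA pphi phiN phiM.
have [dl dl0 Hdl] := nonvanishing k0 m0 q1 A0.
have [N _ NP] : \forall j \near \oo, ((A / 2)%:E <= Mq (phi j))%E.
  have /fine_cvgP[Mfin /cvgrPdist_lt cM] := phiM.
  have A2 : 0 < A / 2 by rewrite divr_gt0.
  move: Mfin (cM _ A2); apply: filterS2 => j Mj; rewrite -[Mq (phi j)]fineK// lee_fin /=.
  by rewrite ltr_norml; lra.
have [r rP] : {r : nat -> R & forall j, 0 < r j /\ dl <= r j `^ a * phi (N + j)%N (r j)}.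
  apply: (@choice _ _ (fun j (x : R) => 0 < x /\ dl <= x `^ a * phi (N + j)%N x)) => j.
  have [|x x0 xd] := Hdl _ (pphi (N + j)%N) (phiN _); last by exists x.
  by apply: NP => /=; exact: leq_addr.
(* Dilation by the inverse of [r j] moves the large value to radius 1; the shift by [N] skips the
   terms that are not yet near-maximizers. *)
pose psi0 j := scale k m q (r j)^-1 (phi (N + j)%N).
have rV0 j : 0 < (r j)^-1 by rewrite invr_gt0; have [] := rP j.
have ppsi0 j : profile (psi0 j) by exact: profile_scale.
have psi0N j : Np (psi0 j) = 1%E by rewrite Np_scale.
have psi01 j : dl <= psi0 j 1.
  rewrite /psi0 /scale invrK mulr1 -powR_inv1 ?(ltW (rP j).1)// -powRrM mulN1r opprK.
  by have [] := rP j.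
have [|h [f [hh pf psif]]] := helly_profile (D := fun t => weak_cst k m q * t `^ (- a)) ppsi0.
  by move=> j t t0; apply: profile_weak => //; rewrite psi0N.
have Nf0 : (0 < Np f)%E.
  apply: (@Np_gt0 f dl) => // t t0 t1 nJ.
  apply: (ler_cvg_to (cvg_cst dl) (psif t t0 nJ)); apply: nearW => j.
  have [_ _ un] := ppsi0 (h j).
  by apply: (le_trans (psi01 (h j))); apply: un => //; exact: ltW.
pose H j := (N + h j)%N.
have hH : {homo H : i j / (i < j)%N} by move=> i j ij; rewrite ltn_add2l hh.
have cH : H j @[j --> \oo] --> \oo.
  exact: cvg_subsequence.
have psiM : (Mq (psi0 (h j)) @[j --> \oo] --> A%:E)%E.
  rewrite (_ : (fun j => _) = (fun j => Mq (phi (H j)))); last by apply/funext => j; rewrite Mq_scale.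
  exact: cvg_comp cH phiM.
exists H, (fun j => (r (h j))^-1), f; split => //.
- exact: (maximizer_limit k0 m0 q1 A0 MqA (fun j => ppsi0 (h j)) (fun j => psi0N (h j)) pf psif psiM Nf0).
- exact: (maximizer_Lp_cvg k0 m0 q1 A0 MqA (fun j => ppsi0 (h j)) (fun j => psi0N (h j)) pf psif psiM Nf0).
Qed.

End compactness.

(** * Back to functions on R^n *)

Section radial_sup.
Context {R : realType}.
Local Notation nu := (@radial_measure R).
Variables (k m : nat) (q : R).
Hypotheses (k0 : (0 < k)%N) (m0 : (0 < m)%N) (q1 : 1 < q).
Local Notation p := (pexp k m q).
Local Notation Np := (Np k m q).
Local Notation Mq := (Mq k m q).

Let km0 : (0 < k + m)%N. Proof. by rewrite addn_gt0 k0. Qed.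
Let q0 : 0 < q. Proof. exact: qgt0. Qed.
Let p0 : 0 < p. Proof. exact: pexp_gt0. Qed.

(** The profile of the unit ball, open at 0 because profiles vanish there. *)
Definition step (r : R) : R := \1_(`]0, 1[%classic) r.

Lemma profile_step : profile step.
Proof.
split => [r|r r0|r s r0 rs]; rewrite /step ?indicE//.
- by rewrite memNset//= in_itv/= ltNge r0.
- have [|_] := boolP (s \in _); last by [].
  rewrite inE/= in_itv/= => /andP[_ s1].
  by rewrite mem_set//= in_itv/= r0 (le_lt_trans rs).
Qed.

Lemma Np_step : Np step = (ballvol (k + m))%:E.
Proof.
rewrite -[in RHS](mul1r (ballvol _)) -[in RHS](expr1n R (k + m)) -integral_radial_ball//.
have mind (D : set R) : measurable D -> measurable_fun setT (fun r : R => (\1_D r)%:E : \bar R).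
  by move=> mD; apply/measurable_EFinP.
apply: ge0_ae_eq_integral => //.
- by apply/measurable_EFinP; apply: measurable_powR_fun; exact: measurable_profile profile_step.
- exact: mind.
- by move=> r _; rewrite lee_fin powR_ge0.
apply: filterS (ae_radial_gt0 km0) => r r0 _; congr (_%:E).
have -> : step r = \1_(`]-oo, 1[%classic) r.
  rewrite /step !indicE.
  have [r1|r1] := ltP r 1; first by rewrite !mem_set//= in_itv/= ?r0.
  by rewrite !memNset//= in_itv/= ?r0 ltNge r1.
by rewrite indicE; case: (_ \in _); rewrite ?powR1// powR0// gt_eqF.
Qed.

(** For r and rho below 1/2 the norm sqrt (r^2 + rho^2) is below 1, so planes at distance less than
    1/2 meet the unit ball in a k-ball of radius at least 1/2. *)
Lemma Mq_step_gt0 : (0 < Mq step)%E.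
Proof.
have h0 : 0 < 2^-1 :> R by rewrite invr_gt0.
have [st0 _ _] := profile_step; have mst := measurable_profile profile_step.
pose c : R := 2^-1 ^+ k * ballvol k; have c0 : 0 < c by rewrite mulr_gt0 ?exprn_gt0 ?ballvol_gt0.
have : (0 < (c `^ q * (2^-1 ^+ m * ballvol m))%:E)%E.
  by rewrite lte_fin !mulr_gt0 ?powR_gt0 ?exprn_gt0 ?ballvol_gt0.
move/lt_le_trans; apply; rewrite EFinM -integral_radial_ball// -ge0_integralZl_EFin//; last 2 first.
- by apply/measurable_EFinP.
- by rewrite powR_ge0.
apply: ae_ge0_le_integral => //.
- by move=> r _; rewrite -EFinM lee_fin mulr_ge0// powR_ge0.
- by apply: emeasurable_funM => //; apply/measurable_EFinP.
- by move=> r _; exact: poweR_ge0.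
- apply: (measurableT_comp (measurable_poweR _)); apply: measurableT_comp => //.
  exact: measurable_ktrans mst st0.
apply: filterS (ae_radial_gt0 m0) => rho rho0 _; rewrite -EFinM indicE.
have [|_] := boolP (rho \in _); last by rewrite mulr0 poweR_ge0.
rewrite inE/= in_itv/= mulr1 => rho2; rewrite -poweR_EFin.
apply: gt0_ler_poweR; rewrite ?in_itv/= ?leey ?andbT ?abse_ge0 ?(ltW q0) ?lee_fin ?(ltW c0)//.
rewrite gee0_abs ?ktrans_ge0// /c -integral_radial_ball//.
apply: ae_ge0_le_integral => //.
- by apply/measurable_EFinP.
- by move=> r _; rewrite lee_fin.
- by apply/measurable_EFinP; apply: (measurableT_comp mst); exact: measurable_hypot.
apply: filterS (ae_radial_gt0 k0) => r r0 _; rewrite lee_fin indicE.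
have [|_] := boolP (r \in _); last by [].
rewrite inE/= in_itv/= => r2; rewrite /step indicE mem_set//= in_itv/=.
rewrite sqrtr_gt0 addr_gt0 ?exprn_gt0//= -[ltRHS]sqrtr1 ltr_sqrt//.
have : r ^+ 2 < 2^-1 ^+ 2 by rewrite ltrXn2r// ?nnegrE ltW.
have : rho ^+ 2 < 2^-1 ^+ 2 by rewrite ltrXn2r// ?nnegrE ltW.
by rewrite !expr2; lra.
Qed.

Lemma exists_profile_Mq_gt0 : exists phi : R -> R, [/\ profile phi, Np phi = 1%E & (0 < Mq phi)%E].
Proof.
have v0 := @ballvol_gt0 R (k + m); set c := (ballvol (k + m))^-1 `^ p^-1 : R.
have c0 : 0 < c by rewrite powR_gt0 ?invr_gt0.
exists (fun r => c * step r); split.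
- by apply: profileZ profile_step; exact: ltW.
- rewrite (NpZ _ _ _ (ltW c0) profile_step) Np_step -EFinM /c -powRrM mulVf ?gt_eqF//.
  by rewrite powRr1 ?invr_ge0 ?(ltW v0)// mulVf// gt_eqF.
- rewrite (MqZ _ _ _ (ltW c0) profile_step) mule_gt0 ?Mq_step_gt0// lte_fin powR_gt0//.
Qed.

(** The weak norm is controlled by the strong one, so [strong_bound] contains the boundedness of the
    transform on profiles and makes the supremum finite. *)
Lemma Mq_le_strong phi : profile phi -> Np phi = 1%E ->
  (Mq phi <= (strong_cst k m q * weak_cst k m q `^ (q - p))%:E)%E.
Proof.
move=> pphi N1; have [_ phiW] : weak_profile k m q phi by apply: profile_Np_le1 => //; rewrite N1.
by have := strong_bound k0 m0 q1 pphi (weak_cst_ge0 k m q) phiW; rewrite N1 mule1.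
Qed.

End radial_sup.

(** * Dictionary between admissible functions and profiles *)

Section admissible_profiles.
Context {R : realType}.
Local Notation nu := (@radial_measure R).
Variables (k m : nat) (q : R).
Hypotheses (k0 : (0 < k)%N) (m0 : (0 < m)%N) (q1 : 1 < q).
Local Notation p := (pexp k m q).
Local Notation Np := (Np k m q).
Local Notation Mq := (Mq k m q).
Local Notation lambda := (lebesgue_rV (k + m)).
Variable dtheta : probability (subspaces R (k + m)) R.
Hypothesis dtheta1 : dtheta (Gr k) = 1%E.

Let km0 : (0 < k + m)%N. Proof. by rewrite addn_gt0 k0. Qed.
Let q0 : 0 < q. Proof. exact: qgt0. Qed.
Let p0 : 0 < p. Proof. exact: pexp_gt0. Qed.

Definition has_profile (f : 'rV[R]_(k + m) -> R) (phi : R -> R) :=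
  [/\ measurable_fun setT f, profile phi & \forall x \ae lambda, f x = phi (enorm x)].

Lemma has_profile_enorm phi : profile phi -> has_profile (phi \o @enorm R (k + m)) phi.
Proof.
move=> pphi; split => //; last exact: nearW.
by apply: (measurableT_comp (measurable_profile pphi)); exact: measurable_enorm.
Qed.

Lemma Lnorm_has_profile f phi : has_profile f phi -> 'N[lambda]_p%:E[EFin \o f]%E = (Np phi `^ p^-1)%E.
Proof.
move=> [mf pphi fphi]; have [phi0 _ _] := pphi.
rewrite (Lnorm_radial p mf (measurable_profile pphi) fphi).
by rewrite /Np -(poweR_Lnorm_ge0 _ p0 phi0) -poweRrM mulfV ?gt_eqF// poweRe1// Lnorm_ge0.
Qed.

Lemma admissible_has_profile f : admissible p f -> exists2 phi, has_profile f phi & Np phi = 1%E.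
Proof.
move=> [fL N1 fr]; have mf : measurable_fun setT f by move: fL; rewrite inE => /andP[]; rewrite inE.
have [phi pphi fphi] := eq_rearr_profile km0 mf fr; exists phi => //.
have [phi0 _ _] := pphi.
rewrite /Np -(poweR_Lnorm_ge0 _ p0 phi0) -(Lnorm_radial p mf (measurable_profile pphi) fphi) N1.
by rewrite poweR1r.
Qed.

Lemma has_profile_admissible f phi : has_profile f phi -> Np phi = 1%E -> admissible p f.
Proof.
move=> fphi N1; have := Lnorm_has_profile fphi; rewrite N1 poweR1r => NE.
have [mf pphi fE] := fphi; split => //; last exact: profile_eq_rearr mf pphi fE.
by rewrite inE; apply/andP; split; rewrite inE//= /finite_norm NE ltry.
Qed.

Lemma affLnorm_has_profile f phi : has_profile f phi -> affLnorm k dtheta q (kplane f) = (Mq phi `^ q^-1)%E.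
Proof.
move=> [mf pphi fE]; have [phi0 _ _] := pphi.
rewrite (affLnorm_radial q dtheta1 mf (measurable_profile pphi) phi0 fE) addKn unlock//.
Qed.

Lemma kplane_ratio_admissible f : admissible p f -> kplane_ratio k dtheta p q f = affLnorm k dtheta q (kplane f).
Proof. by move=> [_ N1 _]; rewrite /kplane_ratio N1 inve1 mule1. Qed.

(* [A = S ^ q] where [S] is the supremum of the norm ratios. *)
Lemma kplane_supP : exists A : R, [/\ 0 < A, kplane_sup k dtheta p q = (A `^ q^-1)%:E &
  forall phi, profile phi -> Np phi = 1%E -> (Mq phi <= A%:E)%E].
Proof.
set S := kplane_sup k dtheta p q.
have qV0 : 0 < q^-1 by rewrite invr_gt0.
have MS phi : profile phi -> Np phi = 1%E -> (Mq phi `^ q^-1 <= S)%E.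
  move=> pphi N1; have hp := has_profile_enorm pphi; have ad := has_profile_admissible hp N1.
  apply: ereal_sup_ubound; exists (phi \o @enorm R (k + m)) => //.
  by rewrite kplane_ratio_admissible// (affLnorm_has_profile hp).
have Sle : (S <= ((strong_cst k m q * weak_cst k m q `^ (q - p)) `^ q^-1)%:E)%E.
  apply: ge_ereal_sup => _ [f ad <-]; have [phi hp N1] := admissible_has_profile ad.
  rewrite kplane_ratio_admissible// (affLnorm_has_profile hp) -poweR_EFin.
  have [_ pphi _] := hp; have MC := Mq_le_strong k0 m0 q1 pphi N1.
  apply: gt0_ler_poweR; rewrite ?in_itv/= ?leey ?andbT ?Mq_ge0 ?(ltW qV0)//.
  by apply: le_trans MC; exact: Mq_ge0.
have [phi [pphi N1 M0]] := exists_profile_Mq_gt0 k0 m0 q1.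
have S0 : (0 < S)%E by apply: lt_le_trans (MS _ pphi N1); rewrite poweR_gt0.
case: S S0 Sle MS => // s; rewrite lte_fin => s0 _ MS.
exists (s `^ q); split; first by rewrite powR_gt0.
- by rewrite -powRrM mulfV ?gt_eqF// powRr1// ltW.
- move=> g pg Ng.
  have -> : Mq g = ((Mq g `^ q^-1) `^ q)%E by rewrite -poweRrM mulVf ?gt_eqF// poweRe1// Mq_ge0.
  rewrite -poweR_EFin; apply: gt0_ler_poweR; rewrite ?in_itv/= ?leey ?andbT ?poweR_ge0 ?(ltW q0)//.
  - by rewrite lee_fin ltW.
  - exact: MS.
Qed.

End admissible_profiles.

(** * Rescaling and extremizing sequences on R^n *)

Section rescaling.
Context {R : realType}.
Local Notation nu := (@radial_measure R).
Variables (k m : nat) (q : R).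
Hypotheses (k0 : (0 < k)%N) (m0 : (0 < m)%N) (q1 : 1 < q).
Local Notation p := (pexp k m q).
Local Notation Np := (Np k m q).
Local Notation Mq := (Mq k m q).
Local Notation lambda := (lebesgue_rV (k + m)).

Let q0 : 0 < q. Proof. exact: qgt0. Qed.
Let p0 : 0 < p. Proof. exact: pexp_gt0. Qed.

Lemma ae_scalemx (c : R) (P : 'rV[R]_(k + m) -> Prop) : 0 < c ->
  (\forall x \ae lambda, P x) -> \forall x \ae lambda, P (c *: x).
Proof.
move=> c0 [N [mN N0 subN]]; exists ( *:%R c @^-1` N).
have mc : measurable ( *:%R c @^-1` N).
  by rewrite -[X in measurable X]setTI; exact: measurable_scalemx.
split => //; last by move=> x /= nP; exact: subN.
have := @ge0_integral_rV_scale R (k + m) c (fun x => (\1_N x)%:E) c0.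
have -> : (\int[lambda]_x (\1_N x)%:E = 0)%E by rewrite integral_indic// setIT; exact: N0.
move=> /(_ _ _)/eqP; rewrite mule_eq0 eqe gt_eqF ?exprn_gt0//= => H.
rewrite -[LHS](_ : (\int[lambda]_x (\1_N (c *: x))%:E = _)%E).
  by apply/eqP/H => [|x]; [exact/measurable_EFinP|rewrite lee_fin].
by rewrite -[X in lambda X]setIT -integral_indic.
Qed.

(** The exponent n/p of [rescale] is [aexp], by [aexpMp], so [rescale] acts on profiles as
    [scale]. *)
Lemma rescale_has_profile f phi (s : R) : 0 < s -> has_profile f phi ->
  @has_profile R k m (rescale p s f) (scale k m q s phi).
Proof.
move=> s0 [mf pphi fE]; split; last 1 first.
- have sV0 : 0 < s^-1 by rewrite invr_gt0.
  apply: filterS (ae_scalemx sV0 fE) => x fx.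
  rewrite /rescale /scale fx enormZ ?(ltW sV0)// gtr0_norm//; congr (_ `^ (- _) * _).
  by rewrite -(aexpMp k0 m0 q1) mulfK// gt_eqF.
- apply: measurable_funM => //; apply: (measurableT_comp mf); exact: measurable_scalemx.
- exact: profile_scale.
Qed.

Lemma poweR_cvg0 (u : nat -> \bar R) (r : R) : 0 < r -> (forall j, (0 <= u j)%E) ->
  (u j @[j --> \oo] --> 0)%E -> (u j `^ r @[j --> \oo] --> 0)%E.
Proof.
move=> r0 u0 /fine_cvgP[ufin uc]; apply/fine_cvgP; split.
  by apply: filterS ufin => j; case: (u j) => // x _; rewrite poweR_EFin.
rewrite (_ : fine \o _ = (fun j => fine (u j) `^ r)); last first.
  apply/funext => j /=; have := u0 j; case: (u j) => [x| |]//= _.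
  by rewrite gt_eqF//= powR0// gt_eqF.
rewrite -[X in _ --> X](@powR0 _ r) ?gt_eqF//; apply: cvg_powR => //.
by move=> j; rewrite fine_ge0.
Qed.

(** Extremizing sequences are stated with norms, the maximization argument with their q-th
    powers. *)
Lemma Mq_cvg_root (phi : nat -> R -> R) (A : R) : 0 < A -> (forall j, (Mq (phi j) <= A%:E)%E) ->
  (Mq (phi j) `^ q^-1 @[j --> \oo] --> (A `^ q^-1)%:E)%E -> (Mq (phi j) @[j --> \oo] --> A%:E)%E.
Proof.
move=> A0 MA cM; pose x j := fine (Mq (phi j)).
have ME j : Mq (phi j) = (x j)%:E.
  by rewrite /x; have := Mq_ge0 k m q (phi j); have := MA j; case: (Mq (phi j)).
have x0 j : 0 <= x j by rewrite -lee_fin -ME Mq_ge0.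
have xE y : 0 <= y -> (y `^ q^-1) `^ q = y.
  by move=> y0; rewrite -powRrM mulVf ?gt_eqF// powRr1.
rewrite (_ : (fun j => _) = (fun j => ((x j `^ q^-1) `^ q)%:E)); last first.
  by apply/funext => j; rewrite xE.
apply: cvg_EFin; first exact: nearW.
rewrite -[A]xE ?ltW//; apply: (cvg_powR q0); [by move=> j; exact: powR_ge0|exact: powR_ge0|].
rewrite (_ : (fun j => _) = fine \o (fun j => Mq (phi j) `^ q^-1)%E); first exact: fine_cvg cM.
by apply/funext => j /=; rewrite ME.
Qed.

Variable dtheta : probability (subspaces R (k + m)) R.
Hypothesis dtheta1 : dtheta (Gr k) = 1%E.

Lemma extremizing_compactness fs : extremizing k dtheta p q fs ->
  exists (h : nat -> nat) (sigma : nat -> R) (phi : R -> R),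
    let gs := fun j => rescale p (sigma j) (fs (h j)) in
    let f := phi \o @enorm R (k + m) in
    [/\ {homo h : i j / (i < j)%N}, forall j, 0 < sigma j, profile phi /\ Np phi = 1%E,
        extremizing k dtheta p q gs &
        'N[lambda]_p%:E[(fun x => (gs j x - f x)%:E)]%E @[j --> \oo] --> 0%E]
    /\ kplane_ratio k dtheta p q f = kplane_sup k dtheta p q.
Proof.
move=> [fad fS]; have [A [A0 SE MqA]] := kplane_supP k0 m0 q1 dtheta1.
have [phi phiP] : {phi : nat -> R -> R & forall j, has_profile (fs j) (phi j) /\ Np (phi j) = 1%E}.
  apply: (@choice _ _ (fun j g => has_profile (fs j) g /\ Np g = 1%E)) => j.
  by have [g hg N1] := admissible_has_profile k0 m0 q1 (fad j); exists g.
have hp j := (phiP j).1; have N1 j := (phiP j).2.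
have pphi j : profile (phi j) by have [] := hp j.
have aE j : affLnorm k dtheta q (kplane (fs j)) = (Mq (phi j) `^ q^-1)%E.
  exact: affLnorm_has_profile.
have phiM : (Mq (phi j) @[j --> \oo] --> A%:E)%E.
  apply: Mq_cvg_root => //; first by move=> j; exact: MqA.
  by rewrite -SE; move: fS; rewrite (_ : (fun j => _) = (fun j => (Mq (phi j) `^ q^-1)%E))//; apply/funext.
have [h [s [f [hh s0 pf [Nf Mf] cf]]]] := profile_compactness k0 m0 q1 A0 MqA pphi N1 phiM.
have hg j := rescale_has_profile (s0 j) (hp (h j)).
have hf := has_profile_enorm k m pf.
exists h, s, f; split; last first.
  rewrite kplane_ratio_admissible; last exact: has_profile_admissible hf Nf.
  by rewrite (affLnorm_has_profile q dtheta1 hf) Mf poweR_EFin SE.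
split; [exact: hh|exact: s0|exact: (conj pf Nf)| |].
- split; first by move=> j; apply: (has_profile_admissible k0 m0 q1 (hg j)); rewrite Np_scale.
  rewrite (_ : (fun j => _) = (fun j => affLnorm k dtheta q (kplane (fs (h j))))).
    exact: cvg_comp (cvg_subsequence hh) fS.
  by apply/funext => j; rewrite (affLnorm_has_profile q dtheta1 (hg j)) Mq_scale// aE.
have mfe : measurable_fun setT f by exact: measurable_profile.
have md j : measurable_fun setT (fun r => scale k m q (s j) (phi (h j)) r - f r).
  by apply: measurable_funB => //; apply: measurable_profile; exact: profile_scale.
rewrite (_ : (fun j => _) = (fun j => (\int[nu (k + m)]_r (`|scale k m q (s j) (phi (h j)) r - f r| `^ p)%:E) `^ p^-1)%E).
  apply: poweR_cvg0 => //; first by rewrite invr_gt0.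
  by move=> j; apply: integral_ge0 => r _; rewrite lee_fin powR_ge0.
apply/funext => j; have [mg pg gE] := hg j; have [mF _ _] := hf.
rewrite (@Lnorm_radial R (k + m) p (fun x => rescale p (s j) (fs (h j)) x - f (enorm x)) _ _ (md j)).
- by rewrite unlock.
- exact: measurable_funB.
- by apply: filterS gE => x ->.
Qed.

(** Attainment follows from compactness once some extremizing sequence exists; here the j-th term
    comes within 1/(j+1) of the finite supremum. *)
Lemma exists_extremizing : exists fs, extremizing k dtheta p q fs.
Proof.
have [A [A0 SE MqA]] := kplane_supP k0 m0 q1 dtheta1.
have Sfin : kplane_sup k dtheta p q \is a fin_num by rewrite SE.
have [fs fsP] : {fs : nat -> 'rV[R]_(k + m) -> R & forall j, admissible p (fs j) /\
    (kplane_sup k dtheta p q - (j.+1%:R^-1)%:E <= kplane_ratio k dtheta p q (fs j))%E}.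
  apply: (@choice _ _ (fun j f => admissible p f /\
    (kplane_sup k dtheta p q - (j.+1%:R^-1)%:E <= kplane_ratio k dtheta p q f)%E)) => j.
  have [|_ [f fad <-] /ltW flt] := @ub_ereal_sup_adherent _ _ j.+1%:R^-1 _ Sfin; last by exists f.
  by rewrite invr_gt0.
exists fs; split; first by move=> j; have [] := fsP j.
apply: (@squeeze_cvge _ _ _ _ (fun j => (kplane_sup k dtheta p q - (j.+1%:R^-1)%:E)%E) _
  (cst (kplane_sup k dtheta p q))).
- apply: nearW => j; have [ad le] := fsP j.
  rewrite -(kplane_ratio_admissible dtheta ad) le/=.
  by apply: ereal_sup_ubound; exists (fs j).
- rewrite SE -[X in _ --> X]sube0; apply: cvgeB => //; first exact: cvg_cst.
  by apply: cvg_EFin; [exact: nearW|exact: cvg_harmonic].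
- exact: cvg_cst.
Qed.

End rescaling.

Theorem theoremA2 (R : realType) (n k q : nat)
    (hn : (2 <= n)%N) (hk : (1 <= k <= n - 1)%N) (hq : (1 < q <= n + 1)%N)
    (p : R) (hp : p = n%:R * q%:R / (n%:R - k%:R + k%:R * q%:R))
    (dtheta : probability (subspaces R n) R)
    (hdtheta : rotation_invariant_prob k dtheta) :
  (forall fs : nat -> 'rV[R]_n -> R,
     extremizing k dtheta p q%:R fs ->
     exists (phi : nat -> nat) (sigma : nat -> R) (f : 'rV[R]_n -> R),
       let gs := fun j => rescale p (sigma j) (fs (phi j)) in
       [/\ {homo phi : i j / (i < j)%N},
           forall j, 0 < sigma j,
           f \in Lfun (lebesgue_rV n) p%:E /\ ~ (\forall x \ae lebesgue_rV n, f x = 0),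
           extremizing k dtheta p q%:R gs &
           'N[lebesgue_rV n]_p%:E[(fun x => (gs j x - f x)%:E)]%E @[j --> \oo] --> 0%E]) /\
  (exists2 f : 'rV[R]_n -> R, admissible p f &
     kplane_ratio k dtheta p q%:R f = kplane_sup k dtheta p q%:R).
Proof.
(* The codimension m = n - k is the dimension of the space of translations of a plane. *)
have [m m0 nE] : exists2 m, (0 < m)%N & n = (k + m)%N.
  by exists (n - k)%N; lia.
have {hk} k0 : (0 < k)%N by case/andP: hk.
subst n; have q1 : 1 < q%:R :> R by rewrite ltr1n; case/andP: hq.
have {hp} -> : p = pexp k m q%:R by rewrite hp /pexp [(k + m)%:R - _](_ : _ = m%:R)// natrD addrAC subrr add0r.
have [dtheta1 _] := hdtheta.
split => [fs /(extremizing_compactness k0 m0 q1 dtheta1)|]; last first.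
  have [fs /(extremizing_compactness k0 m0 q1 dtheta1)] := exists_extremizing k0 m0 q1 dtheta1.
  move=> [_ [_ [phi [[_ _ [pphi N1] _ _] fS]]]]; exists (phi \o @enorm R (k + m)) => //.
  exact: has_profile_admissible (has_profile_enorm k m pphi) N1.
move=> [h [s [phi [[hh s0 [pphi N1] gS cg] _]]]]; exists h, s, (phi \o @enorm R (k + m)); split => //.
have hphi := has_profile_enorm k m pphi.
have [fL Nf _] := has_profile_admissible k0 m0 q1 hphi N1.
(* A function vanishing almost everywhere has norm 0, while the limit has norm 1. *)
split => // f0; have p1 := pexp_gt1 k0 m0 q1.
have [mf _ _] := hphi; have := Lnorm_radial (pexp k m q%:R) mf (measurable_cst (0 : R)) f0.
rewrite Nf (_ : EFin \o _ = cst 0%E)// Lnorm0 ?eqe ?gt_eqF ?(lt_trans _ p1)// => /eqP.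
by rewrite eqe oner_eq0.
Qed.
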